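(* Let $f=\sum_{e\in E}a_ez^e\in\mathcal P$ be non-constant and $c\in C$. Then there is a canonical measure $\mu$ on $f^{-1}(c)$, characterized by $$\mu\big(f^{-1}(c)\cap(\alpha+\Delta_r)\big)=\lim_{n\to\infty}\frac{\#\{\text{zeros of }(f_n-c)^{p^n}\text{ in }\alpha+\Delta_r\}}{p^n}$$ for all $\alpha\in C$ and $r>0$, zeros counted with multiplicity. For every real $s$, the horizontal length of the segment of the Newton polygon of $f-c$ having slope $s$ (taken to be $0$ if there is no such segment) equals $\mu(\{z\in f^{-1}(c): v(z)=-s\})$. Also $\mu(f^{-1}(c))=\sup\{e: a_e\neq0\}$ (both sides possibly $+\infty$). If $f\in C[[z]]$ (an ordinary power series), then $\mu$ is the counting measure, i.e. $\mu(\{x\})$ is the multiplicity of $x$ as a zero of $f-c$. Finally, if $f\in\mathcal F$ is nonzero and $c=0$, then $\mu$ is a Haar measure on the locally compact group $\ker f$.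
   Context: Let $p$ be a prime, $q$ a power of $p$, and $C$ an algebraically closed field containing $\mathbb F_q$, complete with respect to a non-archimedean absolute value $|\cdot|$; $v(z)=-\log|z|$ ($v(0)=+\infty$), $\Delta_r=\{x\in C:|x|\le r\}$. $E=\{mp^n:m,n\in\mathbb Z,m\ge0\}$, with $z^{mp^n}=(z^{1/p^n})^m$. $\mathcal P$ is the set of series $\sum_{e\in E}a_ez^e$ ($a_e\in C$) converging at every $z\in C$ (for each $z$ and $r>0$ only finitely many terms exceed $r$ in absolute value); $\mathcal F\subseteq\mathcal P$ consists of those whose only exponents are $q^n$, $n\in\mathbb Z$. For $f=\sum a_ez^e\in\mathcal P$ and $n\ge0$, $f_n=\sum_{v_p(e)\ge-n}a_ez^e$, where $v_p$ is the $p$-adic valuation on $\mathbb Q$; thus $(f_n-c)^{p^n}$ is an everywhere convergent ordinary power series in $z$. The Newton polygon of $f=\sum a_ez^e\in\mathcal P$ is the lower convex hull of the points $(e,v(a_e))$ in $\mathbb R^2$. *)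

(* Defs.v *)
From HB Require Import structures.
From mathcomp Require Import all_boot all_order all_algebra.
From mathcomp Require Import finmap.
From mathcomp Require Import all_classical all_reals all_analysis.
From mathcomp.analysis.showcase Require summability.
Set Implicit Arguments.
Unset Strict Implicit.
Unset Printing Implicit Defensive.
Import Order.TTheory GRing.Theory Num.Theory.
Local Open Scope classical_set_scope.
Local Open Scope ring_scope.

(* The trivial absolute value is not excluded. *)
Record nonarch_absval (R : realType) (C : fieldType) := NonarchAbsval {
  absval :> C -> R ;
  absval_ge0 : forall x, 0 <= absval x ;
  absval_eq0 : forall x, (absval x == 0) = (x == 0) ;
  absvalM : forall x y, absval (x * y) = absval x * absval y ;
  absval_ultra : forall x y, absval (x + y) <= Num.max (absval x) (absval y)
}.

Section AbsvalTheory.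
Context {R : realType} {C : fieldType} (V : nonarch_absval R C).

Lemma absval0 : V 0 = 0.
Proof. by apply/eqP; rewrite absval_eq0. Qed.

Lemma absval1 : V 1 = 1.
Proof.
have V1 : V 1 != 0 by rewrite absval_eq0 oner_eq0.
by apply: (mulfI V1); rewrite -absvalM !mulr1.
Qed.

Lemma absvalN x : V (- x) = V x.
Proof.
suff VN1 : V (-1) = 1 by rewrite -mulN1r absvalM VN1 mul1r.
apply/eqP; rewrite -(@pexpr_eq1 _ _ 2) ?absval_ge0//.
by rewrite expr2 -absvalM mulrNN mulr1 absval1.
Qed.

Lemma absval_dist x y z : V (x - z) <= Num.max (V (x - y)) (V (y - z)).
Proof. by rewrite -(subrKA y) absval_ultra. Qed.

Lemma absval_triangle y x z : V (x - z) <= V (x - y) + V (y - z).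
Proof.
by rewrite (le_trans (absval_dist x y z))// ge_max lerDl lerDr !absval_ge0.
Qed.

Lemma absval_distC x y : V (x - y) = V (y - x).
Proof. by rewrite -opprB absvalN. Qed.

End AbsvalTheory.

(* The field C with the metric |x - y|. *)
Definition vtop (R : realType) (C : closedFieldType)
  (V : nonarch_absval R C) : Type := C.

Section VtopInstances.
Context {R : realType} {C : closedFieldType} (V : nonarch_absval R C).

HB.instance Definition _ := GRing.ClosedField.on (vtop V).
HB.instance Definition _ := isPointed.Build (vtop V) 0.

Let vdist (x y : vtop V) : R := V (x - y).

Let vdistxx x : vdist x x = 0.
Proof. by rewrite /vdist subrr absval0. Qed.

Let vdist_eq0 x y : vdist x y = 0 -> x = y.
Proof. by move=> /eqP; rewrite absval_eq0 subr_eq0 => /eqP. Qed.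

Let vdistC x y : vdist x y = vdist y x.
Proof. exact: absval_distC. Qed.

Let vdist_triangle y x z : vdist x z <= vdist x y + vdist y z.
Proof. exact: absval_triangle. Qed.

HB.instance Definition _ :=
  isMetric.Build R (vtop V) vdistxx vdist_eq0 vdistC vdist_triangle.

Lemma vtop_ballE (x : vtop V) r : ball x r = [set y : vtop V | V (x - y) < r].
Proof. by rewrite ballEmdist. Qed.

Let vtop_sub_continuous :
  continuous (fun x : vtop V * vtop V => x.1 - x.2).
Proof.
move=> [x y]; apply/cvg_ballP => e e0.
exists (ball x e, ball y e); first by split; exact: nbhsx_ballx.
case=> x' y' [/= xx' yy']; move: xx' yy'; rewrite !vtop_ballE /= => xx' yy'.
rewrite opprD addrACA; apply: (le_lt_trans (absval_ultra _ _ _)).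
by rewrite gt_max xx' -opprD absvalN.
Qed.

HB.instance Definition _ :=
  PreTopologicalNmodule_isTopologicalZmodule.Build (vtop V) vtop_sub_continuous.

Definition valuation (x : C) : \bar R :=
  if x == 0 then +oo%E else (- ln (V x))%:E.

Definition is_complete : Prop :=
  forall F : set_system (vtop V), ProperFilter F -> cauchy F -> cvg F.

Definition disc (alpha : C) (r : R) : set C := [set x | V (x - alpha) <= r].

End VtopInstances.

(* A series sum_e a_e z^e is its coefficient family a : rat -> C, required to
   vanish outside E. *)
Section FractionalSeries.
Context {R : realType} {C : closedFieldType} (V : nonarch_absval R C).
Variable p : nat.

Definition expE : set rat :=
  [set e | exists (m : nat) (n : int), e = m%:R * p%:R ^ n].

(* In characteristic p the N-th root is unique for N a power of p. *)
Definition nth_root (N : nat) (z : C) : C := xget 0 [set w | w ^+ N = z].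

(* Meant for e in E, so that denq e is a power of p and numq e >= 0. *)
Definition fpow (z : C) (e : rat) : C :=
  nth_root `|denq e|%N z ^+ `|numq e|%N.

Definition in_P (a : rat -> C) : Prop :=
  (forall e, a e != 0 -> expE e) /\
  (forall (z : C) (r : R), 0 < r ->
    finite_set [set e | r < V (a e * fpow z e)]).

Definition in_F (q : nat) (a : rat -> C) : Prop :=
  in_P a /\ (forall e, a e != 0 -> exists n : int, e = q%:R ^ n).

Definition is_power_series (a : rat -> C) : Prop :=
  forall e, a e != 0 -> exists n : nat, e = n%:R.

Definition nonconstant (a : rat -> C) : Prop :=
  exists2 e, e != 0 & a e != 0.

(* Limit of the finite partial sums along the directed set of finite sets of
   exponents. *)
Definition feval (a : rat -> C) (z : vtop V) : vtop V :=
  lim (summability.partial_sum (fun e => a e * fpow z e : vtop V)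
       @ summability.totally).

Definition fiber (a : rat -> C) (c : C) : set (vtop V) :=
  [set z | feval a z = c].

Definition sub_const (a : rat -> C) (c : C) : rat -> C :=
  fun e => a e - (if e == 0 then c else 0).

(* p-adic valuation of a nonzero rational. *)
Definition vp (e : rat) : int :=
  (logn p `|numq e|)%:Z - (logn p `|denq e|)%:Z.

Definition trunc (n : nat) (a : rat -> C) : rat -> C :=
  fun e => if (e == 0) || (- n%:Z <= vp e) then a e else 0.

End FractionalSeries.

Arguments fiber {R C} V a c.

Section PowerSeries.
Context {R : realType} {C : closedFieldType} (V : nonarch_absval R C).
Implicit Types g h : nat -> C.

Definition entire g : Prop := forall (z : C) (r : R), 0 < r ->
  finite_set [set n | r < V (g n * z ^+ n)].

Definition ps_mul g h : nat -> C :=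
  fun n => \sum_(i < n.+1) g i * h (n - i)%N.

Definition ps_exp g (k : nat) : nat -> C :=
  iter k (ps_mul g) (fun n => (n == 0%N)%:R).

(* Largest k such that (z - x)^k divides g among entire series, +oo for g = 0. *)
Definition zero_mult g (x : C) : \bar R :=
  ereal_sup [set k%:R%:E | k in
    [set k | exists2 h, entire h &
       g =1 ps_mul (ps_exp (fun n => ('X - x%:P)`_n) k) h]].

Definition num_zeros g (D : set C) : \bar R :=
  (\esum_(x in D) zero_mult g x)%E.

(* f_n - c is a power series in t = z^(1/p^n); its p^n-th power only involves
   powers of z = t^(p^n), and the coefficient of z^m is that of t^(m p^n). *)
Definition trunc_power (p : nat) (a : rat -> C) (c : C) (n : nat) : nat -> C :=
  fun m => ps_exp
    (fun j => sub_const (trunc p n a) c (j%:R / (p ^ n)%:R)) (p ^ n)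
    (m * p ^ n)%N.

End PowerSeries.

Section NewtonPolygon.
Context {R : realType} {C : closedFieldType} (V : nonarch_absval R C).

Definition convex_hull (A : set (R^o * R^o)) : set (R^o * R^o) :=
  smallest (@convex_set R (R^o * R^o)%type) A.

Definition newton_points (b : rat -> C) : set (R^o * R^o) :=
  [set P | exists e, P.1 = ratr e /\ valuation V (b e) = P.2%:E].

Definition newton_polygon (b : rat -> C) : set (R^o * R^o) :=
  [set P | convex_hull (newton_points b) P /\
     forall y, convex_hull (newton_points b) (P.1, y) -> P.2 <= y].

(* Segments contained in the polygon, running from P to P + (l, s * l); the
   degenerate ones (l = 0) give length 0 when the slope s does not occur. *)
Definition slope_length (b : rat -> C) (s : R) : \bar R :=
  ereal_sup [set l%:E | l in
    [set l : R | 0 <= l /\ exists P : R^o * R^o, forall t : R, 0 <= t <= l ->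
       newton_polygon b (P.1 + t, P.2 + s * t)]].

End NewtonPolygon.

(* A subset as a space; measurable types being pointed, a base point is carried
   along, on which neither the topology nor the Borel sets depend. *)
Definition pointed_subtype (T : Type) (A : set T) (x0 : A) : Type := A.

HB.instance Definition _ (T : topologicalType) (A : set T) (x0 : A) :=
  Topological.copy (pointed_subtype x0) (set_type A).
HB.instance Definition _ (T : topologicalType) (A : set T) (x0 : A) :=
  isPointed.Build (pointed_subtype x0) x0.

Definition pt_val (T : Type) (A : set T) (x0 : A) (x : pointed_subtype x0) : T :=
  set_val (x : A).

Definition borel (T : ptopologicalType) := g_sigma_algebraType (@open T).

HB.instance Definition _ (T : ptopologicalType) := Measurable.on (borel T).

Section Haar.
Context {R : realType} {T : topologicalZmodType} (G : set T) (x0 : G).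
Local Notation S := (pointed_subtype x0).

Definition is_locally_compact_group : Prop :=
  [/\ G 0, forall x y, G x -> G y -> G (x - y),
      hausdorff_space S & locally_compact [set: S]].

Definition translate (g : S) (A : set S) : set S :=
  [set y | exists2 x, A x & pt_val y = pt_val g + pt_val x].

(* A nonzero translation invariant Radon measure. *)
Definition is_haar_measure (mu : {measure set (borel S) -> \bar R}) : Prop :=
  [/\ mu [set: S] <> 0%E,
      forall (g : S) (A : set S), measurable (A : set (borel S)) ->
        mu (translate g A) = mu A,
      forall K : set S, compact K -> (mu K < +oo)%E,
      forall A : set S, measurable (A : set (borel S)) ->
        mu A = ereal_inf [set mu U | U in [set U : set S | open U /\ A `<=` U]] &
      forall U : set S, open U ->
        mu U = ereal_sup [set mu K | K in [set K : set S | compact K /\ K `<=` U]]].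

End Haar.

Section ZeroMeasure.
Context {R : realType} {C : closedFieldType} (V : nonarch_absval R C).
Context (p : nat) (a : rat -> C) (c : C) (x0 : fiber V a c).
Local Notation S := (pointed_subtype x0).

Definition zero_density_measure
    (mu : {measure set (borel S) -> \bar R}) : Prop :=
  forall (alpha : C) (r : R), 0 < r ->
    (fun n => num_zeros V (trunc_power p a c n) (disc V alpha r)
              * ((p ^ n)%:R^-1)%:E)%E @ \oo
    --> mu [set x : S | disc V alpha r (pt_val x)].

End ZeroMeasure.

(* Main.v *)
Require Import Defs.
From HB Require Import structures.
From mathcomp Require Import all_boot all_order all_algebra.
From mathcomp Require Import finmap finfield.
From mathcomp Require Import all_classical all_reals all_analysis.
From mathcomp.analysis.showcase Require summability.
From mathcomp Require Import ring lra zify.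
Set Implicit Arguments.
Unset Strict Implicit.
Unset Printing Implicit Defensive.
Import Order.TTheory GRing.Theory Num.Theory.
Local Open Scope classical_set_scope.
Local Open Scope ring_scope.

(** Write b for the coefficients of f - c.  In characteristic p the series
    g_n = (f_n - c)^(p^n) has m-th coefficient b(m/p^n)^(p^n).  The number of
    zeros of an entire series in the disc of radius r about alpha is the largest
    index at which its Taylor series at alpha attains the Gauss norm of radius r.
    Since g_(n+d) differs from g_n^(p^d) by terms that are small in Gauss norm,
    whereas the Gauss norm of g_n on a fixed disc is bounded below by beta^(p^n)
    for a constant beta > 0, the zero count of g_n in a fixed disc divided by p^n
    is eventually constant; call it the density of the disc.

    The zeros of g_n in a bounded disc lie within any prescribed distance of
    f^-1(c) once n is large, and conversely.  Hence f^-1(c) meets discs in compact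
    open sets, the density depends only on the trace of the disc on f^-1(c), and
    it is additive on partitions into discs.  By compactness it is a premeasure on
    the semiring of traces of discs, which generates the Borel sets; the measure is
    its Caratheodory extension.

    For discs centred at 0 the density is the largest exponent e maximising
    |b_e| r^e, which gives the Newton polygon and the total mass.  For f in the
    class F with c = 0 each g_n is additive, so translating a disc by a zero of f
    changes its Taylor series by a negligible constant: the measure is a Haar
    measure. *)

(** The obstacle is that f need not be a power series in any root of z, so no theory of zeros
    applies to it directly, and f^-1(c) may have no isolated point. What makes the passage through
    g_n work is that every bound relating g_n to f has the shape (constant)^(p^n): a Gauss term of
    g_n is the p^n-th power of a term of f - c, and |g_n(z) - (f(z) - c)^(p^n)| <= eta^(p^n) for
    large n. Taking p^n-th roots gives estimates uniform in n, and any eta < beta, such as beta/2,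
    beats the lower bound. The constant beta comes from the last exponent e maximising |b_e| rho^e
    at rho = max(r, |alpha|): for large n, e p^n is an index of g_n whose coefficient keeps its
    absolute value under re-expansion at alpha. Radii are arbitrary positive reals and the absolute
    value may be trivial, so Gauss norms replace suprema of |g| over discs. Zeros of an entire
    series are found by following a root from one polynomial truncation to the next rather than by
    Weierstrass preparation. *)

Lemma finite_set_nat_bound (S : set nat) :
  finite_set S -> exists N, forall n, (N <= n)%N -> ~ S n.
Proof.
move=> /finite_seqP[s ->]; exists (\max_(i <- s) i).+1 => n + /= ns.
by rewrite ltnNge (@leq_bigmax_seq _ _ xpredT id).
Qed.

Lemma invn_small (R : realType) (e : R) : 0 < e ->
  exists N, forall n, (N <= n)%N -> n.+1%:R^-1 < e.
Proof.
move=> e0; exists (Num.truncn e^-1) => n Nn; rewrite invf_plt ?posrE//.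
by apply: lt_le_trans (truncnS_gt _) _; rewrite ler_nat ltnS.
Qed.

(** * Ultrametric estimates and limits of sequences *)

Section Ultrametric.
Context {R : realType} {C : closedFieldType} (V : nonarch_absval R C).
Implicit Types (x y z : C) (e B r rho : R).

Lemma ler_exp n (u v : R) : 0 <= u -> u <= v -> u ^+ n <= v ^+ n.
Proof. by move=> u0 uv; rewrite lerXn2r ?nnegrE// (le_trans u0). Qed.

Lemma absvalX x n : V (x ^+ n) = V x ^+ n.
Proof. by elim: n => [|n IH]; rewrite ?expr0 ?absval1 // !exprS absvalM IH. Qed.

Lemma absval_add_le x y B : V x <= B -> V y <= B -> V (x + y) <= B.
Proof. by move=> xB yB; rewrite (le_trans (absval_ultra _ _ _))// ge_max xB. Qed.

Lemma absval_add_lt x y B : V x < B -> V y < B -> V (x + y) < B.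
Proof. by move=> xB yB; rewrite (le_lt_trans (absval_ultra _ _ _))// gt_max xB. Qed.

Lemma absval_sub_le x y B : V x <= B -> V y <= B -> V (x - y) <= B.
Proof. by move=> xB yB; apply: absval_add_le; rewrite ?absvalN. Qed.

Lemma absval_sub_lt x y B : V x < B -> V y < B -> V (x - y) < B.
Proof. by move=> xB yB; apply: absval_add_lt; rewrite ?absvalN. Qed.

Lemma absval_sum_le (I : Type) (s : seq I) (P : pred I) (F : I -> C) B :
  0 <= B -> (forall i, P i -> V (F i) <= B) -> V (\sum_(i <- s | P i) F i) <= B.
Proof.
move=> B0 H; elim/big_ind: _ => [||//]; first by rewrite absval0.
by move=> x y; apply: absval_add_le.
Qed.

Lemma absval_sum_lt (I : Type) (s : seq I) (P : pred I) (F : I -> C) B :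
  0 < B -> (forall i, P i -> V (F i) < B) -> V (\sum_(i <- s | P i) F i) < B.
Proof.
move=> B0 H; elim/big_ind: _ => [||//]; first by rewrite absval0.
by move=> x y; apply: absval_add_lt.
Qed.

Lemma absval_nat n : V n%:R <= 1.
Proof.
elim: n => [|n IH]; first by rewrite absval0.
by rewrite -natr1; apply: absval_add_le => //; rewrite absval1.
Qed.

Lemma absval_add_eq x y : V y < V x -> V (x + y) = V x.
Proof.
move=> yx; apply/eqP; rewrite eq_le; apply/andP; split.
  by apply: absval_add_le => //; exact: ltW.
rewrite leNgt; apply/negP => H.
have : V (x + y - y) < V x by apply: absval_sub_lt.
by rewrite addrK ltxx.
Qed.

Lemma absval_close_eq x y : V (x - y) < V y -> V x = V y.
Proof. by move=> H; rewrite -[x](subrK y) addrC absval_add_eq. Qed.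

Lemma absval_gt0 x : x != 0 -> 0 < V x.
Proof. by move=> x0; rewrite lt_neqAle absval_ge0 eq_sym absval_eq0 x0. Qed.

Lemma absval_small_eq0 x : (forall e, 0 < e -> V x <= e) -> x = 0.
Proof.
move=> H; apply/eqP/negPn/negP => /absval_gt0 x0.
have := H (V x / 2); rewrite divr_gt0// => /(_ isT); lra.
Qed.

(** [entire] and [in_P] test convergence at points of C, whereas Gauss norms use real radii. A point
    whose absolute value is at least the given radius bridges the two. The exception is the trivial
    absolute value, where every term has size 0 or 1 and convergence leaves finitely many of
    them. *)
Lemma absval_dichotomy :
  (forall x, x != 0 -> V x = 1) \/ (forall r, exists x, r <= V x).
Proof.
have [[x x1]|H] := pselect (exists x, 1 < V x).
  right => r; have x0 : 0 < V x - 1 by rewrite subr_gt0.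
  have bern n : 1 + n%:R * (V x - 1) <= V x ^+ n.
    elim: n => [|n IH]; first by rewrite mul0r addr0.
    rewrite exprSr; have n0 : 0 <= n%:R :> R by [].
    apply: le_trans (ler_wpM2r (ltW (lt_trans ltr01 x1)) IH).
    rewrite -natr1; have := mulr_ge0 n0 (sqr_ge0 (V x - 1)); nra.
  have [n rn] : exists n : nat, r / (V x - 1) < n%:R.
    by exists (Num.truncn (r / (V x - 1))).+1; exact: truncnS_gt.
  exists (x ^+ n); rewrite absvalX; apply: le_trans (bern n).
  by move: rn; rewrite ltr_pdivrMr// => rn; lra.
left => x x0; apply/eqP; rewrite eq_le; apply/andP; split.
  by rewrite leNgt; apply/negP => x1; apply: H; exists x.
rewrite leNgt; apply/negP => x1; apply: H; exists x^-1.
have := absvalM V x x^-1; rewrite divff// absval1 => E.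
have Vx := absval_gt0 x0.
by rewrite -(ltr_pM2l Vx) -E mulr1.
Qed.

Definition cv (u : nat -> C) (y : C) :=
  forall e, 0 < e -> exists N, forall n, (N <= n)%N -> V (u n - y) < e.

Lemma cv_unique u y z : cv u y -> cv u z -> y = z.
Proof.
move=> uy uz; apply/eqP; rewrite -subr_eq0; apply/eqP/absval_small_eq0 => e e0.
have [N HN] := uy _ e0; have [M HM] := uz _ e0.
rewrite -(subrKA (u (maxn N M))); apply: absval_add_le; apply: ltW.
  by rewrite absval_distC HN// leq_maxl.
by rewrite HM// leq_maxr.
Qed.

Lemma cv_cst y : cv (fun=> y) y.
Proof. by move=> e e0; exists 0%N => n _; rewrite subrr absval0. Qed.

Lemma cvD u v y z : cv u y -> cv v z -> cv (fun n => u n + v n) (y + z).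
Proof.
move=> uy vz e e0; have [N HN] := uy _ e0; have [M HM] := vz _ e0.
exists (maxn N M) => n; rewrite geq_max => /andP[Nn Mn].
by rewrite opprD addrACA; apply: absval_add_lt; [apply: HN|apply: HM].
Qed.

Lemma cvMl x u y : cv u y -> cv (fun n => x * u n) (x * y).
Proof.
move=> uy e e0; have x0 : 0 < V x + 1 by rewrite ltr_wpDl// absval_ge0.
have [N HN] := uy _ (divr_gt0 e0 x0); exists N => n /HN.
rewrite ltr_pdivlMr// => H; rewrite -mulrBr absvalM mulrC.
by apply: le_lt_trans H; rewrite ler_wpM2l ?absval_ge0// lerDl.
Qed.

Lemma cvN u y : cv u y -> cv (fun n => - u n) (- y).
Proof. by move/(cvMl (-1)); rewrite mulN1r; under eq_fun do rewrite mulN1r. Qed.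

Lemma cv_shift u y : cv (fun n => u n.+1) y -> cv u y.
Proof.
move=> uy e e0; have [N HN] := uy _ e0; exists N.+1 => -[//|n] Nn; exact: HN.
Qed.

Lemma cv_le u y x B N : (forall n, (N <= n)%N -> V (u n - x) <= B) -> cv u y ->
  V (y - x) <= B.
Proof.
move=> H uy; rewrite leNgt; apply/negP => By.
have yx0 : 0 < V (y - x) by apply: le_lt_trans By; exact: le_trans (absval_ge0 _ _) (H N (leqnn _)).
have [M HM] := uy _ yx0.
have : V (y - x) < V (y - x).
  rewrite -{1}(subrKA (u (maxn N M))); apply: absval_add_lt.
    by rewrite absval_distC HM// leq_maxr.
  by apply: le_lt_trans By; rewrite H// leq_maxl.
by rewrite ltxx.
Qed.

(** By the ultrametric inequality a sequence is Cauchy as soon as its consecutive differences tend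
    to 0. *)
Lemma cv_cauchy (hV : is_complete V) u :
  (forall e, 0 < e -> exists N, forall n, (N <= n)%N -> V (u n.+1 - u n) < e) ->
  exists y, cv u y.
Proof.
move=> H.
have H' e : 0 < e -> exists N, forall n, (N <= n)%N -> V (u n - u N) < e.
  move=> e0; have [N HN] := H _ e0; exists N => n /subnKC <-.
  elim: (n - N)%N => [|k IH]; first by rewrite addn0 subrr absval0.
  rewrite addnS -(subrKA (u (N + k)%N)); apply: absval_add_lt => //.
  by apply: HN; exact: leq_addr.
pose v : nat -> vtop V := u.
have cF : cauchy (v @ \oo).
  apply: cauchy_exP => e e0; have [N HN] := H' _ e0; exists (v N).
  rewrite /= vtop_ballE; exists N => // n /= Nn; rewrite absval_distC; exact: HN.
have /cvg_ex [y uy] : cvg (v @ \oo) by apply: hV.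
exists y => e e0; have /cvg_ballP/(_ _ e0) := uy.
case=> N _ HN; exists N => n Nn; have := HN n Nn.
by rewrite vtop_ballE /= absval_distC.
Qed.

End Ultrametric.

(** * Formal power series and Frobenius *)

Section FormalSeries.
Context {C : closedFieldType}.
Implicit Types (g h : nat -> C) (P Q : {poly C}).

Definition coefs P : nat -> C := fun n => P`_n.

(** Coefficient n of a product depends only on coefficients up to n, so identities between formal
    series can be read off from polynomials. *)
Lemma ps_mul_trunc g h N n : (n < N)%N ->
  ps_mul g h n = ((\poly_(i < N) g i) * (\poly_(i < N) h i))`_n.
Proof.
move=> nN; rewrite coefM; apply: eq_bigr => i _; rewrite !coef_poly.
have iN : (i < N)%N by apply: leq_trans nN; exact: ltn_ord.
by rewrite iN (leq_ltn_trans (leq_subr _ _) nN).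
Qed.

Lemma ps_mulA g h k : ps_mul g (ps_mul h k) = ps_mul (ps_mul g h) k.
Proof.
apply/funext => n.
transitivity ((\poly_(i < n.+1) g i * (\poly_(i < n.+1) h i * \poly_(i < n.+1) k i))`_n).
  rewrite coefM; apply: eq_bigr => i _.
  by rewrite coef_poly ltn_ord (@ps_mul_trunc _ _ n.+1)// ltnS leq_subr.
rewrite mulrA coefM; apply: eq_bigr => i _.
by rewrite coef_poly ltnS leq_subr (@ps_mul_trunc _ _ n.+1).
Qed.

Lemma ps_mul_coefs P Q : ps_mul (coefs P) (coefs Q) = coefs (P * Q).
Proof. by apply/funext => n; rewrite /coefs coefM. Qed.

Lemma ps_exp_coefs P k : ps_exp (coefs P) k = coefs (P ^+ k).
Proof.
elim: k => [|k IH]; first by apply/funext => n; rewrite /coefs coef1.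
by rewrite /ps_exp iterS -/(ps_exp _ _) IH ps_mul_coefs exprS.
Qed.

Lemma ps_mul1 h : ps_mul (coefs 1) h = h.
Proof.
apply/funext => n; rewrite /ps_mul big_ord_recl /= /coefs coef1 mul1r subn0.
by rewrite big1 ?addr0// => i _; rewrite coef1 /= mul0r.
Qed.

Lemma ps_mul_lin x h n : ps_mul (coefs ('X - x%:P)) h n =
  (if n is m.+1 then h m else 0) - x * h n.
Proof.
have -> : ps_mul (coefs ('X - x%:P)) h n = (('X - x%:P) * \poly_(i < n.+1) h i)`_n.
  by rewrite coefM; apply: eq_bigr => i _; rewrite coef_poly ltnS leq_subr.
rewrite mulrBl coefB coefXM coefCM !coef_poly leqnn.
by case: n => [//|n]; rewrite /= ltnS leqnSn.
Qed.

(** For x = 0 the product is a shift; for x != 0 the cofactor is recovered recursively from its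
    lowest coefficient. *)
Lemma ps_mul_lin_inj x : injective (ps_mul (coefs ('X - x%:P))).
Proof.
move=> g h /funeqP E; apply/funext => n.
have {}E m := E m; have [x0|x0] := eqVneq x 0.
  by have := E n.+1; rewrite !ps_mul_lin x0 !mul0r !subr0.
elim: n => [|n IH]; have := E _; [move/(_ 0%N)|move/(_ n.+1)].
  by rewrite !ps_mul_lin !sub0r => /oppr_inj/(mulfI x0).
by rewrite !ps_mul_lin IH => /addrI/oppr_inj/(mulfI x0).
Qed.

Lemma ps_exp_trunc g k N n : (n < N)%N ->
  ps_exp g k n = ((\poly_(i < N) g i) ^+ k)`_n.
Proof.
elim: k n => [|k IH] n nN; first by rewrite coef1.
rewrite /ps_exp iterS -/(ps_exp _ _) exprS coefM; apply: eq_bigr => i _.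
rewrite coef_poly IH; last by rewrite (leq_ltn_trans (leq_subr _ _) nN).
by rewrite (leq_trans (ltn_ord i)).
Qed.

(** The coefficients of g^q for q a power of the characteristic. *)
Definition frob (q : nat) g : nat -> C :=
  fun m => if (q %| m)%N then g (m %/ q)%N ^+ q else 0.

End FormalSeries.

Section Frobenius.
Context {C : closedFieldType} (p : nat) (pC : p \in [pchar C]).

Lemma pnat_pchar (A : comNzRingType) d : p \in [pchar A] -> [pchar A].-nat (p ^ d)%N.
Proof. by move=> pA; rewrite pnatX pnatE ?(pcharf_prime pA)// pA. Qed.

Lemma frob_sum (A : comNzRingType) (pA : p \in [pchar A]) d (I : Type) (s : seq I)
    (P : pred I) (F : I -> A) :
  (\sum_(i <- s | P i) F i) ^+ (p ^ d) = \sum_(i <- s | P i) F i ^+ (p ^ d).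
Proof.
have q0 : (0 < p ^ d)%N by rewrite expn_gt0 (prime_gt0 (pcharf_prime pA)).
elim/big_rec2: _ => [|i x y _ <-]; first by rewrite expr0n gtn_eqF.
by rewrite exprDn_pchar// pnat_pchar.
Qed.

Lemma frobB d (x y : C) : (x - y) ^+ (p ^ d) = x ^+ (p ^ d) - y ^+ (p ^ d).
Proof.
have E := @exprDn_pchar C (x - y) y _ (pnat_pchar d pC).
by rewrite subrK in E; rewrite E addrK.
Qed.

Lemma coef_frob (P : {poly C}) d : coefs (P ^+ (p ^ d)) = frob (p ^ d) (coefs P).
Proof.
have q0 : (0 < p ^ d)%N by rewrite expn_gt0 (prime_gt0 (pcharf_prime pC)).
have pP : p \in [pchar {poly C}] by rewrite pchar_poly.
apply/funext => m; rewrite /coefs -{1}[P]coefK poly_def frob_sum// coef_sum /frob.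
under eq_bigr => i _ do rewrite exprZn -exprM coefZ coefXn.
case: ifPn => [/dvdnP[k ->]|qm].
  rewrite mulnK//; under eq_bigr => i _ do rewrite eqn_pmul2r//.
  have [kP|Pk] := ltnP k (size P).
    rewrite (bigD1 (Ordinal kP)) //= eqxx mulr1 big1 ?addr0// => i ik.
    by rewrite eq_sym -(inj_eq val_inj) /= in ik; rewrite (negbTE ik) mulr0.
  rewrite nth_default// expr0n gtn_eqF//= big1// => i _.
  by rewrite gtn_eqF ?mulr0// (leq_trans (ltn_ord i)).
rewrite big1// => i _; case: eqP => [E|_]; last by rewrite mulr0.
by rewrite E dvdn_mull in qm.
Qed.

Lemma ps_exp_frob g d : ps_exp g (p ^ d) = frob (p ^ d) g :> (nat -> C).
Proof.
have q0 : (0 < p ^ d)%N by rewrite expn_gt0 (prime_gt0 (pcharf_prime pC)).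
apply/funext => m; rewrite (@ps_exp_trunc _ _ _ m.+1)//.
have := coef_frob (\poly_(i < m.+1) g i) d => /funeqP/(_ m); rewrite {1}/coefs => ->.
by rewrite /frob /coefs coef_poly ltnS leq_div.
Qed.

End Frobenius.

(** * Entire series: evaluation, division by a root, Taylor expansion *)

Section Convergence.
Context {R : realType} {C : closedFieldType} (V : nonarch_absval R C).
Context (hV : is_complete V).
Implicit Types (g h : nat -> C) (P Q : {poly C}) (x y z alpha : C).

Definition econv g := forall rho e : R, 0 < rho -> 0 < e ->
  exists N, forall n, (N <= n)%N -> V (g n) * rho ^+ n < e.

Lemma entire_conv g : entire V g <-> econv g.
Proof.
split=> [H rho e rho0 e0|H z r r0]; last first.
  have z0 : 0 < V z + 1 by rewrite ltr_wpDl// absval_ge0.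
  have [N HN] := H _ _ z0 r0; apply: (@sub_finite_set _ _ `I_N); last exact: finite_II.
  move=> n /= rn; rewrite ltnNge; apply/negP => /HN; apply/negP; rewrite -leNgt.
  rewrite (le_trans (ltW rn))// absvalM absvalX ler_wpM2l ?absval_ge0//.
  by rewrite lerXn2r ?nnegrE ?absval_ge0// ?ltW// ltrDl.
(* For the trivial absolute value, the threshold 1/2 at the point 1 picks out exactly the non-zero
   coefficients. *)
have [triv|/(_ rho)[z rz]] := absval_dichotomy V.
  have [] := finite_set_nat_bound (H 1 (1/2) _); first lra; move=> N HN; exists N => n /HN /=.
  rewrite expr1n mulr1; have [->|/triv ->] := eqVneq (g n) 0.
    by rewrite absval0 mul0r.
  by case; lra.
have [] := finite_set_nat_bound (H z (e / 2) _); first lra; move=> N HN; exists N => n /HN /= /negP.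
rewrite -leNgt absvalM absvalX => gn; apply: le_lt_trans (_ : e / 2 < e); last lra.
by apply: le_trans gn; rewrite ler_wpM2l ?absval_ge0// lerXn2r ?nnegrE ?absval_ge0// ltW.
Qed.

Lemma convB g h : econv g -> econv h -> econv (g \- h).
Proof.
move=> cg ch rho e rho0 e0; have [N HN] := cg _ _ rho0 e0.
have [M HM] := ch _ _ rho0 e0; exists (maxn N M) => n.
rewrite geq_max => /andP[Nn Mn] /=; rewrite -ltr_pdivlMr ?exprn_gt0//.
by apply: absval_sub_lt; rewrite ltr_pdivlMr ?exprn_gt0//; [apply: HN|apply: HM].
Qed.

Lemma econv_le g h : (forall n, V (h n) <= V (g n)) -> econv g -> econv h.
Proof.
move=> hg cg rho e rho0 e0; have [N HN] := cg _ _ rho0 e0; exists N => n /HN.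
by apply: le_lt_trans; rewrite ler_wpM2r ?hg// exprn_ge0// ltW.
Qed.

Lemma conv_scale k g : econv g -> econv (fun n => k * g n).
Proof.
move=> cg rho e rho0 e0; have k0 : 0 < V k + 1 by rewrite ltr_wpDl// absval_ge0.
have [N HN] := cg _ _ rho0 (divr_gt0 e0 k0); exists N => n /HN.
rewrite ltr_pdivlMr//; apply: le_lt_trans; rewrite absvalM -mulrA mulrC.
by rewrite ler_wpM2l ?mulr_ge0 ?absval_ge0 ?exprn_ge0// ?ltW// ltrDl.
Qed.

Lemma conv_addn j g : econv g -> econv (fun n => g (n + j)%N).
Proof.
move=> cg rho e rho0 e0.
have [N HN] := cg _ _ rho0 (mulr_gt0 e0 (exprn_gt0 j rho0)); exists N => n Nn.
have := HN (n + j)%N (leq_trans Nn (leq_addr _ _)).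
by rewrite exprD mulrA ltr_pM2r// exprn_gt0.
Qed.

Lemma conv_up h : econv h -> econv (fun n => if n is m.+1 then h m else 0).
Proof.
move=> ch rho e rho0 e0; have [N HN] := ch _ _ rho0 (divr_gt0 e0 rho0).
exists N.+1 => -[//|n] Nn; have := HN n Nn.
by rewrite ltr_pdivlMr// exprSr mulrA.
Qed.

Lemma conv_coefs P : econv (coefs P).
Proof.
move=> rho e _ e0; exists (size P) => n Pn.
by rewrite /coefs nth_default// absval0 mul0r.
Qed.

Lemma conv_lin x h : econv h -> econv (ps_mul (coefs ('X - x%:P)) h).
Proof.
move=> ch; have := convB (conv_up ch) (conv_scale x ch).
by congr econv; apply/funext => n; rewrite ps_mul_lin.
Qed.

Lemma conv_frob q g : (0 < q)%N -> econv g -> econv (frob q g).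
Proof.
move=> q0 cg rho e rho0 e0.
(* Below 1, raising to the power q does not increase a term. *)
have e1 : 0 < Num.min e 1 by rewrite lt_min e0 ltr01.
have [N HN] := cg _ _ (exprn_gt0 1 rho0) e1.
exists (N * q)%N => n Nn; rewrite /frob; case: ifPn => [/dvdnP[k nE]|_]; last first.
  by rewrite absval0 mul0r.
rewrite nE mulnK// in Nn *; rewrite leq_pmul2r// in Nn; have := HN _ Nn.
rewrite expr1 absvalX exprM -exprMn; set t := V _ * _ => tm.
have t0 : 0 <= t by rewrite mulr_ge0 ?absval_ge0// exprn_ge0// ltW.
have [te t1] : t < e /\ t < 1 by move: tm; rewrite lt_min => /andP[].
apply: le_lt_trans te; rewrite -[leRHS]expr1.
by apply: ler_wiXn2l => //; exact: ltW.
Qed.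

Definition psum g x n := \sum_(i < n) g i * x ^+ i.

Definition eval_ps g x : C := xget 0 [set y | cv V (psum g x) y].

Lemma ev_cv g x : econv g -> cv V (psum g x) (eval_ps g x).
Proof.
move=> cg; rewrite /eval_ps; case: xgetP => [y -> //|H].
exfalso; have [] := @cv_cauchy _ _ V hV (psum g x); last by move=> y /H.
move=> e e0; have x0 : 0 < V x + 1 by rewrite ltr_wpDl// absval_ge0.
have [N HN] := cg _ _ x0 e0; exists N => n /HN; apply: le_lt_trans.
rewrite /psum big_ord_recr /= [X in V (X - _)]addrC addrK absvalM absvalX.
by rewrite ler_wpM2l ?absval_ge0// ler_exp ?absval_ge0// lerDl.
Qed.

Lemma ev_eq g x y : econv g -> cv V (psum g x) y -> eval_ps g x = y.
Proof. by move=> /(ev_cv x); exact: cv_unique. Qed.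

Lemma evB g h x : econv g -> econv h -> eval_ps (g \- h) x = eval_ps g x - eval_ps h x.
Proof.
move=> cg ch; apply: ev_eq; first exact: convB.
have := cvD (ev_cv x cg) (cvN (ev_cv x ch)); congr cv; apply/funext => n.
by rewrite /psum -sumrB; apply: eq_bigr => i _; rewrite mulrBl.
Qed.

Lemma evZ k g x : econv g -> eval_ps (fun n => k * g n) x = k * eval_ps g x.
Proof.
move=> cg; apply: ev_eq; first exact: conv_scale.
have := cvMl k (ev_cv x cg); congr cv; apply/funext => n.
by rewrite /psum mulr_sumr; apply: eq_bigr => i _; rewrite mulrA.
Qed.

Lemma ev_shift g x : econv g -> eval_ps g x = g 0%N + x * eval_ps (fun n => g n.+1) x.
Proof.
move=> cg; apply: ev_eq => //; apply: cv_shift.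
have cg1 : econv (fun n => g n.+1).
  by have := conv_addn 1 cg; congr econv; apply/funext => n; rewrite addn1.
have := cvD (cv_cst V (g 0%N)) (cvMl x (ev_cv x cg1)); congr cv; apply/funext => n.
rewrite /psum big_ord_recl expr0 mulr1 mulr_sumr; congr (_ + _).
by apply: eq_bigr => i _; rewrite exprS mulrCA.
Qed.

Lemma ev_le g x (B : R) : econv g -> 0 <= B ->
  (forall n, V (g n) * V x ^+ n <= B) -> V (eval_ps g x) <= B.
Proof.
move=> cg B0 H; rewrite -[eval_ps g x]subr0; apply: (cv_le (N := 0) _ (ev_cv x cg)) => n _.
by rewrite subr0; apply: absval_sum_le => // i _; rewrite absvalM absvalX.
Qed.

Lemma ev_lt g x (B : R) : econv g -> 0 < B ->
  (forall n, V (g n) * V x ^+ n < B) -> V (eval_ps g x) < B.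
Proof.
move=> cg B0 H; have [N HN] := ev_cv x cg B0.
rewrite -[eval_ps g x](subrK (psum g x N)); apply: absval_add_lt.
  by rewrite absval_distC HN.
by apply: absval_sum_lt => // i _; rewrite absvalM absvalX.
Qed.

Lemma ev_coefs P x : eval_ps (coefs P) x = P.[x].
Proof.
apply: ev_eq; first exact: conv_coefs.
move=> e e0; exists (size P) => n Pn; rewrite (horner_coef_wide _ Pn).
by rewrite subrr absval0.
Qed.

Lemma ev_lin x h y : econv h -> eval_ps (ps_mul (coefs ('X - x%:P)) h) y = (y - x) * eval_ps h y.
Proof.
move=> ch; have -> : ps_mul (coefs ('X - x%:P)) h =
    (fun n => if n is m.+1 then h m else 0) \- (fun n => x * h n).
  by apply/funext => n; rewrite ps_mul_lin.
rewrite evB ?evZ//; [|exact: conv_up|exact: conv_scale].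
by rewrite ev_shift ?add0r ?mulrBl//; exact: conv_up.
Qed.

Definition rootprod (s : seq C) : {poly C} := \prod_(x <- s) ('X - x%:P).

Lemma conv_rootprod s h : econv h -> econv (ps_mul (coefs (rootprod s)) h).
Proof.
move=> ch; elim: s => [|x s IH]; first by rewrite /rootprod big_nil ps_mul1.
by rewrite /rootprod big_cons -ps_mul_coefs -ps_mulA; apply: conv_lin.
Qed.

Lemma ev_rootprod s h y : econv h ->
  eval_ps (ps_mul (coefs (rootprod s)) h) y = (\prod_(x <- s) (y - x)) * eval_ps h y.
Proof.
move=> ch; elim: s => [|x s IH]; first by rewrite /rootprod !big_nil ps_mul1 mul1r.
rewrite /rootprod !big_cons -ps_mul_coefs -ps_mulA ev_lin ?IH ?mulrA//.
exact: conv_rootprod.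
Qed.

(** Synthetic division: the tails h_n = g_(n+1) + g_(n+2) x + ... satisfy h_(n-1) = g_n + x h_n, and
    the recursion starts from g(x) = 0. *)
Lemma root_factor g x : econv g -> eval_ps g x = 0 ->
  exists2 h, econv h & g = ps_mul (coefs ('X - x%:P)) h.
Proof.
move=> cg gx; pose h n := eval_ps (fun m => g (m + n.+1)%N) x.
have cgn n : econv (fun m => g (m + n)%N) by apply: conv_addn.
have hE n : eval_ps (fun m => g (m + n)%N) x = g n + x * h n.
  rewrite ev_shift//; congr (_ + _ * _).
  by rewrite /h; congr eval_ps; apply/funext => m; rewrite addnS addSn.
exists h.
  (* r >= |x| absorbs the powers of x in the tails, and r >= 1 the shift of the index by one. *)
  move=> rho e rho0 e0; pose r := Num.max rho (Num.max 1 (V x)).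
  have [rr r1 rx] : [/\ rho <= r, 1 <= r & V x <= r] by rewrite /r !le_max !lexx !orbT.
  have r0 : 0 < r by exact: lt_le_trans r1.
  have [N HN] := cg _ _ r0 e0; exists N => n Nn.
  apply: le_lt_trans (_ : V (h n) * r ^+ n.+1 < e).
    rewrite ler_wpM2l ?absval_ge0// (@le_trans _ _ (r ^+ n))//.
      by rewrite ler_exp// ltW.
    by rewrite exprS ler_peMl// exprn_ge0// ltW.
  rewrite -ltr_pdivlMr ?exprn_gt0//; apply: ev_lt => //.
    by rewrite divr_gt0// exprn_gt0.
  move=> m; rewrite ltr_pdivlMr ?exprn_gt0//.
  apply: le_lt_trans (HN (m + n.+1)%N (leq_trans Nn _)); last by rewrite addnS -addSn leq_addl.
  rewrite -mulrA exprD ler_wpM2l ?absval_ge0// ler_wpM2r ?ler_exp ?absval_ge0//.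
  exact/exprn_ge0/ltW.
apply/funext => -[|n]; rewrite ps_mul_lin.
  have := hE 0%N; under [fun m => _]eq_fun do rewrite addn0.
  by rewrite gx => /eqP; rewrite eq_sym addr_eq0 => /eqP ->; rewrite sub0r.
by have := hE n.+1; rewrite -/(h n) => ->; rewrite addrK.
Qed.

(** Coefficient j of g(alpha + z), as a Hasse derivative: an ordinary derivative would have to be
    divided by j!, which may vanish in C. *)
Definition taylor alpha g : nat -> C :=
  fun j => eval_ps (fun m => g (m + j)%N *+ 'C(m + j, j)) alpha.

Lemma convT_arg g j : econv g -> econv (fun m => g (m + j)%N *+ 'C(m + j, j)).
Proof.
move=> cg; apply: econv_le (conv_addn j cg) => n.
by rewrite -mulr_natr absvalM ler_piMr ?absval_ge0// absval_nat.
Qed.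

Lemma T_term g j m alpha (rho : R) : 0 < rho -> V alpha <= rho ->
  V (g (m + j)%N *+ 'C(m + j, j)) * V alpha ^+ m * rho ^+ j <=
  V (g (m + j)%N) * rho ^+ (m + j).
Proof.
move=> rho0 ar; rewrite exprD mulrA ler_wpM2r//; first exact/exprn_ge0/ltW.
rewrite -mulr_natr absvalM; apply: ler_pM.
- by rewrite mulr_ge0 ?absval_ge0.
- by rewrite exprn_ge0 ?absval_ge0.
- by rewrite ler_piMr ?absval_ge0 ?absval_nat.
- by rewrite lerXn2r ?nnegrE ?absval_ge0// ltW.
Qed.

(** Re-expansion at a point of the disc does not enlarge the terms. Coefficient j involves only the
    g_m with m >= j; this restriction is what later controls the indices beyond the dominant one. *)
Lemma T_le g alpha (rho B : R) j : econv g -> 0 < rho -> V alpha <= rho -> 0 <= B ->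
  (forall m, (j <= m)%N -> V (g m) * rho ^+ m <= B) -> V (taylor alpha g j) * rho ^+ j <= B.
Proof.
move=> cg rho0 ar B0 H; rewrite -ler_pdivlMr ?exprn_gt0//.
apply: ev_le; [exact: convT_arg|by rewrite divr_ge0// exprn_ge0// ltW|move=> m].
by rewrite ler_pdivlMr ?exprn_gt0// (le_trans (T_term _ _ _ _ _))// H// leq_addl.
Qed.

Lemma T_lt g alpha (rho B : R) j : econv g -> 0 < rho -> V alpha <= rho -> 0 < B ->
  (forall m, (j <= m)%N -> V (g m) * rho ^+ m < B) -> V (taylor alpha g j) * rho ^+ j < B.
Proof.
move=> cg rho0 ar B0 H; rewrite -ltr_pdivlMr ?exprn_gt0//.
apply: ev_lt; [exact: convT_arg|by rewrite divr_gt0// exprn_gt0|move=> m].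
by rewrite ltr_pdivlMr ?exprn_gt0// (le_lt_trans (T_term _ _ _ _ _))// H// leq_addl.
Qed.

Lemma conv_T alpha g : econv g -> econv (taylor alpha g).
Proof.
move=> cg rho e rho0 e0; pose r := Num.max rho (V alpha).
have [rr ra] : rho <= r /\ V alpha <= r by rewrite /r !le_max !lexx orbT.
have r0 : 0 < r by exact: lt_le_trans rr.
have [N HN] := cg _ _ r0 e0; exists N => n Nn.
apply: le_lt_trans (_ : V (taylor alpha g n) * r ^+ n < e).
  by rewrite ler_wpM2l ?absval_ge0// ler_exp// ltW.
by apply: T_lt => // m nm; apply: HN; exact: leq_trans nm.
Qed.

Lemma TB alpha g h : econv g -> econv h -> taylor alpha (g \- h) = taylor alpha g \- taylor alpha h.
Proof.
move=> cg ch; apply/funext => j; rewrite /taylor /= -evB; [|exact: convT_arg..].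
by congr eval_ps; apply/funext => m; rewrite /= mulrnBl.
Qed.

Lemma T_head alpha g : taylor alpha g 0%N = eval_ps g alpha.
Proof. by rewrite /taylor; congr eval_ps; apply/funext => m; rewrite addn0 bin0. Qed.

Lemma T_coefs alpha P : taylor alpha (coefs P) = coefs (P \Po ('X + alpha%:P)).
Proof.
apply/funext => j; rewrite /taylor /coefs.
have -> : (fun m => P`_(m + j) *+ 'C(m + j, j)) = coefs P^`N(j).
  by apply/funext => m; rewrite /coefs coef_nderivn addnC.
rewrite ev_coefs /comp_poly addrC nderiv_taylor; last exact: mulrC.
rewrite size_map_polyC coef_sum.
under eq_bigr => i _.
  rewrite nderivn_map horner_map /= mul_polyC coefZ coefXn; over.
have [jP|Pj] := ltnP j (size P).
  rewrite (bigD1 (Ordinal jP)) //= eqxx mulr1 big1 ?addr0// => i ij.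
  by rewrite eq_sym -(inj_eq val_inj) /= in ij; rewrite (negbTE ij) mulr0.
rewrite big1 => [|i _]; last by rewrite gtn_eqF ?mulr0// (leq_trans (ltn_ord i)).
by rewrite nderivn_poly0// horner0.
Qed.

(* Polynomials are dense for the Gauss norm. *)
Lemma conv_density (rho : R) (A B : (nat -> C) -> C) : 0 < rho ->
  (forall g h, econv g -> econv h -> A (g \- h) = A g - A h) ->
  (forall g h, econv g -> econv h -> B (g \- h) = B g - B h) ->
  (forall e, 0 < e -> exists2 d, 0 < d & forall g, econv g ->
     (forall m, V (g m) * rho ^+ m <= d) -> V (A g) <= e) ->
  (forall e, 0 < e -> exists2 d, 0 < d & forall g, econv g ->
     (forall m, V (g m) * rho ^+ m <= d) -> V (B g) <= e) ->
  (forall P, A (coefs P) = B (coefs P)) -> forall g, econv g -> A g = B g.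
Proof.
move=> rho0 AB BB cA cB AE g cg; apply/eqP; rewrite -subr_eq0; apply/eqP.
apply: (@absval_small_eq0 _ _ V) => e e0.
have [d d0 Hd] := cA _ e0; have [d' d'0 Hd'] := cB _ e0.
have dd : 0 < Num.min d d' by rewrite lt_min d0.
have [N HN] := cg _ _ rho0 dd; pose P := \poly_(i < N) g i.
have cP := conv_coefs P; have cgP := convB cg cP.
have gP m : V ((g \- coefs P) m) * rho ^+ m <= Num.min d d'.
  rewrite /coefs /= coef_poly; case: ltnP => Nm; first by rewrite subrr absval0 mul0r ltW.
  by rewrite subr0 ltW// HN.
have -> : A g - B g = A (g \- coefs P) - B (g \- coefs P).
  by rewrite AB// BB// AE; ring.
apply: absval_sub_le.
  by apply: Hd => // m; apply: le_trans (gP m) _; rewrite ge_min lexx.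
by apply: Hd' => // m; apply: le_trans (gP m) _; rewrite ge_min lexx orbT.
Qed.

(** Both sides are additive in g and continuous for the Gauss norm of a radius bounding 1, alpha and
    y; on polynomials this is Taylor's formula. *)
Lemma ev_T alpha g y : econv g -> eval_ps (taylor alpha g) y = eval_ps g (alpha + y).
Proof.
move: g; pose r := Num.max 1 (Num.max (V alpha) (V y)).
have [r1 ra ry] : [/\ 1 <= r, V alpha <= r & V y <= r] by rewrite /r !le_max !lexx !orbT.
have ray : V (alpha + y) <= r by apply: absval_add_le.
have r0 : 0 < r by exact: lt_le_trans r1.
have evsmall z g e : econv g -> 0 < e -> V z <= r ->
    (forall m, V (g m) * r ^+ m <= e) -> V (eval_ps g z) <= e.
  move=> cg e0 zr H; apply: ev_le => //; first exact: ltW.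
  move=> n; apply: le_trans (H n); rewrite ler_wpM2l ?absval_ge0//.
  by rewrite lerXn2r ?nnegrE ?absval_ge0// ltW.
apply: (conv_density r0).
- by move=> g h cg ch; rewrite TB// evB//; exact: conv_T.
- by move=> g h cg ch; rewrite evB.
- move=> e e0; exists e => // g cg H; apply: evsmall => //; first exact: conv_T.
  by move=> m; apply: T_le => //; exact: ltW.
- by move=> e e0; exists e => // g cg H; apply: evsmall.
- by move=> P; rewrite T_coefs !ev_coefs horner_comp !hornerE addrC.
Qed.

Lemma T_lin alpha x h : econv h ->
  taylor alpha (ps_mul (coefs ('X - x%:P)) h) = ps_mul (coefs ('X - (x - alpha)%:P)) (taylor alpha h).
Proof.
move=> ch; apply/funext => j; move: h ch.
have alpha0 : 0 < V alpha + 1 by rewrite ltr_wpDl// absval_ge0.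
have aa : V alpha <= V alpha + 1 by rewrite lerDl.
set r := V alpha + 1 in alpha0 aa.
have linB z g h : ps_mul (coefs ('X - z%:P)) (g \- h) =
   ps_mul (coefs ('X - z%:P)) g \- ps_mul (coefs ('X - z%:P)) h.
  apply/funext => n /=; rewrite !ps_mul_lin /=; case: n => [|n]; rewrite mulrBr; ring.
have linS z g e : 0 < e -> (forall m, V (g m) * r ^+ m <= e / (r + V z)) ->
   forall m, V (ps_mul (coefs ('X - z%:P)) g m) * r ^+ m <= e.
  move=> e0 H m; have rz : 0 < r + V z by rewrite ltr_wpDr// absval_ge0.
  rewrite ps_mul_lin -ler_pdivlMr ?exprn_gt0//; apply: absval_sub_le.
    case: m => [|m]; first by rewrite absval0 expr0 divr1 ltW.
    rewrite ler_pdivlMr ?exprn_gt0// exprSr mulrA.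
    have := H m; rewrite ler_pdivlMr// => {}H; apply: le_trans H.
    apply: ler_wpM2l; last by rewrite lerDl absval_ge0.
    by rewrite mulr_ge0 ?absval_ge0// exprn_ge0// ltW.
  rewrite absvalM ler_pdivlMr ?exprn_gt0// -mulrA mulrC.
  have := H m; rewrite ler_pdivlMr// => {}H; apply: le_trans H.
  apply: ler_wpM2l; last by rewrite lerDr ltW.
  by rewrite mulr_ge0 ?absval_ge0// exprn_ge0// ltW.
have small z (e : R) : 0 < e -> 0 < e / (r + V z).
  by move=> e0; rewrite divr_gt0// ltr_wpDr// absval_ge0.
have coef1 (c e : R) : c * r ^+ j <= e * r ^+ j -> c <= e.
  by rewrite ler_pM2r// exprn_gt0.
apply: (conv_density alpha0).
- by move=> g h cg ch; rewrite linB TB//; exact: conv_lin.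
- by move=> g h cg ch; rewrite TB// linB.
- move=> e e0; have er : 0 < e * r ^+ j by rewrite mulr_gt0 ?exprn_gt0.
  exists (e * r ^+ j / (r + V x)); first exact: small.
  move=> g cg H; apply: coef1; apply: T_le => //; [exact: conv_lin|exact: ltW|].
  by move=> m _; apply: linS.
- move=> e e0; have er : 0 < e * r ^+ j by rewrite mulr_gt0 ?exprn_gt0.
  exists (e * r ^+ j / (r + V (x - alpha))); first exact: small.
  move=> g cg H; apply: coef1; apply: linS => // m; apply: T_le => //.
  exact/ltW/small.
- move=> P; rewrite ps_mul_coefs !T_coefs ps_mul_coefs.
  rewrite comp_polyM comp_polyB comp_polyX comp_polyC; congr (coefs (_ * _) j).
  by rewrite polyCB opprB addrA addrAC.
Qed.

(** Frobenius is additive without being linear, which is why the density argument asks only for maps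
    compatible with differences. *)
Lemma T_frob p (pC : p \in [pchar C]) alpha d g : econv g ->
  taylor alpha (frob (p ^ d) g) = frob (p ^ d) (taylor alpha g).
Proof.
move=> cg; apply/funext => j; move: g cg.
have q0 : (0 < p ^ d)%N by rewrite expn_gt0 (prime_gt0 (pcharf_prime pC)).
have alpha0 : 0 < V alpha + 1 by rewrite ltr_wpDl// absval_ge0.
have aa : V alpha <= V alpha + 1 by rewrite lerDl.
set r := V alpha + 1 in alpha0 aa.
have frB g h : frob (p ^ d) (g \- h) = frob (p ^ d) g \- frob (p ^ d) h.
  apply/funext => m; rewrite /frob /=; case: ifP => _; last by rewrite subrr.
  by rewrite frobB.
have frS g e : 0 < e -> (forall m, V (g m) * r ^+ m <= Num.min 1 e) ->
   forall m, V (frob (p ^ d) g m) * r ^+ m <= e.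
  move=> e0 H m; rewrite /frob; case: ifPn => [/dvdnP[k ->]|_]; last first.
    by rewrite absval0 mul0r ltW.
  rewrite mulnK// absvalX exprM -exprMn; have := H k; set t := V _ * _ => tm.
  have t0 : 0 <= t by rewrite mulr_ge0 ?absval_ge0// exprn_ge0// ltW.
  have [t1 te] : t <= 1 /\ t <= e by move: tm; rewrite le_min => /andP[].
  by apply: le_trans te; rewrite -[leRHS]expr1; apply: ler_wiXn2l.
have coef1 (c e : R) : c * r ^+ j <= e * r ^+ j -> c <= e.
  by rewrite ler_pM2r// exprn_gt0.
apply: (conv_density alpha0).
- by move=> g h cg ch; rewrite frB TB//; exact: conv_frob.
- by move=> g h cg ch; rewrite TB// frB.
- move=> e e0; have er : 0 < e * r ^+ j by rewrite mulr_gt0 ?exprn_gt0.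
  exists (Num.min 1 (e * r ^+ j)); first by rewrite lt_min ltr01.
  move=> g cg H; apply: coef1; apply: T_le => //; [exact: conv_frob|exact: ltW|].
  by move=> m _; apply: frS.
- move=> e e0; have er : 0 < e * r ^+ j by rewrite mulr_gt0 ?exprn_gt0.
  exists (Num.min 1 (e * r ^+ j)); first by rewrite lt_min ltr01.
  move=> g cg H; apply: coef1; apply: frS => // m; apply: T_le => //.
  by rewrite le_min ler01 ltW.
- move=> P; rewrite -coef_frob// !T_coefs -coef_frob//.
  by rewrite (rmorphXn (comp_poly _)).
Qed.

End Convergence.

(** * Dominant terms and zeros of entire series *)

Lemma seq_dominant (R : realType) (I : choiceType) (phi key : I -> R) (s : seq I) :
  s != [::] -> exists2 i, i \in s & forall j, j \in s ->
    phi j <= phi i /\ (key i < key j -> phi j < phi i).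
Proof.
elim: s => [//|x s IH] _; have [->|s0] := eqVneq s [::].
  by exists x; rewrite ?mem_head// => j; rewrite inE => /eqP ->; rewrite ltxx.
have [i si Hi] := IH s0.
have [xi|ix] := boolP ((phi i < phi x) || ((phi i == phi x) && (key i <= key x))).
  have pix : phi i <= phi x by case/orP: xi => [/ltW//|/andP[/eqP ->]].
  exists x; rewrite ?mem_head// => j; rewrite inE => /predU1P[->|/Hi[ji kij]].
    by rewrite ltxx.
  split; first exact: le_trans pix.
  move=> kxj; case/orP: xi => [|/andP[/eqP <- kix]]; first exact: le_lt_trans.
  by apply: kij; exact: le_lt_trans kxj.
exists i; rewrite ?inE ?si ?orbT// => j /predU1P[->|/Hi//].
move: ix; rewrite negb_or -leNgt => /andP[xi]; rewrite negb_and => /orP[ix|kxi].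
  by split => // _; rewrite lt_neqAle eq_sym ix.
by split => // kix; rewrite (ltW kix) in kxi.
Qed.

(** [key] breaks ties among the finitely many maximisers: the index or the exponent selects the last
    one, the opposite of the exponent the first. *)
Lemma exists_dominant (R : realType) (I : choiceType) (phi key : I -> R) :
  (exists i, 0 < phi i) -> (forall e, 0 < e -> finite_set [set i | e <= phi i]) ->
  exists i, [/\ 0 < phi i, forall j, phi j <= phi i &
    forall j, key i < key j -> phi j < phi i].
Proof.
move=> [i0 i00] fin; have /finite_seqP[s sE] := fin _ i00.
have inS j : (phi i0 <= phi j) = (j \in s).
  apply/idP/idP => H; first by have : [set` s] j by rewrite -sE.
  by have : [set i | phi i0 <= phi i] j by rewrite sE.
have [|i] := seq_dominant phi key (s := s).
  by have := inS i0; rewrite lexx; case: (s).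
rewrite -inS => ii Hi; exists i; split; first exact: lt_le_trans ii.
  move=> j; have [/[dup]|/ltW ji] := leP (phi i0) (phi j); last exact: le_trans ii.
  by rewrite {1}inS => /Hi[].
move=> j kij; have [/[dup]|ji] := leP (phi i0) (phi j); last exact: lt_le_trans ii.
by rewrite {1}inS => /Hi[_ ->].
Qed.

Section Dominance.
Context {R : realType} {C : closedFieldType} (V : nonarch_absval R C).
Context (hV : is_complete V).
Implicit Types (g h : nat -> C) (P Q : {poly C}) (x y z alpha beta : C) (rho r : R).

(* N is the number of zeros of g in the closed disc of radius rho. *)
Definition max_index g rho N := [/\ g N != 0,
  forall n, V (g n) * rho ^+ n <= V (g N) * rho ^+ N &
  forall n, (N < n)%N -> V (g n) * rho ^+ n < V (g N) * rho ^+ N].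

Lemma dom_unique g rho N M : max_index g rho N -> max_index g rho M -> N = M.
Proof.
move=> [_ gN gN'] [_ gM gM']; case: (ltngtP N M) => // NM.
  by have := gN' _ NM; rewrite ltNge gM.
by have := gM' _ NM; rewrite ltNge gN.
Qed.

Lemma dom_gt0 g rho N : 0 < rho -> max_index g rho N -> 0 < V (g N) * rho ^+ N.
Proof. by move=> r0 [gN _ _]; rewrite mulr_gt0 ?absval_gt0 ?exprn_gt0. Qed.

Lemma dom_exists g rho m : econv V g -> 0 < rho -> g m != 0 -> exists N, max_index g rho N.
Proof.
move=> cg r0 gm.
have [||N [N0 N1 N2]] := @exists_dominant R nat (fun n => V (g n) * rho ^+ n) (fun n => n%:R).
- by exists m; rewrite mulr_gt0 ?absval_gt0 ?exprn_gt0.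
- move=> e e0; have [N HN] := cg _ _ r0 e0.
  apply: (@sub_finite_set _ _ `I_N); last exact: finite_II.
  by move=> n /=; rewrite leNgt ltnNge; apply: contra => /HN.
exists N; split => // [|n Nn]; last by apply: N2; rewrite ltr_nat.
by apply: contraTneq N0 => ->; rewrite absval0 mul0r ltxx.
Qed.

(** Gauss's lemma with positions. A pair (i, j) with i + j = N + M other than (N, M) has i > N or j
    > M, so its contribution is strictly smaller and cannot cancel the dominant one; beyond N + M
    every pair is of this kind. *)
Lemma dom_mul g h rho N M : 0 < rho -> max_index g rho N -> max_index h rho M ->
  max_index (ps_mul g h) rho (N + M).
Proof.
move=> r0 dg dh; have A0 := dom_gt0 r0 dg; have B0 := dom_gt0 r0 dh.
case: dg dh => gN g1 g2 [hM h1 h2].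
set A := V (g N) * _ in A0 g1 g2; set B := V (h M) * _ in B0 h1 h2.
have AB0 : 0 < A * B by rewrite mulr_gt0.
have pos k n : 0 <= V (k n) * rho ^+ n by rewrite mulr_ge0 ?absval_ge0// exprn_ge0// ltW.
have split n i : (i <= n)%N -> V (g i * h (n - i)%N) * rho ^+ n =
    (V (g i) * rho ^+ i) * (V (h (n - i)%N) * rho ^+ (n - i)).
  by move=> ni; rewrite -{2}(subnKC ni) exprD absvalM; ring.
have le n i : (i <= n)%N -> V (g i * h (n - i)%N) <= A * B / rho ^+ n.
  by move=> ni; rewrite ler_pdivlMr ?exprn_gt0// split// ler_pM.
have lt n i : (i <= n)%N -> (N < i)%N || (M < n - i)%N ->
    V (g i * h (n - i)%N) < A * B / rho ^+ n.
  move=> ni H; rewrite ltr_pdivlMr ?exprn_gt0// split//.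
  case/orP: H => [/g2 H|/h2 H].
    apply: le_lt_trans (_ : A * B > V (g i) * rho ^+ i * B); last by rewrite ltr_pM2r.
    by rewrite ler_wpM2l.
  apply: le_lt_trans (_ : A * B > A * (V (h (n - i)%N) * rho ^+ (n - i))); last by rewrite ltr_pM2l.
  by rewrite ler_wpM2r.
have NM : V (ps_mul g h (N + M)%N) * rho ^+ (N + M) = A * B.
  rewrite /ps_mul; have NNM : (N < (N + M).+1)%N by rewrite ltnS leq_addr.
  rewrite (bigD1 (Ordinal NNM)) //= addKn.
  have VNM : V (g N * h M) = A * B / rho ^+ (N + M).
    by rewrite absvalM /A /B exprD; field; rewrite !expf_neq0 ?gt_eqF.
  rewrite absval_add_eq; first by rewrite VNM divfK// expf_neq0// gt_eqF.
  rewrite VNM; apply: absval_sum_lt; first by rewrite divr_gt0 ?exprn_gt0.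
  move=> i iN; apply: lt; first by rewrite -ltnS.
  have : nat_of_ord i <> N by move=> E; move/eqP: iN; apply; exact/val_inj.
  have := ltn_ord i; lia.
have NM' : V (ps_mul g h (N + M)%N) = A * B / rho ^+ (N + M).
  by rewrite -NM mulfK// expf_neq0// gt_eqF.
split.
- by rewrite -(absval_eq0 V) gt_eqF// NM' divr_gt0 ?exprn_gt0.
- move=> n; rewrite NM -ler_pdivlMr ?exprn_gt0//; apply: absval_sum_le.
    by rewrite divr_ge0 ?exprn_ge0// ltW.
  by move=> i _; apply: le; rewrite -ltnS.
- move=> n n1; rewrite NM -ltr_pdivlMr ?exprn_gt0//; apply: absval_sum_lt.
    by rewrite divr_gt0 ?exprn_gt0.
  move=> i _; apply: lt; first by rewrite -ltnS.
  by have := ltn_ord i; lia.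
Qed.

Lemma dom_const c rho : c != 0 -> max_index (coefs c%:P) rho 0.
Proof.
move=> c0; rewrite /coefs; split; rewrite ?coefC//= expr0 mulr1.
  by move=> [|n]; rewrite coefC /= ?expr0 ?mulr1// absval0 mul0r absval_ge0.
by move=> [//|n] _; rewrite coefC /= absval0 mul0r absval_gt0.
Qed.

Lemma dom_lin1 x rho : 0 < rho -> V x <= rho -> max_index (coefs ('X - x%:P)) rho 1.
Proof.
move=> r0 xr; have E n : coefs ('X - x%:P) n = (n == 1%N)%:R - (if n == 0%N then x else 0).
  by rewrite /coefs coefB coefX coefC.
split; rewrite ?E /= ?subr0 ?oner_eq0// absval1 mul1r expr1.
  move=> [|[|n]]; rewrite E /= ?sub0r ?subr0 ?absvalN ?expr0 ?mulr1// ?absval1 ?mul1r//.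
  by rewrite absval0 mul0r ltW.
by move=> [//|[//|n]] _; rewrite E /= subr0 absval0 mul0r.
Qed.

Lemma dom_lin0 x rho : 0 < rho -> rho < V x -> max_index (coefs ('X - x%:P)) rho 0.
Proof.
move=> r0 xr; have E n : coefs ('X - x%:P) n = (n == 1%N)%:R - (if n == 0%N then x else 0).
  by rewrite /coefs coefB coefX coefC.
have x0 : x != 0 by rewrite -(absval_eq0 V) gt_eqF// (lt_trans r0).
split; rewrite ?E /= ?sub0r ?oppr_eq0// absvalN expr0 mulr1.
  move=> [|[|n]]; rewrite E /= ?sub0r ?subr0 ?absvalN ?expr0 ?mulr1// ?absval1 ?mul1r// ?ltW//.
  by rewrite absval0 mul0r absval_gt0.
by move=> [//|[|n]] _; rewrite E /= subr0 ?absval1 ?mul1r// absval0 mul0r absval_gt0.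
Qed.

Lemma dom_perturb g g' rho N : 0 < rho -> max_index g rho N ->
  (forall m, V (g' m - g m) * rho ^+ m < V (g N) * rho ^+ N) ->
  max_index g' rho N /\ V (g' N) = V (g N).
Proof.
move=> r0 [gN g1 g2] H.
have E : V (g' N) = V (g N).
  by apply: absval_close_eq; have := H N; rewrite ltr_pM2r// exprn_gt0.
have dec m : g' m = (g' m - g m) + g m by rewrite subrK.
split => //; split; rewrite ?E.
- by rewrite -(absval_eq0 V) E absval_eq0.
- move=> n; rewrite dec -ler_pdivlMr ?exprn_gt0//; apply: absval_add_le.
    by rewrite ler_pdivlMr ?exprn_gt0// ltW.
  by rewrite ler_pdivlMr ?exprn_gt0.
- move=> n Nn; rewrite dec -ltr_pdivlMr ?exprn_gt0//; apply: absval_add_lt.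
    by rewrite ltr_pdivlMr ?exprn_gt0.
  by rewrite ltr_pdivlMr ?exprn_gt0// g2.
Qed.

(** Coefficient N of the re-expansion is g_N plus contributions of indices beyond N, strictly
    smaller at radius rho. So the dominant index does not depend on the centre chosen in the
    disc. *)
Lemma dom_T g alpha rho N : econv V g -> 0 < rho -> V alpha <= rho -> max_index g rho N ->
  max_index (taylor V alpha g) rho N /\ V (taylor V alpha g N) = V (g N).
Proof.
move=> cg r0 ar dg; have A0 := dom_gt0 r0 dg; case: (dg) => gN g1 g2.
pose u m := if m is m'.+1 then g (m + N)%N *+ 'C(m + N, N) else 0.
have cu : econv V u.
  apply: econv_le (convT_arg N cg) => -[|m] //=; by rewrite absval0 absval_ge0.
have TN : taylor V alpha g N - g N = eval_ps V u alpha.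
  rewrite /taylor ev_shift//; last exact: convT_arg.
  by rewrite add0n binn mulr1n addrC addKr [RHS]ev_shift// add0r.
have close : V (taylor V alpha g N - g N) < V (g N).
  rewrite TN; apply: ev_lt => //; first by rewrite absval_gt0.
  move=> [|m]; first by rewrite /u absval0 mul0r absval_gt0.
  rewrite -(ltr_pM2r (exprn_gt0 N r0)).
  apply: le_lt_trans (T_term _ _ _ r0 ar) _; apply: g2; lia.
have E := absval_close_eq close.
split => //; split; rewrite ?E.
- by rewrite -(absval_eq0 V) E absval_eq0.
- by move=> n; apply: T_le => //; exact: ltW.
- by move=> n Nn; apply: T_lt => // m nm; apply: g2; exact: leq_trans nm.
Qed.

Lemma dom_frob q g rho N : (0 < q)%N -> 0 < rho -> max_index g rho N ->
  max_index (frob q g) rho (N * q) /\ 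
  V (frob q g (N * q)%N) * rho ^+ (N * q) = (V (g N) * rho ^+ N) ^+ q.
Proof.
move=> q0 r0 dg; have A0 := dom_gt0 r0 dg; case: (dg) => gN g1 g2.
have E k : V (frob q g (k * q)%N) * rho ^+ (k * q) = (V (g k) * rho ^+ k) ^+ q.
  by rewrite /frob dvdn_mull// mulnK// absvalX exprM -exprMn.
have pos n : 0 <= V (g n) * rho ^+ n by rewrite mulr_ge0 ?absval_ge0// exprn_ge0// ltW.
split; last exact: E.
split; rewrite ?E.
- by rewrite /frob dvdn_mull// mulnK// expf_neq0.
- move=> n; have [/dvdnP[k ->]|qn] := boolP (q %| n)%N; first by rewrite E ler_exp.
  by rewrite /frob (negbTE qn) absval0 mul0r exprn_ge0.
- move=> n; have [/dvdnP[k ->]|qn] := boolP (q %| n)%N.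
    by rewrite ltn_pmul2r// E => /g2 H; rewrite ltrXn2r// gtn_eqF.
  by rewrite /frob (negbTE qn) absval0 mul0r exprn_gt0.
Qed.

(** In the expansion at y the difference of values has a factor x - y, and the Taylor terms at
    radius rho are still bounded by B. *)
Lemma ev_lip g x y rho (B : R) : econv V g -> 0 < rho -> V x <= rho -> V y <= rho ->
  0 <= B -> (forall i, V (g i) * rho ^+ i <= B) ->
  V (eval_ps V g x - eval_ps V g y) * rho <= V (x - y) * B.
Proof.
move=> cg r0 xr yr B0 H.
have cT := conv_T hV y cg; have xyr : V (x - y) <= rho by apply: absval_sub_le.
have -> : eval_ps V g x = eval_ps V (taylor V y g) (x - y) by rewrite ev_T// addrC subrK.
rewrite (ev_shift hV _ cT) T_head addrC addKr absvalM -mulrA ler_wpM2l ?absval_ge0//.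
rewrite -ler_pdivlMr//; apply: ev_le => //.
- by have := conv_addn 1 cT; congr econv; apply/funext => n; rewrite addn1.
- by rewrite divr_ge0// ltW.
move=> n; rewrite ler_pdivlMr// -mulrA.
have := T_le (j := n.+1) hV cg r0 yr B0 (fun m _ => H m); apply: le_trans.
by rewrite ler_wpM2l ?absval_ge0// exprSr ler_wpM2r ?ler_exp ?absval_ge0// ltW.
Qed.

(** If all roots were larger than rho, each linear factor would have dominant index 0, hence so
    would their product. *)
Lemma poly_root_exists P rho N : 0 < rho -> (0 < N)%N -> max_index (coefs P) rho N ->
  exists2 x, V x <= rho & P.[x] = 0.
Proof.
move=> r0 N0 dP; apply: contrapT => H.
have out x : P.[x] = 0 -> rho < V x.
  by move=> Px; rewrite ltNge; apply/negP => xr; apply: H; exists x.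
have P0 : P != 0 by case: dP => + _ _; apply: contra => /eqP ->; rewrite /coefs coef0.
have [s Ps] := closed_field_poly_normal P.
have sr x : x \in s -> rho < V x.
  move=> xs; apply: out; rewrite Ps hornerZ (_ : (\prod_(z <- s) _).[x] = 0) ?mulr0//.
  by apply/eqP; rewrite -[_ == 0]/(root _ x) root_prod_XsubC.
suff : max_index (coefs P) rho 0 by move/(dom_unique dP) => N00; rewrite N00 in N0.
rewrite Ps -mul_polyC -ps_mul_coefs -[0%N]/(0 + 0)%N; apply: dom_mul => //.
  by apply: dom_const; rewrite lead_coef_eq0.
elim: (s) sr => [|x t IH] sr; first by rewrite big_nil; apply: (dom_const _ (oner_neq0 _)).
rewrite big_cons -ps_mul_coefs -[0%N]/(0 + 0)%N; apply: dom_mul => //.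
  by apply: dom_lin0 => //; rewrite sr// mem_head.
by apply: IH => y yt; rewrite sr// inE yt orbT.
Qed.

(** At radius delta the term N of the expansion at y is at least as large as the constant term g(y),
    so the last dominant index there is positive and a zero follows. Existence of zeros is a
    hypothesis because the lemma serves first for polynomials, to construct zeros of series, and
    then for series. The value delta = 0 occurs when a truncation does not change. *)
Lemma near_root_aux g y rho (delta : R) N : econv V g -> 0 < rho -> (0 < N)%N ->
  max_index g rho N -> V y <= rho -> 0 <= delta -> V (eval_ps V g y) <= delta ^+ N * V (g N) ->
  (forall M, (0 < M)%N -> 0 < delta -> max_index (taylor V y g) delta M ->
     exists2 w, V w <= delta & eval_ps V (taylor V y g) w = 0) ->
  exists2 x, V (x - y) <= delta & eval_ps V g x = 0.
Proof.
move=> cg r0 N0 dg yr; rewrite le_eqVlt => /predU1P[<-|d0] gy H.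
  exists y; first by rewrite subrr absval0.
  apply/eqP; rewrite -(absval_eq0 V) eq_le absval_ge0 andbT.
  by move: gy; rewrite expr0n gtn_eqF// mul0r.
have [dT TN] := dom_T cg r0 yr dg.
have [M dM] : exists M, max_index (taylor V y g) delta M.
  by apply: (dom_exists (m := N)) => //; [exact: conv_T|case: dT].
have M0 : (0 < M)%N.
  rewrite lt0n; apply/eqP => M0; case: dM => _ _ /(_ N); rewrite M0 => /(_ N0).
  by rewrite expr0 mulr1 T_head TN ltNge mulrC gy.
have [w wd Tw] := H _ M0 d0 dM.
by exists (y + w); rewrite ?(addrC y) ?addrK// addrC -ev_T.
Qed.

(** A root of each truncation is followed to a root of the next. Successive distances are controlled
    by the new term, which tends to 0, so the roots converge. *)
Lemma root_exists g rho N : econv V g -> 0 < rho -> (0 < N)%N -> max_index g rho N ->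
  exists2 x, V x <= rho & eval_ps V g x = 0.
Proof.
move=> cg r0 N0 dg; have A0 := dom_gt0 r0 dg; case: (dg) => gN g1 g2.
pose P n := \poly_(i < n) g i.
have dP n : (N < n)%N -> max_index (coefs (P n)) rho N.
  move=> Nn; have PN : coefs (P n) N = g N by rewrite /coefs coef_poly Nn.
  split; rewrite ?PN// => m; last move=> Nm; rewrite /coefs coef_poly; case: ltnP => // _.
  - by rewrite absval0 mul0r ltW.
  - exact: g2.
  - by rewrite absval0 mul0r.
have near n y : (N < n)%N -> V y <= rho -> (P n).[y] = 0 ->
    exists x, [/\ V x <= rho, (P n.+1).[x] = 0 &
      V (x - y) ^+ N * V (g N) <= V (g n) * rho ^+ n].
  move=> Nn yr Py.
  (* t compares the new term with the dominant one, and d is the radius at which d^N |g_N| equals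
     the size of the new term. *)
  pose t := V (g n) * rho ^+ n / (V (g N) * rho ^+ N).
  have t0 : 0 <= t by rewrite divr_ge0 ?(ltW A0)// mulr_ge0 ?absval_ge0// exprn_ge0// ltW.
  have t1 : t <= 1 by rewrite ler_pdivrMr// mul1r.
  pose d := rho * t `^ N%:R^-1.
  have tN : (t `^ N%:R^-1) ^+ N = t.
    by rewrite -powR_mulrn ?powR_ge0// -powRrM mulVf ?powRr1// pnatr_eq0 gtn_eqF.
  have dN : d ^+ N * V (g N) = V (g n) * rho ^+ n.
    rewrite /d exprMn tN /t; field.
    by rewrite expf_neq0 gt_eqF// absval_gt0.
  have d0 : 0 <= d by rewrite mulr_ge0 ?powR_ge0// ltW.
  have dr : d <= rho.
    rewrite ger_pMr//; apply: (@le_trans _ _ (1 `^ N%:R^-1)); last by rewrite powR1.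
    by apply: ge0_ler_powR => //; rewrite ?nnegrE ?invr_ge0.
  have [||x xd Px] := @near_root_aux (coefs (P n.+1)) y rho d N (conv_coefs _ _) r0 N0
    (dP n.+1 (leqW Nn)) yr d0.
  - rewrite ev_coefs// /coefs coef_poly (leqW Nn) dN.
    have -> : P n.+1 = P n + (g n)%:P * 'X^n.
      apply/polyP => i; rewrite coefD coefCM coefXn !coef_poly ltnS.
      by case: ltngtP; rewrite ?mulr0 ?mulr1 ?addr0 ?add0r// => ->.
    rewrite hornerD Py add0r !hornerE absvalM absvalX ler_wpM2l ?absval_ge0//.
    by rewrite ler_exp ?absval_ge0.
  - move=> M M0 dd; rewrite T_coefs// => /(poly_root_exists dd M0)[w wd Pw].
    by exists w; rewrite ?ev_coefs.
  exists x; split.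
  - by rewrite -(subrK y x); apply: absval_add_le => //; exact: le_trans dr.
  - by rewrite -(ev_coefs hV).
  - by rewrite -dN ler_wpM2r ?absval_ge0// ler_exp ?absval_ge0.
(* The truncation of length N + 1 is the first to contain the dominant term. *)
have [u0 u0r Pu0] : exists2 x, V x <= rho & (P N.+1).[x] = 0.
  exact: poly_root_exists r0 N0 (dP _ (ltnSn N)).
pose S n y := [set x | [/\ V x <= rho, (P n.+1).[x] = 0 &
      V (x - y) ^+ N * V (g N) <= V (g n) * rho ^+ n]].
pose u := fix u k := if k is k'.+1 then xget 0 (S (N.+1 + k')%N (u k')) else u0.
have uP k : V (u k) <= rho /\ (P (N.+1 + k)%N).[u k] = 0.
  elim: k => [|k [IH1 IH2]]; first by rewrite addn0.
  rewrite /= -/(u k) addnS; case: xgetP => [x -> [] //|].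
  by have [|x Hx] := near _ _ _ IH1 IH2; [exact: leq_addr|move/(_ x)].
have uS k : V (u k.+1 - u k) ^+ N * V (g N) <= V (g (N.+1 + k)%N) * rho ^+ (N.+1 + k).
  have [IH1 IH2] := uP k; rewrite /= -/(u k); case: xgetP => [x -> [] //|].
  by have [|x Hx] := near _ _ _ IH1 IH2; [exact: leq_addr|move/(_ x)].
have [x ux] : exists x, cv V u x.
  apply: cv_cauchy => // e e0.
  have [M HM] := cg _ _ r0 (mulr_gt0 (exprn_gt0 N e0) (absval_gt0 V gN)).
  exists M => k Mk; rewrite ltNge; apply/negP => eu.
  have := HM (N.+1 + k)%N (leq_trans Mk (leq_addl _ _)); rewrite ltNge => /negP; apply.
  by apply: le_trans (uS k); rewrite ler_wpM2r ?absval_ge0// ler_exp// ltW.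
have xr : V x <= rho.
  by rewrite -(subr0 x); apply: (cv_le (N := 0) _ ux) => n _; rewrite subr0; case: (uP n).
exists x => //; apply: (@absval_small_eq0 _ _ V) => e e0.
have B0 := ltW A0.
have [M1 HM1] := ev_cv hV x cg e0.
have [M2 HM2] := ux _ (divr_gt0 (mulr_gt0 e0 r0) A0).
pose k := maxn M1 M2; have M1k : (M1 <= N.+1 + k)%N by rewrite /k; lia.
(* The first difference is the tail of g at x; the second is small because x is close to [u k], a
   root of the truncation. *)
have -> : eval_ps V g x = (eval_ps V g x - psum g x (N.+1 + k)%N) +
   (eval_ps V (coefs (P (N.+1 + k)%N)) x - eval_ps V (coefs (P (N.+1 + k)%N)) (u k)).
  rewrite !ev_coefs// (uP k).2 subr0 /P horner_poly /psum; ring.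
apply: absval_add_le; first by rewrite absval_distC ltW// HM1.
have PB i : V (coefs (P (N.+1 + k)%N) i) * rho ^+ i <= V (g N) * rho ^+ N.
  rewrite /coefs coef_poly; case: ifP => _ //; by rewrite absval0 mul0r.
have := ev_lip (conv_coefs _ _) r0 xr (uP k).1 B0 PB.
have /HM2/ltW : (M2 <= k)%N by rewrite leq_maxr.
rewrite ler_pdivlMr// absval_distC => H1 H2.
by rewrite -(ler_pM2r r0); exact: le_trans H1.
Qed.

Lemma near_root g y rho (delta : R) N : econv V g -> 0 < rho -> (0 < N)%N ->
  max_index g rho N -> V y <= rho -> 0 <= delta -> V (eval_ps V g y) <= delta ^+ N * V (g N) ->
  exists2 x, V (x - y) <= delta & eval_ps V g x = 0.
Proof.
move=> cg r0 N0 dg yr d0 gy; apply: (near_root_aux cg r0 N0 dg) => // M M0 dd.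
by apply: root_exists => //; exact: conv_T.
Qed.

Lemma dom0_ev g rho x : econv V g -> 0 < rho -> max_index g rho 0 -> V x <= rho ->
  V (eval_ps V g x) = V (g 0%N).
Proof.
by move=> cg r0 dg xr; have [_] := dom_T cg r0 xr dg; rewrite T_head.
Qed.

Lemma dom_T_exists g alpha r m : econv V g -> 0 < r -> g m != 0 ->
  exists N, max_index (taylor V alpha g) r N.
Proof.
move=> cg r0 gm; have a0 : 0 < V alpha + 1 by rewrite ltr_wpDl// absval_ge0.
have aa : V alpha <= V alpha + 1 by rewrite lerDl.
have [N dg] := dom_exists cg a0 gm.
have [[TN _ _] _] := dom_T cg a0 aa dg.
by apply: (dom_exists (m := N)) => //; exact: conv_T.
Qed.

(** A Weierstrass factorisation over a closed disc, with a list of zeros in place of the polynomial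
    factor so that multiplicities and subdiscs are handled by counting. *)
Definition decomp g alpha r s h := [/\ econv V h, g = ps_mul (coefs (rootprod s)) h,
  forall x, x \in s -> V (x - alpha) <= r &
  forall x, V (x - alpha) <= r -> eval_ps V h x != 0].

(** By multiplicativity, dividing out a zero lowers the dominant index by one; at dominant index 0
    the absolute value of g is constant on the disc and non-zero. *)
Lemma decomp_exists_dom g alpha r N : econv V g -> 0 < r -> max_index (taylor V alpha g) r N ->
  exists s h, decomp g alpha r s h.
Proof.
elim: N g => [|N IH] g cg r0 dg.
  exists [::], g; split=> //; first by rewrite /rootprod big_nil ps_mul1.
  move=> x xr; rewrite -[x](subrK alpha) addrC -ev_T// -(absval_eq0 V).
  rewrite (dom0_ev _ r0 dg)//; last exact: conv_T.
  by rewrite absval_eq0; case: dg.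
have [y yr Ty] := root_exists (conv_T hV alpha cg) r0 (ltn0Sn N) dg.
rewrite ev_T// in Ty; have [h ch gh] := root_factor hV cg Ty.
have [m hm] : exists m, h m != 0.
  apply: contrapT => H; case: dg => + _ _; rewrite gh T_lin//.
  have -> : h = coefs 0.
    apply/funext => m; rewrite /coefs coef0; apply/eqP/negPn/negP => hm.
    by apply: H; exists m.
  by rewrite T_coefs// comp_poly0 ps_mul_coefs mulr0 /coefs coef0 eqxx.
have [M dM] := dom_T_exists alpha ch r0 hm.
have : max_index (taylor V alpha g) r (1 + M).
  rewrite gh T_lin//; apply: dom_mul => //; apply: dom_lin1 => //.
  by rewrite addrC addKr.
move/(dom_unique dg)/eqP; rewrite add1n eqSS => /eqP NM; rewrite -NM in dM.
have [s [h' [ch' hE sr nz]]] := IH _ ch r0 dM.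
exists ((alpha + y) :: s), h'; split => //.
  by rewrite gh hE ps_mulA ps_mul_coefs /rootprod big_cons.
by move=> x; rewrite inE => /predU1P[->|/sr//]; rewrite addrC addKr.
Qed.

Lemma decomp_exists g alpha r m : econv V g -> 0 < r -> g m != 0 ->
  exists s h, decomp g alpha r s h.
Proof.
by move=> cg r0 gm; have [N] := dom_T_exists alpha cg r0 gm; exact: decomp_exists_dom.
Qed.

(** Each listed zero contributes 1 to the dominant index; a cofactor of positive index would have a
    zero in the disc. *)
Lemma decomp_dom g alpha r s h : 0 < r -> decomp g alpha r s h ->
  max_index (taylor V alpha g) r (size s).
Proof.
move=> r0 [ch -> sr nz]; elim: s sr => [|x s IH] sr.
  rewrite /rootprod big_nil ps_mul1 /=.
  have h0 : taylor V alpha h 0%N != 0 by rewrite T_head nz// subrr absval0 ltW.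
  have [[//|M] dM] := dom_exists (conv_T hV alpha ch) r0 h0.
  have [y yr] := root_exists (conv_T hV alpha ch) r0 (ltn0Sn M) dM.
  by rewrite ev_T// => /eqP E; have := nz (alpha + y); rewrite addrC addKr E => /(_ yr).
rewrite /rootprod big_cons -ps_mul_coefs -ps_mulA T_lin//; last exact: conv_rootprod.
rewrite -[size _]/(1 + size s)%N; apply: dom_mul => //.
  by apply: dom_lin1 => //; rewrite sr// mem_head.
by apply: IH => y ys; rewrite sr// inE ys orbT.
Qed.

Lemma rootprod_filter (a : pred C) s :
  rootprod s = rootprod (seq.filter a s) * rootprod (seq.filter (predC a) s).
Proof. by rewrite /rootprod !big_filter (bigID a). Qed.

Lemma decomp_root g alpha r s h x : decomp g alpha r s h -> V (x - alpha) <= r ->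
  (eval_ps V g x == 0) = (x \in s).
Proof.
move=> [ch -> sr nz] xr; rewrite ev_rootprod// mulf_eq0 (negbTE (nz _ xr)) orbF.
elim: s {sr} => [|y s IH]; first by rewrite big_nil oner_eq0.
by rewrite big_cons mulf_eq0 IH inE subr_eq0.
Qed.

(** Linear factors whose zero lies outside the smaller disc join the cofactor. *)
Lemma decomp_sub g alpha r s h beta t : decomp g alpha r s h ->
  (forall x, V (x - beta) <= t -> V (x - alpha) <= r) ->
  exists h', decomp g beta t [seq x <- s | V (x - beta) <= t] h'.
Proof.
move=> [ch gE sr nz] sub.
exists (ps_mul (coefs (rootprod [seq x <- s | ~~ (V (x - beta) <= t)])) h); split.
- exact: conv_rootprod.
- by rewrite gE ps_mulA ps_mul_coefs -(rootprod_filter (fun x => V (x - beta) <= t)).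
- by move=> x; rewrite mem_filter => /andP[].
- move=> x xt; rewrite ev_rootprod// mulf_neq0// ?nz ?sub//.
  rewrite big_seq; elim/big_ind: _ => [||y]; [exact: oner_neq0|exact: mulf_neq0|].
  by rewrite mem_filter => /andP[yt _]; rewrite subr_eq0; apply: contraNneq yt => <-.
Qed.

(** If a higher power of z - x divided g, cancelling (z - x)^k would make the remaining cofactor
    vanish at x. *)
Lemma zero_mult_decomp g alpha r s h x : decomp g alpha r s h -> V (x - alpha) <= r ->
  zero_mult V g x = (count_mem x s)%:R%:E.
Proof.
move=> [ch gE sr nz] xr; set k := count_mem x s.
pose h' := ps_mul (coefs (rootprod (seq.filter (predC (pred1 x)) s))) h.
have ch' : econv V h' by apply: conv_rootprod.
have rpE : rootprod (seq.filter (pred1 x) s) = ('X - x%:P) ^+ k.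
  rewrite /k /rootprod big_filter; elim: (s) => [|y t IH]; first by rewrite big_nil.
  by rewrite big_cons /=; case: eqP => [->|_]; rewrite IH ?add1n ?exprS// add0n.
have gE' : g = ps_mul (coefs (('X - x%:P) ^+ k)) h'.
  by rewrite gE -rpE /h' ps_mulA ps_mul_coefs -rootprod_filter.
have h'x : eval_ps V h' x != 0.
  rewrite ev_rootprod// mulf_neq0// ?nz//.
  rewrite big_seq; elim/big_ind: _ => [||y]; [exact: oner_neq0|exact: mulf_neq0|].
  by rewrite mem_filter /= subr_eq0 eq_sym => /andP[].
apply/eqP; rewrite eq_le; apply/andP; split.
  apply: ub_ereal_sup => _ [k' [h'' eh''] gE'' <-]; rewrite lee_fin ler_nat.
  have ch'' := (entire_conv V h'').1 eh''.
  rewrite leqNgt; apply/negP => kk'.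
  have E : ps_mul (coefs (('X - x%:P) ^+ k)) h' =
      ps_mul (coefs (('X - x%:P) ^+ k)) (ps_mul (coefs (('X - x%:P) ^+ (k' - k))) h'').
    rewrite -gE' ps_mulA ps_mul_coefs -exprD subnKC; last exact: ltnW.
    by apply/funext => n; rewrite gE'' -ps_exp_coefs.
  have inj j u v : ps_mul (coefs (('X - x%:P) ^+ j)) u = ps_mul (coefs (('X - x%:P) ^+ j)) v -> u = v.
    elim: j => [|j IH]; first by rewrite expr0 !ps_mul1.
    by rewrite exprS -ps_mul_coefs -!ps_mulA => /ps_mul_lin_inj.
  have /negP := h'x; apply; rewrite (inj _ _ _ E).
  rewrite -(prednK (n := k' - k)) ?subn_gt0// exprS -ps_mul_coefs -ps_mulA.
  rewrite ev_lin ?subrr ?mul0r//.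
  have -> : ('X - x%:P) ^+ (k' - k).-1 = rootprod (nseq (k' - k).-1 x).
    by rewrite /rootprod big_nseq iter_mulr_1.
  exact: conv_rootprod.
apply: ereal_sup_ubound; exists k => //; exists h'; first exact/entire_conv.
by move=> n; rewrite {1}gE' ps_exp_coefs.
Qed.

Lemma num_zeros_decomp g alpha r s h : decomp g alpha r s h ->
  num_zeros V g (disc V alpha r) = (size s)%:R%:E.
Proof.
move=> dg; rewrite /num_zeros.
under eq_esum => x xr do rewrite (zero_mult_decomp dg)//.
case: dg => _ _ sr _; elim: s sr => [|y s IH] sr.
  by rewrite esum1.
have yD : disc V alpha r y by apply: sr; rewrite mem_head.
rewrite (@eq_esum _ _ _ _ (fun x => (if x \in [set y] then 1 else 0)%:E + (count_mem x s)%:R%:E)%E); last first.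
  move=> x _ /=; rewrite -EFinD natrD; congr (_ + _)%:E.
  by have -> : (x \in [set y]) = (y == x) by [apply/idP/eqP; rewrite in_setE]; case: eqP.
rewrite esumD; [|by move=> x _; case: ifP|by move=> x _; rewrite lee_fin].
rewrite IH; last by move=> x xs; apply: sr; rewrite inE xs orbT.
rewrite (_ : (\esum_(x in disc V alpha r) (if x \in [set y] then 1 else 0)%:E)%E = 1%E).
  by rewrite -EFinD /= -natr1 addrC.
under eq_esum => x _ do rewrite fun_if.
rewrite -esum_mkcondr (_ : _ `&` _ = [set y]) ?esum_set1//.
by apply/seteqP; split => [x [_]|x ->]//.
Qed.

End Dominance.

(** * Fractional exponents, unordered sums and roots *)

Lemma rat_abs_num_den (e : rat) : 0 <= e ->
  e = `|numq e|%N%:R / `|denq e|%N%:R /\ (0 < `|denq e|)%N.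
Proof.
move=> e0; split; last by rewrite absz_gt0 denq_neq0.
rewrite -{1}(divq_num_den e) !pmulrn !abszE ger0_norm ?numq_ge0//.
by rewrite gtr0_norm ?denq_gt0.
Qed.

Lemma ratr_num_den (R : realType) (e : rat) : 0 <= e ->
  ratr e = `|numq e|%N%:R / `|denq e|%N%:R :> R.
Proof.
by move=> e0; rewrite {1}(rat_abs_num_den e0).1 fmorph_div /= !ratr_nat.
Qed.

(** [fpow] and [vp] read the reduced form of an exponent, while g_n is indexed by unreduced
    fractions m / p^n; t is the common factor. *)
Lemma natfrac_num_den (m d : nat) : (0 < d)%N ->
  exists t, [/\ (0 < t)%N, m = (`|numq (m%:R / d%:R)| * t)%N &
                d = (`|denq (m%:R / d%:R)| * t)%N].
Proof.
move=> d0; set e : rat := m%:R / d%:R.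
have e0 : 0 <= e by rewrite divr_ge0.
have [eE den0] := rat_abs_num_den e0; have := coprime_num_den e.
set u := `|numq e|%N in eE *; set v := `|denq e|%N in eE den0 *; move=> uv.
have E : (m * v = u * d)%N.
  apply/eqP; rewrite -(eqr_nat rat) !natrM -eqr_div ?pnatr_eq0 -?lt0n//.
  by rewrite -/e {1}eE.
have /dvdnP[t dt] : (v %| d)%N.
  by rewrite -(@Gauss_dvdr v u d) 1?coprime_sym// -E dvdn_mull.
exists t; split; last by rewrite mulnC.
  by move: d0; rewrite dt muln_gt0 => /andP[].
by apply/eqP; rewrite -(eqn_pmul2r den0) E dt; apply/eqP; lia.
Qed.

Lemma natfrac_inj (d : nat) : (0 < d)%N -> injective (fun m : nat => m%:R / d%:R : rat).
Proof.
move=> d0 m n /eqP; rewrite eqr_div ?pnatr_eq0 -?lt0n// -!natrM eqr_nat.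
by rewrite eqn_pmul2r// => /eqP.
Qed.

Section UnorderedSums.
Context {R : realType} {C : closedFieldType} (V : nonarch_absval R C).
Context (hV : is_complete V) (I : choiceType) (t : I -> C).
Context (fin : forall r, 0 < r -> finite_set [set e | r < V (t e)]).


Lemma big_fset_split (J J' : {fset I}) : (J `<=` J')%fset ->
  \sum_(i <- J') t i = \sum_(i <- J) t i + \sum_(i <- J' | i \notin J) t i.
Proof.
move=> /fsubsetP sub; rewrite (bigID (mem J)) /=; congr (_ + _).
rewrite big_fset_condE (_ : [fset i | i in J' & i \in J]%fset = J)//.
by apply/fsetP => i; rewrite !inE /=; case: (boolP (i \in J)) => [/sub ->|]; rewrite ?andbF.
Qed.

(** Let J k consist of the finitely many terms larger than 1/(k+1). By the ultrametric inequality,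
    any finite set of further terms adds at most 1/(k+1). *)
Lemma unordered_sum : exists W, forall e, 0 < e -> exists J : {fset I},
  forall J' : {fset I}, (J `<=` J')%fset -> V (\sum_(i <- J') t i - W) < e.
Proof.
pose J k : {fset I} := fset_set [set e | k.+1%:R^-1 < V (t e)].
have k0 k : 0 < k.+1%:R^-1 :> R by rewrite invr_gt0.
have JP k i : (i \in J k) = (k.+1%:R^-1 < V (t i)).
  rewrite in_fset_set; last exact: fin.
  by apply/idP/idP; rewrite in_setE.
have JS k (J' : {fset I}) : (J k `<=` J')%fset ->
    V (\sum_(i <- J') t i - \sum_(i <- J k) t i) <= k.+1%:R^-1.
  move=> sub; rewrite (big_fset_split sub) addrC addKr.
  apply: absval_sum_le => [|i]; first exact: ltW.
  by rewrite JP -leNgt.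
have [W HW] : exists W, cv V (fun k => \sum_(i <- J k) t i) W.
  apply: cv_cauchy => // e e0; have [N HN] := invn_small e0; exists N => n /HN.
  apply: le_lt_trans; apply: JS; apply/fsubsetP => i; rewrite !JP; apply: le_lt_trans.
  by rewrite lef_pV2 ?posrE// ler_nat.
exists W => e e0; have [N HN] := invn_small e0; have [M HM] := HW _ e0.
exists (J (maxn N M)) => J' sub.
rewrite -(subrKA (\sum_(i <- J (maxn N M)) t i)); apply: absval_add_lt.
  by apply: le_lt_trans (JS _ _ sub) _; rewrite HN// leq_maxl.
by rewrite HM// leq_maxr.
Qed.

Lemma unordered_sum_lim (W : vtop V) :
  (forall e, 0 < e -> exists J : {fset I},
    forall J' : {fset I}, (J `<=` J')%fset -> V (\sum_(i <- J') t i - W) < e) ->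
  lim (summability.partial_sum (t : I -> vtop V) @ summability.totally) = W.
Proof.
move=> H; have tF := @summability.totally_filter I.
apply: cvg_lim; first exact: metric_hausdorff.
apply/cvg_ballP => e e0; have [J HJ] := H _ e0.
exists J => // J' /= JJ'; rewrite vtop_ballE /= absval_distC.
by have := HJ _ JJ'; rewrite big_seq_fsetE.
Qed.

End UnorderedSums.

Section Roots.
Context {R : realType} {C : closedFieldType} (V : nonarch_absval R C).

Lemma nth_rootP N (z : C) : (0 < N)%N -> nth_root N z ^+ N = z.
Proof.
move=> N0; rewrite /nth_root; case: xgetP => [w -> //|H].
have [|w] := closed_rootP ('X^N - z%:P) _; first by rewrite size_XnsubC// eqSS -lt0n.
by rewrite rootE !hornerE subr_eq0 => /eqP /H.
Qed.

Lemma absval_root (w z : C) N : (0 < N)%N -> w ^+ N = z -> V w = V z `^ N%:R^-1.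
Proof.
move=> N0 <-; rewrite absvalX -powR_mulrn ?absval_ge0// -powRrM mulfV ?powRr1 ?absval_ge0//.
by rewrite pnatr_eq0 -lt0n.
Qed.

Lemma absval_fpow (z : C) (e : rat) : 0 <= e -> V (fpow z e) = V z `^ ratr e.
Proof.
move=> e0; have [_ den0] := rat_abs_num_den e0.
rewrite /fpow absvalX (absval_root den0 (nth_rootP z den0)) (ratr_num_den R e0).
by rewrite -powR_mulrn ?powR_ge0// -powRrM mulrC.
Qed.

Lemma powR_natfrac (x : R) (m q : nat) : (0 < q)%N -> 0 <= x ->
  (x `^ ratr (m%:R / q%:R)) ^+ q = x ^+ m.
Proof.
move=> q0 x0; rewrite fmorph_div /= !ratr_nat -powR_mulrn ?powR_ge0// -powRrM.
by rewrite divfK ?pnatr_eq0 -?lt0n// powR_mulrn.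
Qed.

End Roots.

(** * Truncations of f and their Frobenius powers *)

Section Truncations.
Context {R : realType} {C : closedFieldType} (V : nonarch_absval R C).
Context (hV : is_complete V) (p : nat) (pC : p \in [pchar C]).
Context (a : rat -> C) (ha : in_P V p a) (c : C).
Local Notation b := (sub_const a c).

Let hp : prime p. Proof. exact: pcharf_prime pC. Qed.
Let p0 n : (0 < p ^ n)%N. Proof. by rewrite expn_gt0 prime_gt0. Qed.

Lemma in_P_ge0 e : a e != 0 -> 0 <= e.
Proof.
by move=> /ha.1[m [n ->]]; rewrite mulr_ge0// exprz_ge0.
Qed.

Lemma in_P_frac e : a e != 0 -> exists n0, forall n, (n0 <= n)%N ->
  exists m : nat, e = m%:R / (p ^ n)%:R.
Proof.
have pn0 n : (p%:R : rat) ^+ n != 0 by rewrite expf_neq0// pnatr_eq0 -lt0n prime_gt0.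
move=> /ha.1[m [[k|k] ->]].
  exists 0%N => n _; exists (m * p ^ k * p ^ n)%N.
  by rewrite !natrM mulfK ?natrX// -exprnP.
exists k.+1 => n /subnK <-; exists (m * p ^ (n - k.+1))%N.
rewrite natrM !natrX exprD NegzE -exprnN; field.
by rewrite !pn0.
Qed.

Definition gauss_term (rho : R) (e : rat) : R := V (b e) * rho `^ ratr e.

Lemma in_P_finite (rho eps : R) : 0 < rho -> 0 < eps ->
  finite_set [set e | eps < V (a e) * rho `^ ratr e].
Proof.
move=> rho0 e0; have [triv|/(_ rho)[z rz]] := absval_dichotomy V.
  apply: sub_finite_set (ha.2 1 (1/2) _); last by lra.
  move=> e /=; have [->|ae] := eqVneq (a e) 0; first by rewrite absval0 mul0r; lra.
  by rewrite absvalM absval_fpow ?in_P_ge0// absval1 powR1 triv// => _; lra.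
apply: sub_finite_set (ha.2 z eps e0) => e /=.
have [->|ae] := eqVneq (a e) 0; first by rewrite absval0 mul0r ltNge (ltW e0).
rewrite absvalM absval_fpow ?in_P_ge0// => H; apply: lt_le_trans H _.
rewrite ler_wpM2l ?absval_ge0// ge0_ler_powR ?nnegrE ?absval_ge0 ?(ltW rho0)//.
by rewrite ler0q; exact: in_P_ge0.
Qed.

Lemma gauss_finite (rho eps : R) : 0 < rho -> 0 < eps ->
  finite_set [set e | eps < gauss_term rho e].
Proof.
move=> rho0 e0; apply: (@sub_finite_set _ _ ([set e | eps < V (a e) * rho `^ ratr e] `|` [set 0])).
  move=> e /=; rewrite /gauss_term /sub_const; case: eqP => [->|_]; first by right.
  by rewrite subr0; left.
by rewrite finite_setU; split; [exact: in_P_finite|exact: finite_set1].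
Qed.

Definition frob_trunc n : nat -> C := fun m => b (m%:R / (p ^ n)%:R) ^+ (p ^ n).

(** The reduced denominator of m / p^n divides p^n, so the valuation test in [trunc] succeeds on
    every exponent that occurs. *)
Lemma trunc_powerE n : trunc_power p a c n = frob_trunc n.
Proof.
apply/funext => m; rewrite /trunc_power ps_exp_frob// /frob dvdn_mull// mulnK// /frob_trunc.
congr (_ ^+ _); rewrite /sub_const /trunc; case: ifPn => //.
rewrite negb_or => /andP[e0]; set e : rat := _ / _ in e0 *.
have [t [t0 mE dE]] := natfrac_num_den m (p0 n).
have : (logn p `|denq e| <= n)%N.
  by rewrite -[X in (_ <= X)%N](pfactorK n hp) dvdn_leq_log// [X in (_ %| X)%N]dE dvdn_mulr.
rewrite /vp; lia.
Qed.

Lemma gn_gauss n m (rho : R) : 0 < rho ->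
  V (frob_trunc n m) * rho ^+ m = gauss_term rho (m%:R / (p ^ n)%:R) ^+ (p ^ n).
Proof.
move=> rho0; rewrite /frob_trunc absvalX /gauss_term exprMn powR_natfrac//; exact: ltW.
Qed.

Lemma gauss_ge0 (rho : R) e : 0 <= gauss_term rho e.
Proof. by rewrite mulr_ge0 ?absval_ge0// powR_ge0. Qed.

Lemma gn_conv n : econv V (frob_trunc n).
Proof.
move=> rho eps rho0 e0.
have d0 : 0 < Num.min 1 (eps / 2) by rewrite lt_min ltr01 divr_gt0.
have /finite_preimage := gauss_finite rho0 d0.
move=> /(_ _ (fun m : nat => m%:R / (p ^ n)%:R : rat)) [].
  by move=> x y _ _; exact: natfrac_inj.
move=> k kE; have [N HN] := finite_set_nat_bound (ex_intro _ k kE); exists N => m /HN /= /negP; rewrite -leNgt gn_gauss//.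
set u := gauss_term _ _; have u0 : 0 <= u by exact: gauss_ge0.
rewrite le_min => /andP[u1 ue]; apply: le_lt_trans (_ : eps / 2 < eps); last lra.
by apply: le_trans ue; rewrite -[leRHS]expr1 ler_wiXn2l.
Qed.

(* The exponents missing from f_n contribute at most eta on the disc of radius rho. *)
Definition tail n (rho eta : R) := forall e, a e != 0 ->
  (forall m : nat, e <> m%:R / (p ^ n)%:R) -> V (a e) * rho `^ ratr e <= eta.

(** At radius rho only finitely many terms exceed eta, and each of their exponents is a fraction
    over p^n from some n on. *)
Lemma tail_exists (rho eta : R) : 0 < rho -> 0 < eta ->
  exists n0, forall n, (n0 <= n)%N -> tail n rho eta.
Proof.
move=> rho0 eta0; have /finite_seqP[s sE] := in_P_finite rho0 eta0.
have [n0 Hn0] : exists n0, forall e, e \in s -> forall n, (n0 <= n)%N ->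
    exists m : nat, e = m%:R / (p ^ n)%:R.
  have : forall e, e \in s -> a e != 0.
    move=> e es; have : [set` s] e by []; rewrite -sE /=.
    by apply: contraPneq => ->; rewrite absval0 mul0r; apply/negP; rewrite -leNgt ltW.
  elim: (s) => [|e t IH] Ht; first by exists 0%N.
  have [n1 Hn1] : exists n0, forall e, e \in t -> forall n, (n0 <= n)%N ->
    exists m : nat, e = m%:R / (p ^ n)%:R.
    by apply: IH => x xt; apply: Ht; rewrite inE xt orbT.
  have [n2 Hn2] := in_P_frac (Ht e (mem_head _ _)).
  exists (maxn n1 n2) => x; rewrite inE => /predU1P[->|/Hn1 H] n; rewrite geq_max => /andP[? ?].
    exact: Hn2.
  exact: H.
exists n0 => n n0n e ae H; rewrite leNgt; apply/negP => ee.
have es : e \in s by have : [set e | eta < V (a e) * rho `^ ratr e] e by []; rewrite sE.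
by have [m /H] := Hn0 e es n n0n.
Qed.

(** Coefficients at multiples of p^d agree exactly; the others are 0 or come from exponents absent
    from f_n. *)
Lemma gn_frob n d m (rho eta : R) : 0 < rho -> 0 < eta -> tail n rho eta ->
  V (frob_trunc (n + d) m - frob (p ^ d) (frob_trunc n) m) * rho ^+ m <= eta ^+ (p ^ (n + d)).
Proof.
move=> rho0 eta0 tl; have pd0 k : ((p ^ k)%:R : rat) != 0 by rewrite pnatr_eq0 -lt0n p0.
rewrite /frob; case: ifPn => [/dvdnP[k ->]|dm].
  rewrite mulnK// /frob_trunc -exprM -expnD (_ : _ / _ = k%:R / (p ^ n)%:R) ?subrr.
    by rewrite absval0 mul0r exprn_ge0// ltW.
  by rewrite expnD !natrM; field; rewrite !pd0.
rewrite subr0 gn_gauss// ler_exp ?gauss_ge0// /gauss_term.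
set e : rat := _ / _; have e0 : e != 0.
  rewrite mulf_neq0 ?invr_eq0// pnatr_eq0; apply: contra dm => /eqP ->; exact: dvdn0.
rewrite /sub_const (negbTE e0) subr0; have [->|ae] := eqVneq (a e) 0.
  by rewrite absval0 mul0r ltW.
apply: tl => // k ek; move: dm; rewrite (_ : m = k * p ^ d)%N ?dvdn_mull//.
apply/eqP; rewrite -(eqr_nat rat) natrM; apply/eqP.
have : e * (p ^ (n + d))%:R = m%:R by rewrite /e divfK.
by rewrite ek => <-; rewrite expnD natrM mulrA divfK.
Qed.

Lemma feval_approx (z : C) (eps : R) : 0 < eps -> exists J : {fset rat},
  forall J' : {fset rat}, (J `<=` J')%fset ->
  V (\sum_(e <- J') a e * fpow z e - feval a (z : vtop V)) < eps.
Proof.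
move=> e0; have [W HW] := unordered_sum hV (ha.2 z).
by rewrite /feval (unordered_sum_lim HW); exact: HW.
Qed.

Lemma frob_inj d (x y : C) : x ^+ (p ^ d) = y ^+ (p ^ d) -> x = y.
Proof.
move=> E; apply/eqP; rewrite -subr_eq0.
have : (x - y) ^+ (p ^ d) == 0 by rewrite frobB// E subrr.
by rewrite expf_eq0 => /andP[].
Qed.

(** Roots of p-power order are unique in characteristic p, so the root chosen for the reduced
    denominator is a power of the one chosen for p^n. *)
Lemma fpow_frac (z : C) n m :
  fpow z (m%:R / (p ^ n)%:R) = nth_root (p ^ n) z ^+ m.
Proof.
have [t [t0 mE dE]] := natfrac_num_den m (p0 n); rewrite /fpow.
set e : rat := _ / _ in mE dE *.
have /(dvdn_pfactor _ _ hp)[k kn kE] : (`|denq e| %| p ^ n)%N by rewrite dE dvdn_mulr.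
rewrite [in RHS]mE mulnC exprM; congr (_ ^+ _); apply: (@frob_inj k).
by rewrite -kE nth_rootP ?kE// -exprM mulnC -kE -dE nth_rootP.
Qed.

(* g_n(z) is the p^n-th power of f_n(z) - c, and f_n approximates f. *)
Lemma gn_feval n (z : C) (rho eta : R) : 0 < rho -> 0 < eta -> V z <= rho ->
  tail n rho eta ->
  V (eval_ps V (frob_trunc n) z - (feval a (z : vtop V) - c) ^+ (p ^ n)) <= eta ^+ (p ^ n).
Proof.
move=> rho0 eta0 zr tl; set q := (p ^ n)%N; set W : C := feval _ _.
have etaq : 0 < eta ^+ q by rewrite exprn_gt0.
have [J HJ] := feval_approx z eta0.
have [N1 HN1] := ev_cv hV z (gn_conv n) etaq.
have [N2 HN2] := gn_conv n rho0 etaq.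
pose N := (maxn N1 N2).+1; pose f (m : nat) : rat := m%:R / q%:R.
(* K holds the exponents of the first N terms of g_n. Enlarging J by K preserves the approximation
   of f(z). *)
pose K : {fset rat} := seq_fset tt [seq f m | m <- iota 0 N].
have KP e : (e \in K) = (e \in [seq f m | m <- iota 0 N]) by rewrite seq_fsetE.
pose w := nth_root q z; pose X := \sum_(m < N) b (f m) * w ^+ m.
have wq : w ^+ q = z by apply: nth_rootP; exact: p0.
have Xq : X ^+ q = psum (frob_trunc n) z N.
  rewrite /X frob_sum//; apply: eq_bigr => i _.
  by rewrite exprMn -exprM mulnC exprM wq.
have K0 : 0 \in K by rewrite KP; apply/mapP; exists 0%N; rewrite ?mem_iota// /f mul0r.
have JK := fsubsetUl J K; set J' := (J `|` K)%fset in JK.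
have KJ : (K `<=` J')%fset := fsubsetUr J K.
have sumK : \sum_(e <- K) a e * fpow z e - c = X.
  have -> : \sum_(e <- K) a e * fpow z e = \sum_(e <- [seq f m | m <- iota 0 N]) a e * fpow z e.
    apply: perm_big; apply: uniq_perm; [exact: fset_uniq| |exact: KP].
    by rewrite map_inj_uniq ?iota_uniq//; exact: natfrac_inj (p0 n).
  rewrite big_map /X -[N]subn0 -/(index_iota 0 N) subn0 big_mkord /N !big_ord_recl.
  have b0 : b (f 0%N) = a (f 0%N) - c by rewrite /sub_const /f mul0r eqxx.
  have bS m : (0 < m)%N -> b (f m) = a (f m).
    move=> m0; rewrite /sub_const (_ : (f m == 0) = false) ?subr0//.
    by rewrite /f mulf_eq0 invr_eq0 !pnatr_eq0 (gtn_eqF m0) (gtn_eqF (p0 n)).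
  rewrite (fpow_frac z n) b0 expr0 !mulr1 addrAC; congr (_ + _).
  by apply: eq_bigr => i _; rewrite (fpow_frac z n) bS.
have rest : V (\sum_(e <- J') a e * fpow z e - c - X) <= eta.
  rewrite (big_fset_split _ KJ) -sumK.
  rewrite (_ : _ - _ = \sum_(e <- J' | e \notin K) a e * fpow z e); last by ring.
  apply: absval_sum_le => [|e eK]; first exact: ltW.
  have [->|ae] := eqVneq (a e) 0; first by rewrite mul0r absval0 ltW.
  rewrite absvalM absval_fpow ?in_P_ge0//.
  apply: (@le_trans _ _ (V (a e) * rho `^ ratr e)).
    rewrite ler_wpM2l ?absval_ge0// ge0_ler_powR ?nnegrE ?absval_ge0 ?(ltW rho0)//.
    by rewrite ler0q; exact: in_P_ge0.
  (* An exponent outside K is either missing from f_n, where the tail bound applies, or of the form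
     m / p^n with m >= N, where convergence of g_n does. *)
  have [[m em]|H] := pselect (exists m, e = f m); last first.
    by apply: tl => // m em; apply: H; exists m.
  have Nm : (N <= m)%N.
    rewrite leqNgt; apply: contra eK => mN; rewrite KP em; apply: map_f.
    by rewrite mem_iota add0n.
  have e0 : e != 0 by apply: contraNneq eK => ->.
  have := HN2 m (leq_trans (leq_maxr _ _) (ltnW Nm)); rewrite gn_gauss// -/q -/(f m) -em.
  rewrite /gauss_term /sub_const (negbTE e0) subr0 => H; rewrite leNgt; apply/negP => H'.
  have : eta ^+ q < eta ^+ q.
    by apply: le_lt_trans H; apply: ler_exp; exact: ltW.
  by rewrite ltxx.
rewrite -(subrKA (X ^+ q)); apply: absval_add_le.
  rewrite absval_distC Xq ltW// HN1//; exact: leq_trans (leq_maxl _ _) (leqnSn _).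
rewrite -frobB// absvalX ler_exp ?absval_ge0//.
rewrite (_ : X - _ = - ((\sum_(e <- J') a e * fpow z e - c - X) - (\sum_(e <- J') a e * fpow z e - W))); last by ring.
by rewrite absvalN; apply: absval_sub_le => //; exact/ltW/HJ.
Qed.

(** The counterpart of [max_index] for rational exponents: the last one attaining the Gauss norm of
    f - c. *)
Definition edom (rho : R) (e : rat) := [/\ b e != 0,
  forall e', gauss_term rho e' <= gauss_term rho e &
  forall e', e < e' -> gauss_term rho e' < gauss_term rho e].

Lemma gauss_gt0 (rho : R) e : 0 < rho -> b e != 0 -> 0 < gauss_term rho e.
Proof. by move=> rho0 be; rewrite mulr_gt0 ?absval_gt0 ?powR_gt0. Qed.

Lemma sub_const_ge0 e : b e != 0 -> 0 <= e.
Proof.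
have [->//|e0] := eqVneq e 0.
by rewrite /sub_const (negbTE e0) subr0; exact: in_P_ge0.
Qed.

Lemma gauss_finite_ge (rho eps : R) : 0 < rho -> 0 < eps ->
  finite_set [set e | eps <= gauss_term rho e].
Proof.
move=> rho0 e0; apply: sub_finite_set (gauss_finite rho0 (_ : 0 < eps / 2)); last by lra.
by move=> e /=; apply: lt_le_trans; lra.
Qed.

Lemma edom_exists (rho : R) : nonconstant a -> 0 < rho -> exists e, edom rho e.
Proof.
move=> [e1 e10 ae1] rho0.
have [||e [e0 H1 H2]] := @exists_dominant R rat (gauss_term rho) ratr.
- by exists e1; rewrite gauss_gt0// /sub_const (negbTE e10) subr0.
- by move=> eps eps0; exact: gauss_finite_ge.
exists e; split=> // [|e' ee']; last by apply: H2; rewrite ltr_rat.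
by apply: contraTneq e0; rewrite /gauss_term => ->; rewrite absval0 mul0r ltxx.
Qed.

Lemma gn_dom (rho : R) e : 0 < rho -> edom rho e -> exists n0, forall n, (n0 <= n)%N ->
  exists N, [/\ N%:R = e * (p ^ n)%:R, max_index V (frob_trunc n) rho N &
    V (frob_trunc n N) * rho ^+ N = gauss_term rho e ^+ (p ^ n)].
Proof.
move=> rho0 [be H1 H2].
have [n0 Hn0] : exists n0, forall n, (n0 <= n)%N -> exists m : nat, e = m%:R / (p ^ n)%:R.
  have [->|e0] := eqVneq e 0; first by exists 0%N => n _; exists 0%N; rewrite mul0r.
  by apply: in_P_frac; move: be; rewrite /sub_const (negbTE e0) subr0.
exists n0 => n /Hn0[N eN]; have pn0 : ((p ^ n)%:R : rat) != 0 by rewrite pnatr_eq0 -lt0n p0.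
have NE : N%:R / (p ^ n)%:R = e by rewrite eN.
exists N; split; rewrite ?gn_gauss ?NE//; first by rewrite eN divfK.
split; rewrite ?gn_gauss ?NE//.
- by rewrite /frob_trunc NE expf_neq0.
- by move=> m; rewrite gn_gauss// ler_exp// gauss_ge0.
- move=> m Nm; rewrite gn_gauss// ltrXn2r ?gauss_ge0 ?(gtn_eqF (p0 n))//.
  by apply: H2; rewrite -NE ltr_pM2r ?invr_gt0 ?ltr0n ?p0// ltr_nat.
Qed.

End Truncations.

Lemma eventually_all_seq (I : eqType) (L : seq I) (Q : I -> nat -> Prop) :
  (forall i, i \in L -> exists n0, forall n, (n0 <= n)%N -> Q i n) ->
  exists n0, forall n, (n0 <= n)%N -> forall i, i \in L -> Q i n.
Proof.
elim: L => [|i L IH] H; first by exists 0%N.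
have [n1 H1] := H i (mem_head _ _).
have [|n2 H2] := IH; first by move=> j jL; apply: H; rewrite inE jL orbT.
exists (maxn n1 n2) => n; rewrite geq_max => /andP[n1n n2n] j.
by rewrite inE => /predU1P[->|/(H2 _ n2n)//]; exact: H1.
Qed.

Lemma seq_pos_lower_bound (R : realType) (I : eqType) (L : seq I) (r : I -> R) :
  (forall i, i \in L -> 0 < r i) -> exists2 d, 0 < d & forall i, i \in L -> d <= r i.
Proof.
elim: L => [|i L IH] H; first by exists 1.
have [|d d0 Hd] := IH; first by move=> j jL; apply: H; rewrite inE jL orbT.
exists (Num.min d (r i)); first by rewrite lt_min d0 H// mem_head.
by move=> j; rewrite inE => /predU1P[->|/Hd jd]; rewrite ge_min ?jd ?lexx ?orbT.
Qed.

Lemma seq_upper_bound (R : realType) (I : eqType) (L : seq I) (r : I -> R) :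
  exists2 d, 0 < d & forall i, i \in L -> r i <= d.
Proof.
elim: L => [|i L [d d0 Hd]]; first by exists 1.
exists (Num.max d (r i)); first by rewrite lt_max d0.
by move=> j; rewrite inE => /predU1P[->|/Hd jd]; rewrite le_max ?jd ?lexx ?orbT.
Qed.

Lemma ler_expI (R : realType) (x y : R) q : (0 < q)%N -> 0 <= y -> x ^+ q <= y ^+ q -> x <= y.
Proof.
move=> q0 y0 H; rewrite leNgt; apply/negP => yx.
by move: H; rewrite leNgt ltrXn2r// gtn_eqF.
Qed.

(** * The density of zeros in a disc *)

Section Density.
Context {R : realType} {C : closedFieldType} (V : nonarch_absval R C).
Context (hV : is_complete V) (p : nat) (pC : p \in [pchar C]).
Context (a : rat -> C) (ha : in_P V p a) (c : C) (hnc : nonconstant a).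
Local Notation b := (sub_const a c).
Local Notation gn := (frob_trunc p a c).
Local Notation tail := (tail V p a).
Local Notation gauss := (gauss_term V a c).
Local Notation edom := (edom V a c).

Let p0 n : (0 < p ^ n)%N. Proof. by rewrite expn_gt0 prime_gt0// (pcharf_prime pC). Qed.

Definition feval_sub (z : C) : C := feval a (z : vtop V) - c.
Local Notation F := feval_sub.

Lemma fiberE (z : C) : fiber V a c z <-> F z = 0.
Proof.
rewrite /fiber /feval_sub /=; split => [->|/eqP]; first by rewrite subrr.
by rewrite subr_eq0 => /eqP.
Qed.

Lemma econv_bounded g (rho : R) : econv V g -> 0 < rho ->
  exists2 B, 0 <= B & forall i, V (g i) * rho ^+ i <= B.
Proof.
move=> cg r0; have [[m gm]|H] := pselect (exists m, g m != 0).
  have [N [gN H _]] := dom_exists cg r0 gm.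
  exists (V (g N) * rho ^+ N) => //.
  by rewrite mulr_ge0 ?absval_ge0// exprn_ge0// ltW.
exists 0 => // i; have [->|gi] := eqVneq (g i) 0; first by rewrite absval0 mul0r.
by exfalso; apply: H; exists i.
Qed.

Lemma gn_F n (z : C) (rho eta : R) : 0 < rho -> 0 < eta -> V z <= rho ->
  tail n rho eta -> V (eval_ps V (gn n) z - F z ^+ (p ^ n)) <= eta ^+ (p ^ n).
Proof. exact: gn_feval. Qed.

(** A single g_n suffices: it is Lipschitz on the disc and approximates (f - c)^(p^n), and
    additivity of Frobenius lets the p^n-th root be taken of a difference. *)
Lemma F_cont (rho eta : R) : 0 < rho -> 0 < eta -> exists2 d, 0 < d &
  forall x y, V x <= rho -> V y <= rho -> V (x - y) <= d -> V (F x - F y) <= eta.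
Proof.
move=> rho0 eta0; have [n0 /(_ n0 (leqnn _)) tl] := tail_exists pC ha rho0 eta0.
have [B B0 HB] := econv_bounded (gn_conv pC ha c n0) rho0.
set q := (p ^ n0)%N in tl; have etaq : 0 < eta ^+ q by rewrite exprn_gt0.
have B1 : 0 < B + 1 by lra.
exists (eta ^+ q * rho / (B + 1)); first by rewrite divr_gt0// mulr_gt0.
move=> x y xr yr; rewrite ler_pdivlMr// => xy.
apply: (@ler_expI _ _ _ q) (p0 n0) (ltW eta0) _.
rewrite -absvalX frobB//.
have Hx := gn_F rho0 eta0 xr tl; have Hy := gn_F rho0 eta0 yr tl.
rewrite (_ : _ - _ = - ((eval_ps V (gn n0) x - F x ^+ q) - (eval_ps V (gn n0) y - F y ^+ q)
   - (eval_ps V (gn n0) x - eval_ps V (gn n0) y))); last by ring.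
rewrite absvalN; apply: absval_sub_le; first exact: absval_sub_le.
have := ev_lip hV (gn_conv pC ha c n0) rho0 xr yr B0 HB.
move=> H; rewrite -(ler_pM2r rho0); apply: le_trans H _; apply: le_trans xy.
by rewrite ler_wpM2l ?absval_ge0// lerDl.
Qed.

Lemma F_root n x (rho eta : R) : 0 < rho -> 0 < eta -> V x <= rho -> tail n rho eta ->
  eval_ps V (gn n) x = 0 -> V (F x) <= eta.
Proof.
move=> rho0 eta0 xr tl gx; apply: (@ler_expI _ _ _ (p ^ n)) (p0 n) (ltW eta0) _.
by have := gn_F rho0 eta0 xr tl; rewrite gx sub0r absvalN absvalX.
Qed.

Lemma near_root_gn (rho d : R) : 0 < rho -> 0 < d -> exists2 eta, 0 < eta &
  exists n0, forall n, (n0 <= n)%N -> forall y, V y <= rho -> V (F y) <= eta ->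
  exists2 x, V (x - y) <= d & eval_ps V (gn n) x = 0.
Proof.
move=> rho0 d0; have [e ed] := edom_exists ha c hnc rho0.
have [n1 Hn1] := gn_dom pC ha rho0 ed; have [be _ _] := ed.
have B0 : 0 < gauss rho e by exact: gauss_gt0.
(* The p^n-th power of the second bound is d^N times the absolute value of coefficient N of g_n, the
   threshold for a zero within d of y. The first bound, strictly below the Gauss norm, rules out N =
   0, where |g_n| is constant on the disc. Neither depends on n. *)
pose eta := Num.min (gauss rho e / 2) (gauss rho e * (d / rho) `^ ratr e).
have eta0 : 0 < eta by rewrite lt_min divr_gt0//= mulr_gt0// powR_gt0// divr_gt0.
exists eta => //; have [n2 Hn2] := tail_exists pC ha rho0 eta0.
exists (maxn n1 n2) => n; rewrite geq_max => /andP[n1n n2n] y yr Fy.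
have [N [NE dg VN]] := Hn1 _ n1n; have tl := Hn2 _ n2n.
have cg := gn_conv pC ha c n.
have gy : V (eval_ps V (gn n) y) <= eta ^+ (p ^ n).
  rewrite -[eval_ps _ _ _](subrK (F y ^+ (p ^ n))); apply: absval_add_le; first exact: (gn_F rho0 eta0 yr tl).
  by rewrite absvalX ler_exp ?absval_ge0.
have [N0|N0] := posnP N.
  have := dom0_ev hV cg rho0 _ yr; rewrite N0 in dg VN; move=> /(_ dg) E.
  rewrite expr0 mulr1 in VN; exfalso; move: gy; rewrite E VN leNgt => /negP; apply.
  rewrite ltrXn2r ?(gtn_eqF (p0 n)) ?(ltW eta0)//.
  by apply: le_lt_trans (_ : gauss rho e / 2 < _); [rewrite ge_min lexx|lra].
apply: (near_root hV cg rho0 N0 dg yr (ltW d0)); apply: le_trans gy _.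
have -> : d ^+ N * V (gn n N) = (gauss rho e * (d / rho) `^ ratr e) ^+ (p ^ n).
  have eE : e = N%:R / (p ^ n)%:R by rewrite NE mulfK// pnatr_eq0 -lt0n p0.
  rewrite exprMn -VN {1}eE powR_natfrac//; last by rewrite divr_ge0// ltW.
  by rewrite exprMn exprVn; field; rewrite expf_neq0// gt_eqF.
by rewrite ler_exp ?(ltW eta0)// ge_min lexx orbT.
Qed.

(** A zero of g_n only makes F small, so it is corrected repeatedly: a point where F is small is
    near a zero of a suitable g_n, at which F is smaller still. Steps of length at most d/(k+1) give
    a convergent sequence that never leaves the disc of radius d about y. *)
Lemma near_fiber (rho d : R) : 0 < d -> d <= rho -> exists2 eta, 0 < eta &
  forall y, V y <= rho -> V (F y) <= eta -> exists2 z, V (z - y) <= d & F z = 0.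
Proof.
move=> d0 dr; have rho0 : 0 < rho by exact: lt_le_trans dr.
pose dk k := d / k.+1%:R.
have dk0 k : 0 < dk k by rewrite divr_gt0.
have dkd k : dk k <= d by rewrite ler_pdivrMr// ler_peMr ?(ltW d0)// ler1n.
have k0 k : 0 < k.+1%:R^-1 :> R by rewrite invr_gt0.
(* The bound 1/(k+1) on the thresholds makes F vanish at the limit. *)
have ex k : exists eta, [/\ 0 < eta, eta <= k.+1%:R^-1 &
    exists n0, forall n, (n0 <= n)%N -> forall y, V y <= rho -> V (F y) <= eta ->
    exists2 x, V (x - y) <= dk k & eval_ps V (gn n) x = 0].
  have [eta eta0 [n0 H]] := near_root_gn rho0 (dk0 k).
  exists (Num.min eta k.+1%:R^-1); split; [by rewrite lt_min eta0 k0|by rewrite ge_min lexx orbT|].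
  by exists n0 => n n0n y yr; rewrite le_min => /andP[Fy _]; exact: H.
have [eta Heta] := choice ex.
have step k y : V y <= rho -> V (F y) <= eta k ->
    exists x, [/\ V (x - y) <= dk k, V x <= rho & V (F x) <= eta k.+1].
  move=> yr Fy; have [_ _ [n0 H]] := Heta k; have [eta1 _ _] := Heta k.+1.
  have [n1 H1] := tail_exists pC ha rho0 eta1.
  have [x xy gx] := H (maxn n0 n1) (leq_maxl _ _) _ yr Fy.
  have xr : V x <= rho.
    rewrite -(subrK y x); apply: absval_add_le => //.
    exact: le_trans xy (le_trans (dkd k) dr).
  by exists x; split => //; exact: (F_root rho0 eta1 xr (H1 _ (leq_maxr _ _)) gx).
exists (eta 0%N); first by have [] := Heta 0%N.
move=> y yr Fy.
pose S k y := [set x | [/\ V (x - y) <= dk k, V x <= rho & V (F x) <= eta k.+1]].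
pose u := fix u k := if k is k'.+1 then xget 0 (S k' (u k')) else y.
have uP k : V (u k) <= rho /\ V (F (u k)) <= eta k.
  elim: k => [//|k [IH1 IH2]] /=; case: xgetP => [x -> [] //|].
  by have [x Hx] := step _ _ IH1 IH2; move/(_ x).
have uS k : V (u k.+1 - u k) <= dk k.
  have [IH1 IH2] := uP k; rewrite /= -/(u k); case: xgetP => [x -> [] //|].
  by have [x Hx] := step _ _ IH1 IH2; move/(_ x).
have [z uz] : exists z, cv V u z.
  apply: cv_cauchy => // e e0; have [N HN] := invn_small (divr_gt0 e0 d0).
  exists N => n /HN H; apply: le_lt_trans (uS n) _.
  by rewrite /dk mulrC -ltr_pdivlMr.
have uy k : V (u k - y) <= d.
  elim: k => [|k IH]; first by rewrite subrr absval0 ltW.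
  rewrite -(subrKA (u k)); apply: absval_add_le => //; exact: le_trans (uS k) (dkd k).
have zr : V z <= rho.
  by rewrite -(subr0 z); apply: (cv_le (N := 0) _ uz) => k _; rewrite subr0; have [] := uP k.
exists z; first by apply: (cv_le (N := 0) _ uz).
apply: (@absval_small_eq0 _ _ V) => e e0.
have [d' d'0 Hd'] := F_cont rho0 e0; have [M HM] := uz _ d'0; have [N HN] := invn_small e0.
pose k := maxn M N; rewrite -[F z](subrK (F (u k))); apply: absval_add_le.
  apply: Hd' => //; first by have [] := uP k.
  by rewrite absval_distC ltW// HM// leq_maxl.
have [_ Fu] := uP k; have [_ ek _] := Heta k.
by apply: le_trans Fu (le_trans ek _); rewrite ltW// HN// leq_maxr.
Qed.

(** Only finitely many exponents have a coefficient at least as large as that of e1. Among the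
    exponents below e1, the others lose to e1 from radius 1 on, and each listed e from [rr e] on,
    the radius where its term ties with that of e1. *)
Lemma edom_large e1 : b e1 != 0 -> exists2 rho0, 0 < rho0 &
  forall rho e, rho0 <= rho -> edom rho e -> e1 <= e.
Proof.
move=> be1; have g10 : 0 < gauss 1 e1 by exact: gauss_gt0.
have V10 : 0 < V (b e1) by exact: absval_gt0.
have /finite_seqP[s sE] := gauss_finite_ge ha c ltr01 g10.
have powr1 (e : rat) : gauss 1 e = V (b e) by rewrite /gauss_term powR1 mulr1.
pose rr (e : rat) := (V (b e) / V (b e1)) `^ (ratr (e1 - e))^-1.
have [d d0 Hd] := seq_upper_bound s rr.
exists (Num.max 1 d); first by rewrite lt_max ltr01.
move=> rho e; rewrite ge_max => /andP[r1 dr] [be H1 H2].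
have rho0 : 0 < rho by exact: lt_le_trans r1.
rewrite leNgt; apply/negP => ee1; have := H2 _ ee1; apply/negP; rewrite -leNgt /gauss_term.
have ->: ratr e1 = ratr e + ratr (e1 - e) :> R by rewrite -rmorphD /= addrC subrK.
have ee0 : 0 < ratr (e1 - e) :> R by rewrite ltr0q subr_gt0.
rewrite powRD; last by rewrite (gt_eqF rho0) implybT.
rewrite [in leRHS]mulrCA mulrC ler_wpM2l ?powR_ge0// mulrC -ler_pdivrMr//.
have [es|es] := boolP (e \in s).
  have -> : V (b e) / V (b e1) = rr e `^ ratr (e1 - e).
    by rewrite /rr -powRrM mulVf ?powRr1 ?gt_eqF// divr_ge0 ?absval_ge0.
  rewrite ge0_ler_powR ?nnegrE ?powR_ge0 ?(ltW ee0) ?(ltW rho0)//.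
  exact: le_trans (Hd _ es) dr.
have {}es : V (b e) <= V (b e1).
  rewrite leNgt; apply: contra es => H; have : [set e | gauss 1 e1 <= gauss 1 e] e.
    by rewrite /= !powr1 ltW.
  by rewrite sE.
apply: (@le_trans _ _ 1); first by rewrite ler_pdivrMr// mul1r.
by rewrite -(powRr0 rho) ler_powR// ltW.
Qed.

(** At a large radius the dominant exponent is positive, so g_n has a zero; F is small at this zero
    and a true zero of F is nearby. *)
Lemma fiber_nonempty : exists z, F z = 0.
Proof.
have [e1 e10 ae1] := hnc; have be1 : b e1 != 0 by rewrite /sub_const (negbTE e10) subr0.
have e1p : 0 < e1 by rewrite lt_neqAle eq_sym e10 (in_P_ge0 ha).
have [rho rho0 Hr] := edom_large be1.
have [e ed] := edom_exists ha c hnc rho0; have ee := Hr _ _ (lexx _) ed.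
have [n1 Hn1] := gn_dom pC ha rho0 ed.
have [eta eta0 H] := near_fiber rho0 (lexx rho).
have [n2 Hn2] := tail_exists pC ha rho0 eta0.
have [N [NE dg _]] := Hn1 (maxn n1 n2) (leq_maxl _ _).
have N0 : (0 < N)%N.
  rewrite -(ltr_nat rat) NE mulr_gt0 ?ltr0n ?p0//; exact: lt_le_trans ee.
have [x xr gx] := root_exists hV (gn_conv pC ha c _) rho0 N0 dg.
have [|z _ Fz] := H x xr; last by exists z.
exact: (F_root rho0 eta0 xr (Hn2 _ (leq_maxr _ _)) gx).
Qed.

(** Exact equality for large n replaces the limit of the quotients, so that additivity and
    invariance become statements about integer counts. *)
Definition is_dens alpha r (M : R) := exists n0, forall n, (n0 <= n)%N ->
  exists N, max_index V (taylor V alpha (gn n)) r N /\ N%:R = M * (p ^ n)%:R.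

Lemma is_dens_unique alpha r M M' : is_dens alpha r M -> is_dens alpha r M' -> M = M'.
Proof.
move=> [n0 H] [n1 H'].
have [N [dN NE]] := H (maxn n0 n1) (leq_maxl _ _).
have [N' [dN' NE']] := H' (maxn n0 n1) (leq_maxr _ _).
have pn : (p ^ maxn n0 n1)%:R != 0 :> R by rewrite pnatr_eq0 -lt0n p0.
by apply: (mulIf pn); rewrite -NE -NE' (dom_unique dN dN').
Qed.

Lemma T_gn_lower alpha r : 0 < r -> exists2 beta, 0 < beta & exists n0, forall n,
  (n0 <= n)%N -> exists N, max_index V (taylor V alpha (gn n)) r N /\
    beta ^+ (p ^ n) <= V (taylor V alpha (gn n) N) * r ^+ N.
Proof.
move=> r0; pose rho := Num.max r (V alpha).
have [rr ar] : r <= rho /\ V alpha <= rho by rewrite /rho !le_max !lexx orbT.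
have rho0 : 0 < rho by exact: lt_le_trans rr.
have [e ed] := edom_exists ha c hnc rho0; have [be _ _] := ed.
have [n1 Hn1] := gn_dom pC ha rho0 ed.
have B0 : 0 < gauss rho e by exact: gauss_gt0.
(* The term of exponent e at radius rho, rescaled to radius r. *)
exists (gauss rho e * (r / rho) `^ ratr e); first by rewrite mulr_gt0// powR_gt0// divr_gt0.
exists n1 => n /Hn1[N' [NE dg VN]]; have cg := gn_conv pC ha c n.
have [dT TN] := dom_T hV cg rho0 ar dg.
have [N dN] : exists N, max_index V (taylor V alpha (gn n)) r N.
  by apply: (dom_exists (m := N')) => //; [exact: conv_T|case: dT].
exists N; split => //; case: dN => _ /(_ N') + _; apply: le_trans.
have eE : e = N'%:R / (p ^ n)%:R by rewrite NE mulfK// pnatr_eq0 -lt0n p0.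
rewrite exprMn -VN {1}eE powR_natfrac//; last by rewrite divr_ge0// ltW.
rewrite TN exprMn exprVn le_eqVlt; apply/orP; left; apply/eqP.
by field; rewrite expf_neq0// gt_eqF.
Qed.

Lemma is_dens_exists alpha r : 0 < r -> exists M, is_dens alpha r M.
Proof.
move=> r0; pose rho := Num.max r (V alpha).
have [rr ar] : r <= rho /\ V alpha <= rho by rewrite /rho !le_max !lexx orbT.
have rho0 : 0 < rho by exact: lt_le_trans rr.
have [beta beta0 [n1 Hn1]] := T_gn_lower alpha r0.
have eta0 : 0 < beta / 2 by lra.
have [n2 Hn2] := tail_exists pC ha rho0 eta0.
pose n := maxn n1 n2; have tl := Hn2 n (leq_maxr _ _).
have [N [dN big]] := Hn1 n (leq_maxl _ _).
have cg := gn_conv pC ha c.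
exists (N%:R / (p ^ n)%:R); exists n => m /subnKC <-; set d := (m - n)%N.
have pn : (p ^ n)%:R != 0 :> R by rewrite pnatr_eq0 -lt0n p0.
exists (N * p ^ d)%N; split; last by rewrite expnD !natrM mulrA divfK.
have [df Vf] := dom_frob (p0 d) r0 dN.
rewrite -(T_frob hV pC)// in df; rewrite -(T_frob hV pC)// in Vf.
have cf : econv V (frob (p ^ d) (gn n)) by apply: conv_frob.
have [] // := @dom_perturb _ _ V _ (taylor V alpha (gn (n + d)%N)) _ _ r0 df.
move=> j; rewrite Vf; apply: (@le_lt_trans _ _ ((beta / 2) ^+ (p ^ (n + d)))); last first.
  rewrite expnD exprM; apply: (@lt_le_trans _ _ ((beta ^+ (p ^ n)) ^+ (p ^ d))); last first.
    by rewrite ler_exp// exprn_ge0// ltW.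
  rewrite ltrXn2r ?(gtn_eqF (p0 d)) ?exprn_ge0 ?(ltW eta0)//.
  by rewrite ltrXn2r ?(gtn_eqF (p0 n)) ?(ltW eta0)//; lra.
have := TB hV alpha (cg (n + d)%N) cf => /funeqP/(_ j) /= <-.
apply: (@le_trans _ _ (V (taylor V alpha (gn (n + d)%N \- frob (p ^ d) (gn n)) j) * rho ^+ j)).
  by rewrite ler_wpM2l ?absval_ge0// ler_exp// ltW.
apply: T_le => //; [exact: convB|by rewrite exprn_ge0// ltW|].
by move=> i _; exact: gn_frob.
Qed.

Definition dens alpha r : R := xget 0 [set M | is_dens alpha r M].

Lemma densP alpha r : 0 < r -> is_dens alpha r (dens alpha r).
Proof.
move=> r0; rewrite /dens; case: xgetP => [M -> //|H].
by have [M /H] := is_dens_exists alpha r0.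
Qed.

Lemma dens_ge0 alpha r : 0 < r -> 0 <= dens alpha r.
Proof.
move=> r0; have [n0 /(_ n0 (leqnn _))[N [_ NE]]] := densP alpha r0.
by rewrite -(pmulr_lge0 _ (_ : 0 < (p ^ n0)%:R)) -?NE// ltr0n p0.
Qed.

Lemma dens0 (rho : R) e : 0 < rho -> edom rho e -> dens 0 rho = ratr e.
Proof.
move=> rho0 ed; apply: is_dens_unique (densP _ rho0) _.
have [n0 H] := gn_dom pC ha rho0 ed; exists n0 => n /H[N [NE dg _]].
exists N; split; last by rewrite -[LHS](ratr_nat R) NE rmorphM /= ratr_nat.
by have [] := dom_T hV (gn_conv pC ha c n) rho0 (_ : V 0 <= rho) dg; rewrite ?absval0// ltW.
Qed.

Lemma num_zeros_dens alpha r : 0 < r -> exists n0, forall n, (n0 <= n)%N ->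
  num_zeros V (gn n) (disc V alpha r) = (dens alpha r * (p ^ n)%:R)%:E.
Proof.
move=> r0; have [n0 H] := densP alpha r0; exists n0 => n /H[N [dN <-]].
have [s [h dg]] := decomp_exists_dom hV (gn_conv pC ha c n) r0 dN.
by rewrite (num_zeros_decomp hV dg) (dom_unique dN (decomp_dom hV r0 dg)).
Qed.

Lemma gn_neq0 : exists n0, forall n, (n0 <= n)%N -> exists m, gn n m != 0.
Proof.
have [e ed] := edom_exists ha c hnc ltr01.
have [n0 H] := gn_dom pC ha ltr01 ed; exists n0 => n /H[N [_ [gN _ _] _]].
by exists N.
Qed.

Lemma disc_close (x z alpha : C) (d r : R) : V (z - x) <= d -> d <= r ->
  (V (x - alpha) <= r) = (V (z - alpha) <= r).
Proof.
move=> zx dr; apply/idP/idP => H.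
  rewrite -(subrKA x); apply: absval_add_le => //; exact: le_trans dr.
rewrite -(subrKA z); apply: absval_add_le => //; rewrite absval_distC; exact: le_trans dr.
Qed.

(* For large n every zero of g_n in a bounded disc lies close to the fiber, so
   a partition of the fiber into discs partitions the zeros of g_n. *)
Lemma dens_additive alpha (r : R) (L : seq (C * R)) : 0 < r ->
  (forall D, D \in L -> 0 < D.2) ->
  (forall z, F z = 0 -> count (fun D => V (z - D.1) <= D.2) L = (V (z - alpha) <= r)%R) ->
  dens alpha r = \sum_(D <- L) dens D.1 D.2.
Proof.
move=> r0 L0 HL; pose L' := (alpha, r) :: L.
have L'0 D : D \in L' -> 0 < D.2 by rewrite inE => /predU1P[->|/L0].
(* As d is at most every radius in play, moving a zero of g_n by at most d to a point of the fiber
   changes no membership in the discs. *)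
have [d d0 Hd] := seq_pos_lower_bound L'0.
have [rho rho0 Hrho] := seq_upper_bound L' (fun D => Num.max D.2 (V D.1)).
have [Da Dr] : (forall D, D \in L' -> V D.1 <= rho) /\ (forall D, D \in L' -> D.2 <= rho).
  by split => D /Hrho; rewrite ge_max => /andP[].
have dr : d <= rho by apply: le_trans (Hd (alpha, r) (mem_head _ _)) (Dr _ (mem_head _ _)).
have [eta eta0 near] := near_fiber d0 dr.
have [n1 Hn1] := tail_exists pC ha rho0 eta0.
have [n2 Hn2] := gn_neq0.
have [n3 Hn3] : exists n0, forall n, (n0 <= n)%N -> forall D, D \in L' ->
    exists N, max_index V (taylor V D.1 (gn n)) D.2 N /\ N%:R = dens D.1 D.2 * (p ^ n)%:R.
  by apply: eventually_all_seq => D /L'0; exact: densP.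
pose n := maxn n1 (maxn n2 n3).
have tl : tail n rho eta by apply: Hn1; rewrite leq_maxl.
have [m gm] : exists m, gn n m != 0 by apply: Hn2; rewrite /n; lia.
have cnt D : D \in L' -> exists N, max_index V (taylor V D.1 (gn n)) D.2 N /\ N%:R = dens D.1 D.2 * (p ^ n)%:R.
  by apply: Hn3; rewrite /n; lia.
have [s [h dg]] := decomp_exists hV 0 (gn_conv pC ha c n) rho0 gm.
have cntE D : D \in L' -> (count (fun x => V (x - D.1) <= D.2) s)%:R = dens D.1 D.2 * (p ^ n)%:R.
  move=> DL; have [N [dN <-]] := cnt D DL.
  have [|h' dg'] := decomp_sub hV (beta := D.1) (t := D.2) dg.
    move=> x xD; rewrite subr0 -(subrK D.1 x); apply: absval_add_le; last exact: Da.
    exact: le_trans (Dr _ DL).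
  by rewrite -size_filter (dom_unique dN (decomp_dom hV (L'0 _ DL) dg')).
have root x : x \in s -> count (fun D => V (x - D.1) <= D.2) L = (V (x - alpha) <= r)%R.
  move=> xs; have xr : V (x - 0) <= rho by case: dg => _ _ /(_ x xs).
  have gx : eval_ps V (gn n) x = 0 by apply/eqP; rewrite (decomp_root hV dg xr).
  rewrite subr0 in xr; have [z zx Fz] := near x xr (F_root rho0 eta0 xr tl gx).
  rewrite (disc_close _ zx (Hd (alpha, r) (mem_head _ _))) -HL//.
  apply: eq_in_count => D DL; apply: disc_close zx (Hd _ _).
  by rewrite inE DL orbT.
have pn : (p ^ n)%:R != 0 :> R by rewrite pnatr_eq0 -lt0n p0.
apply: (mulIf pn); rewrite -(cntE (alpha, r) (mem_head _ _)) mulr_suml.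
rewrite [RHS]big_seq; under eq_bigr => D DL do rewrite -cntE ?inE ?DL ?orbT//.
rewrite -big_seq -natr_sum; congr (_%:R) => /=.
(* Double counting of pairs formed by a zero and a disc containing it. *)
rewrite -sum1_count big_mkcond /= big_seq.
under eq_bigr => x xs.
  rewrite (_ : (if _ then _ else _) = (V (x - alpha) <= r)%R :> nat); last by case: ifP.
  rewrite -root// -sum1_count big_mkcond /=; over.
rewrite -big_seq exchange_big; apply: eq_bigr => D _ /=.
by rewrite -sum1_count [RHS]big_mkcond.
Qed.

(** The net consists of zeros of a single g_n, finitely many in a disc; its points need not lie on
    the fiber. *)
Lemma fiber_totally_bounded (rho d : R) : 0 < rho -> 0 < d -> exists s : seq C,
  forall z, F z = 0 -> V z <= rho -> exists2 x, x \in s & V (z - x) <= d.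
Proof.
move=> rho0 d0; pose rho' := Num.max rho d.
have [rr dr] : rho <= rho' /\ d <= rho' by rewrite /rho' !le_max !lexx orbT.
have rho'0 : 0 < rho' by exact: lt_le_trans rr.
have [eta eta0 [n1 H1]] := near_root_gn rho0 d0.
have [n2 Hn2] := gn_neq0; have [m gm] := Hn2 (maxn n1 n2) (leq_maxr _ _).
have [s [h dg]] := decomp_exists hV 0 (gn_conv pC ha c _) rho'0 gm.
exists s => z Fz zr; have [|x xz gx] := H1 _ (leq_maxl n1 n2) z zr.
  by rewrite Fz absval0 ltW.
exists x; last by rewrite absval_distC.
rewrite -(decomp_root hV dg) ?gx// subr0 -(subrK z x).
by apply: absval_add_le; [exact: le_trans dr|exact: le_trans rr].
Qed.

End Density.

(** * Measures generated by a semiring of compact open sets *)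

Section BaseMeasure.
Context {R : realType} {T : ptopologicalType} (D : set (set T)).
Context (D0 : D set0) (DI : setI_closed D).
Context (Dopen : forall A, D A -> open A) (Dcompact : forall A, D A -> compact A).
Context (Dbase : forall U, open U ->
  exists2 F : nat -> set T, (forall n, D (F n)) & U = \bigcup_n F n).

Lemma sigma_base : <<s D >> = <<s @open T >>.
Proof.
apply/seteqP; split.
  by apply: smallest_sub; [exact: smallest_sigma_algebra|move=> A /Dopen; exact: sub_gen_smallest].
apply: smallest_sub; first exact: smallest_sigma_algebra.
move=> U /Dbase[F DF ->]; apply: sigma_algebra_bigcup => n.
exact: sub_gen_smallest.
Qed.

Lemma open_borel (U : set T) : open U -> measurable (U : set (borel T)).
Proof. by move=> oU; apply: sub_gen_smallest. Qed.

(** Countably many members of D, each of finite measure, cover the space, and D is closed under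
    intersection and generates the Borel sets. *)
Lemma base_measure_unique (mu nu : {measure set (borel T) -> \bar R}) :
  (forall A, D A -> (mu A < +oo)%E) -> (forall A, D A -> nu A = mu A) ->
  forall A : set (borel T), measurable A -> nu A = mu A.
Proof.
move=> fin H A mA; have [F DF TF] := Dbase (@openT T).
apply: (@measure_unique _ _ (borel T) D F) => //.
- by rewrite sigma_base.
- by move=> k; rewrite H// fin.
Qed.

Lemma measure_bigcup_le (mu : {measure set (borel T) -> \bar R}) (F : nat -> set T)
    (x : \bar R) : (forall n, measurable (F n : set (borel T))) ->
  (forall n m, (n <= m)%N -> F n `<=` F m) -> (forall n, (mu (F n) <= x)%E) ->
  (mu (\bigcup_n F n) <= x)%E.
Proof.
move=> mF ndF H.
have cF : (mu \o F) n @[n --> \oo] --> mu (\bigcup_n F n).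
  apply: nondecreasing_cvg_mu => //; first exact: bigcupT_measurable.
  by move=> n k nk; apply/subsetPset; exact: ndF.
rewrite -(cvg_lim _ cF)//; apply: lime_le; first by apply/cvg_ex; eexists; exact: cF.
by apply: nearW => n; exact: H.
Qed.

(** U is a countable union of members of D, and the finite partial unions are compact subsets
    exhausting it. *)
Lemma base_measure_inner (mu : {measure set (borel T) -> \bar R}) (U : set T) :
  hausdorff_space T -> open U ->
  mu U = ereal_sup [set mu K | K in [set K : set T | compact K /\ K `<=` U]].
Proof.
move=> hT oU; apply/eqP; rewrite eq_le; apply/andP; split; last first.
  apply: ge_ereal_sup => _ [K [cK KU] <-]; apply: le_measure; rewrite ?inE//.
    rewrite -[K]setCK; apply: measurableC; apply: open_borel.
    by apply: closed_openC; exact: compact_closed.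
  exact: open_borel.
have [F DF UF] := Dbase oU.
have GU : \bigcup_n \big[setU/set0]_(i < n.+1) F i = U by rewrite bigcup_bigsetU_bigcup.
rewrite -{1}GU; apply: measure_bigcup_le.
- by move=> n; apply: bigsetU_measurable => i _; apply: open_borel; exact/Dopen/DF.
- by move=> n k nk; apply: (subset_bigsetU (F := F)).
- move=> n; apply: ereal_sup_ubound; exists (\big[setU/set0]_(i < n.+1) F i) => //.
  split; first by apply: bigsetU_compact => i _; exact: Dcompact.
  by rewrite -GU; exact: bigcup_sup.
Qed.

Context (m : set T -> R) (DD : semi_setD_closed D).
Context (m0 : m set0 = 0) (m_ge0 : forall A, 0 <= m A).
Context (madd : forall (A : set T) n (F : nat -> set T), D A -> (forall i, D (F i)) ->
  trivIset setT F -> A = \bigcup_(i < n) F i -> m A = \sum_(i < n) m (F i)).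

Let S : semiRingOfSetsType default_measure_display :=
  HB.pack T (isSemiRingOfSets.Build default_measure_display T D0 DI DD).

Let mE (A : set S) : \bar R := (m A)%:E.

(** A member of D is compact and the pieces are open and disjoint, so all but finitely many of them
    are empty: countable additivity reduces to finite additivity. *)
Let mE_sigma_additive : semi_sigma_additive mE.
Proof.
move=> F mF tF mUF.
have cA := Dcompact mUF; rewrite compact_cover in cA.
have [J _ HJ] := cA nat setT F (fun i _ => Dopen (mF i)) (fun x Ux => Ux).
pose N := (\max_(i <- J) i).+1.
have JN i : i \in J -> (i < N)%N.
  by move=> iJ; rewrite ltnS (@leq_bigmax_seq _ _ xpredT id).
have sub x : (\bigcup_n F n) x -> exists2 i, (i < N)%N & F i x.
  by move=> /HJ[i iJ Fx]; exists i => //; exact: JN.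
have F0 i : (N <= i)%N -> F i = set0.
  move=> Ni; rewrite -subset0 => x Fx; have [j jN Fjx] := sub x (ex_intro2 _ _ i I Fx).
  have := tF i j I I (ex_intro _ x (conj Fx Fjx)) => ij.
  by move: Ni; rewrite leqNgt ij jN.
apply: cvg_near_cst; exists N => // n /= Nn.
rewrite /mE big_mkord sumEFin; congr EFin; apply/esym; apply: madd => //.
apply/seteqP; split => [x /sub[i iN Fx]|x [i _ Fx]]; last by exists i.
by exists i => //=; exact: leq_trans Nn.
Qed.

Let mu0 : {measure set S -> \bar R} :=
  HB.pack mE (isMeasure.Build _ S R mE (congr1 EFin m0)
    (fun A => m_ge0 A : (0 <= mE A)%E) mE_sigma_additive).

(** The function is the outer measure itself, defined on every subset. Covers by sequences from D
    have open unions, so outer regularity holds for arbitrary sets, measurable or not. *)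
Lemma base_measure_exists : exists mu : {measure set (borel T) -> \bar R},
  (forall A, D A -> mu A = (m A)%:E) /\
  (forall A : set T, mu A = ereal_inf [set mu U | U in [set U : set T | open U /\ A `<=` U]]).
Proof.
pose muf (A : set (borel T)) : \bar R := mu_ext mu0 A.
have mu00 : muf set0 = 0%E by exact: mu_ext0.
have mu0ge A : (0 <= muf A)%E by exact: mu_ext_ge0.
have bm (A : set T) : measurable (A : set (borel T)) ->
    measurable (A : set (g_sigma_algebraType (@measurable _ S))).
  by move=> mA; have : <<s @open T >> A by []; rewrite -sigma_base.
have mus : semi_sigma_additive muf.
  move=> F mF tF mUF.
  apply: (@measure_semi_sigma_additive _ _ _ (measure_extension mu0) F) => //.
  - by move=> i; exact: bm.
  - exact: bm.
pose mu : {measure set (borel T) -> \bar R} :=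
  HB.pack muf (isMeasure.Build _ (borel T) R muf mu00 mu0ge mus).
exists mu; split; first by move=> A DA; exact: (measurable_mu_extE mu0).
move=> A; apply/eqP; rewrite eq_le; apply/andP; split.
  apply: le_ereal_inf_tmp => _ [U [oU AU] <-]; exact: le_mu_ext.
apply: le_ereal_inf_tmp => _ [F [DF AF] <-].
apply: ereal_inf_le; exists (mu (\bigcup_k F k)).
  by exists (\bigcup_k F k) => //; split => //; apply: bigcup_open => i _; exact/Dopen/DF.
by apply: ereal_inf_lbound; exists F => //; split.
Qed.

End BaseMeasure.

(** * Discs on the fiber *)

Section FiberSpace.
Context {R : realType} {C : closedFieldType} (V : nonarch_absval R C).
Context (hV : is_complete V) (p : nat) (pC : p \in [pchar C]).
Context (a : rat -> C) (ha : in_P V p a) (c : C) (hnc : nonconstant a).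
Context (x0 : fiber V a c).
Local Notation S := (pointed_subtype x0).
Local Notation F := (feval_sub V a c).
Local Notation dens := (dens V p a c).
Implicit Types (A B : set S) (x y : S).

Definition fval (x : S) : C := pt_val x.

Lemma F_val x : F (fval x) = 0.
Proof. by apply/fiberE; exact: (set_mem (valP (x : fiber V a c))). Qed.

Lemma fval_ex (z : C) : F z = 0 -> exists x : S, fval x = z.
Proof.
move=> /fiberE Fz.
by exists (exist (fun z => z \in fiber V a c) z (mem_set Fz) : S).
Qed.

Definition disc_trace (alpha : C) (r : R) : set S := [set x | V (fval x - alpha) <= r].

Lemma nbhs_dset x (r : R) : 0 < r -> nbhs x (disc_trace (fval x) r).
Proof.
move=> r0.
have : nbhs (fval x : vtop V) (ball (fval x : vtop V) r) by exact: nbhsx_ballx.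
move/(@initial_continuous _ _ (set_val : fiber V a c -> vtop V) (x : fiber V a c)) => H.
have {}H : nbhs x ((fval : S -> vtop V) @^-1` ball (fval x : vtop V) r) by exact: H.
apply: filterS H => y; rewrite /preimage /= vtop_ballE /= => H.
by rewrite /disc_trace /= absval_distC ltW.
Qed.

Lemma dset_eq alpha beta r : V (beta - alpha) <= r -> disc_trace alpha r = disc_trace beta r.
Proof.
move=> H; apply/seteqP; split => x /=; rewrite /disc_trace /= => xa.
  by rewrite -(subrKA alpha); apply: absval_add_le => //; rewrite absval_distC.
by rewrite -(subrKA beta); apply: absval_add_le.
Qed.

Lemma dset_sub alpha beta r t x : disc_trace alpha r x -> disc_trace beta t x -> r <= t ->
  disc_trace alpha r `<=` disc_trace beta t.
Proof.
move=> xa xb rt; rewrite (dset_eq xa) (dset_eq xb) => y; rewrite /disc_trace /=.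
by move/le_trans; apply.
Qed.

Lemma open_dset alpha r : 0 < r -> open (disc_trace alpha r).
Proof.
move=> r0; rewrite openE => x xa; rewrite /interior (dset_eq xa).
exact: nbhs_dset.
Qed.

Lemma nbhs_dset_ex x (U : set S) : nbhs x U -> exists2 e, 0 < e & disc_trace (fval x) e `<=` U.
Proof.
move=> [_ [[W oW <-] Wx WU]].
have /nbhs_ballP[e e0 eW] : nbhs (fval x : vtop V) W by apply: open_nbhs_nbhs; split.
exists (e / 2); first by rewrite /= in e0; lra.
move=> y; rewrite /disc_trace /= => yx; apply: WU; apply: eW; rewrite vtop_ballE /=.
by rewrite absval_distC; rewrite /= in e0; apply: le_lt_trans yx _; lra.
Qed.

Lemma fiber_hausdorff : hausdorff_space S.
Proof.
move=> x y xy; apply: val_inj => /=; apply/eqP; rewrite -subr_eq0; apply/eqP.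
change (fval x - fval y = 0).
apply: (@absval_small_eq0 _ _ V) => e e0.
have [z [zx zy]] := xy _ _ (nbhs_dset x e0) (nbhs_dset y e0).
rewrite -(subrKA (fval z)); apply: absval_add_le => //; by rewrite absval_distC.
Qed.

Lemma dset_bounded alpha r x : disc_trace alpha r x -> V (fval x) <= Num.max r (V alpha).
Proof.
move=> xa; rewrite -(subrK alpha (fval x)); apply: absval_add_le; rewrite le_max ?lexx ?orbT//.
by rewrite [V _ <= r]xa.
Qed.

(** Total boundedness puts arbitrarily small discs into an ultrafilter, which is therefore Cauchy;
    its limit in C lies on the fiber by continuity of f. *)
Lemma compact_dset alpha r : 0 < r -> compact (disc_trace alpha r).
Proof.
move=> r0; rewrite compact_ultra => G UG GA.
pose rho := Num.max r (V alpha).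
have rho0 : 0 < rho by rewrite lt_max r0.
pose v : S -> vtop V := fval.
have small (e : R) : 0 < e -> exists z : C, G (disc_trace z e).
  move=> e0; have [s Hs] := fiber_totally_bounded hV pC ha c hnc rho0 e0.
  apply: contrapT => H.
  have : G (disc_trace alpha r `&` [set x | forall z, z \in s -> ~ disc_trace z e x]).
    apply: filterI => //; elim: (s) => [|z t IH]; first exact: filterS filterT.
    have Gz : G (~` disc_trace z e).
      by have [Gz|//] := in_ultra_setVsetC (disc_trace z e) UG; exfalso; apply: H; exists z.
    apply: filterS (filterI Gz IH) => x [xz xt] w; rewrite inE => /predU1P[->|/xt]//.
  move=> /filter_ex[x [xa xs]].
  have [z zs zx] := Hs _ (F_val x) (dset_bounded xa).
  exact: xs zs zx.
have cG : cauchy (v @ G).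
  apply: cauchy_exP => e e0; have e20 : 0 < e / 2 by lra.
  have [z Gz] := small _ e20; exists (z : vtop V).
  suff : G (v @^-1` ball (z : vtop V) e) by [].
  apply: filterS Gz => x; rewrite /disc_trace /preimage /= vtop_ballE /= absval_distC => H.
  by apply: le_lt_trans H _; lra.
have /cvg_ex [l vl] : cvg (v @ G) by apply: hV.
have near (e : R) : 0 < e -> exists2 x, disc_trace alpha r x & V (fval x - l) < e.
  move=> e0; have H : G (v @^-1` ball (l : vtop V) e) by apply: vl; exact: nbhsx_ballx.
  have PG : ProperFilter G by exact: ultra_proper.
  have HI : G (disc_trace alpha r `&` v @^-1` ball (l : vtop V) e) by exact: filterI.
  have [x [xa xl]] := filter_ex HI; exists x => //.
  by move: xl; rewrite /= vtop_ballE /= absval_distC.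
have la : V (l - alpha) <= r.
  have [x xa xl] := near _ r0; rewrite -(subrKA (fval x)); apply: absval_add_le => //.
  by rewrite absval_distC ltW.
have lrho : V l <= rho.
  by rewrite -(subrK alpha l); apply: absval_add_le; rewrite le_max ?la ?lexx ?orbT.
have Fl : F l = 0.
  apply: (@absval_small_eq0 _ _ V) => e e0.
  have [d d0 Hd] := F_cont hV pC ha c rho0 e0.
  have [x xa xl] := near _ d0; rewrite -[F l]subr0 -(F_val x); apply: Hd => //.
    exact: dset_bounded xa.
  by rewrite absval_distC ltW.
have [x xl] := fval_ex Fl; exists x; split; first by rewrite /disc_trace /= xl.
move=> U /nbhs_dset_ex[e e0 eU]; apply: (filterS eU).
have H : G (v @^-1` ball (l : vtop V) e) by apply: vl; exact: nbhsx_ballx.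
by apply: filterS H => y; rewrite /preimage /= vtop_ballE /disc_trace /= xl absval_distC => /ltW.
Qed.

(** The empty set is added because discs may be disjoint. It may also be the trace of a disc that
    misses the fiber. *)
Definition discs : set (set S) :=
  [set A | A = set0 \/ exists alpha r, 0 < r /\ A = disc_trace alpha r].

Lemma discs0 : discs set0. Proof. by left. Qed.

Lemma discs_dset alpha r : 0 < r -> discs (disc_trace alpha r).
Proof. by move=> r0; right; exists alpha, r. Qed.

Lemma discs_open A : discs A -> open A.
Proof. by move=> [->|[alpha [r [r0 ->]]]]; [exact: open0|exact: open_dset]. Qed.

Lemma discs_compact A : discs A -> compact A.
Proof. by move=> [->|[alpha [r [r0 ->]]]]; [exact: compact0|exact: compact_dset]. Qed.

Lemma discsI : setI_closed discs.
Proof.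
move=> A B [->|[alpha [r [r0 ->]]]]; first by rewrite set0I => _; left.
move=> [->|[beta [t [t0 ->]]]]; first by rewrite setI0; left.
have [[x [xa xb]]|H] := pselect (exists x, disc_trace alpha r x /\ disc_trace beta t x); last first.
  left; rewrite -subset0 => x [xa xb]; by apply: H; exists x.
have [rt|/ltW tr] := leP r t.
  by rewrite (setIidl (dset_sub xa xb rt)); exact: discs_dset.
by rewrite (setIidr (dset_sub xb xa tr)); exact: discs_dset.
Qed.

(** When the discs meet and the removed one has the smaller radius t, discs of radius t around
    points of the difference stay inside it and are equal or disjoint; total boundedness leaves
    finitely many. *)
Lemma discsD : semi_setD_closed discs.
Proof.
move=> A B dA [->|[beta [t [t0 ->]]]].
  exists [set A]; split; [exact: finite_set1|by move=> _ ->|by rewrite setD0 bigcup_set1|].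
  by move=> X Y -> ->.
case: dA => [->|[alpha [r [r0 ->]]]].
  by exists set0; split => //; rewrite set0D bigcup_set0.
have [[x [xa xb]]|H] := pselect (exists x, disc_trace alpha r x /\ disc_trace beta t x); last first.
  exists [set disc_trace alpha r]; split; [exact: finite_set1|by move=> _ ->; exact: discs_dset| |].
    rewrite bigcup_set1 setDE; apply/setIidl => x xa xb; by apply: H; exists x.
  by move=> X Y -> ->.
have [rt|tr] := leP r t.
  exists set0; split => //.
  by rewrite bigcup_set0 setD_eq0; exact: dset_sub xa xb rt.
have sub y : disc_trace alpha r y -> disc_trace (fval y) t `<=` disc_trace alpha r.
  move=> ya; apply: (dset_sub (x := y)) => //; last exact: ltW.
  by rewrite /disc_trace /= subrr absval0 ltW.
exists [set disc_trace (fval y) t | y in disc_trace alpha r `\` disc_trace beta t]; split.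
- pose rho := Num.max r (V alpha); have rho0 : 0 < rho by rewrite lt_max r0.
  have [s Hs] := fiber_totally_bounded hV pC ha c hnc rho0 t0.
  apply: (@sub_finite_set _ _ [set disc_trace z t | z in [set` s]]); last first.
    by apply: finite_image; exact: finite_seq.
  move=> _ [y [ya yb] <-]; have [z zs zy] := Hs _ (F_val y) (dset_bounded ya).
  by exists z => //; apply: dset_eq.
- by move=> _ [y _ <-]; exact: discs_dset.
- apply/seteqP; split => [y [ya yb]|y [_ [z [za zb] <-] yz]].
    by exists (disc_trace (fval y) t); [exists y|rewrite /disc_trace /= subrr absval0 ltW].
  split; first exact: sub za _ yz.
  move=> yb; apply: zb; rewrite /disc_trace /= -(subrKA (fval y)); apply: absval_add_le => //.
  by rewrite absval_distC.
- move=> X Y [y _ <-] [z _ <-] [w [wy wz]].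
  by rewrite /= (dset_eq wy) (dset_eq wz).
Qed.

Lemma discs_base (U : set S) : open U ->
  exists2 G : nat -> set S, (forall n, discs (G n)) & U = \bigcup_n G n.
Proof.
move=> oU.
have k0 k : 0 < k.+1%:R^-1 :> R by rewrite invr_gt0.
have ex (jk : nat * nat) : exists s : seq C, forall z, F z = 0 -> V z <= jk.1.+1%:R ->
    exists2 x, x \in s & V (z - x) <= jk.2.+1%:R^-1.
  exact: (fiber_totally_bounded hV pC ha c hnc _ (k0 _)).
have [s Hs] := choice ex.
(* The index ((j, k), l) stands for the disc of radius 1/(k+1) around entry l of a net for |z| <= j
   + 1. Indices whose disc is not inside U give the empty set, so the default entry of [nth] is
   harmless. *)
pose D (i : nat * nat * nat) := disc_trace (nth 0 (s i.1) i.2) i.1.2.+1%:R^-1.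
pose G n : set S := if (choice.unpickle n : option (nat * nat * nat)) is Some i then
  (if pselect (D i `<=` U) is left _ then D i else set0) else set0.
exists G.
  move=> n; rewrite /G; case: choice.unpickle => [i|]; last exact: discs0.
  by case: pselect => _; [exact: discs_dset|exact: discs0].
apply/seteqP; split => [x Ux|x [n _]]; last first.
  by rewrite /G; case: choice.unpickle => [i|//]; case: pselect => // H /H.
have [e e0 eU] : exists2 e, 0 < e & disc_trace (fval x) e `<=` U.
  by apply: nbhs_dset_ex; exact: open_nbhs_nbhs.
have [k /(_ k (leqnn _)) ke] := invn_small e0.
pose j := Num.truncn (V (fval x)).
have xj : V (fval x) <= j.+1%:R by rewrite ltW// truncnS_gt.
have [z zs xz] := Hs (j, k) _ (F_val x) xj.
exists (choice.pickle ((j, k), index z (s (j, k)))) => //.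
rewrite /G choice.pickleK; have DE : D (j, k, index z (s (j, k))) = disc_trace (fval x) k.+1%:R^-1.
  by rewrite /D /= nth_index//; exact: dset_eq.
case: pselect => [_|[]].
  by rewrite DE /disc_trace /= subrr absval0 ltW.
rewrite DE => y yx; apply: eU; rewrite /disc_trace /=; exact: le_trans yx (ltW ke).
Qed.

Lemma dens_dset_additive alpha r (L : seq (C * R)) : 0 < r ->
  (forall D, D \in L -> 0 < D.2) ->
  (forall x, count (fun D => V (fval x - D.1) <= D.2) L = (V (fval x - alpha) <= r)%R) ->
  dens alpha r = \sum_(D <- L) dens D.1 D.2.
Proof.
move=> r0 L0 HL; apply: dens_additive => // z /fval_ex[x <-]; exact: HL.
Qed.

Lemma dset_dens_eq alpha beta r t : 0 < r -> 0 < t -> disc_trace alpha r = disc_trace beta t ->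
  dens alpha r = dens beta t.
Proof.
move=> r0 t0 E; rewrite (dens_dset_additive (L := [:: (beta, t)]) r0) ?big_seq1//.
  by move=> D; rewrite inE => /eqP ->.
move=> x /=; rewrite addn0; congr nat_of_bool.
apply/idP/idP => H; first by have : disc_trace beta t x by []; rewrite -E.
by have : disc_trace alpha r x by []; rewrite E.
Qed.

(** By [dset_dens_eq] the value does not depend on which disc cuts out A; sets that no disc cuts out
    get 0. *)
Definition mass A : R := xget 0 [set M | exists alpha r, [/\ 0 < r, A = disc_trace alpha r & M = dens alpha r]].

Lemma mass_dset alpha r : 0 < r -> mass (disc_trace alpha r) = dens alpha r.
Proof.
move=> r0; rewrite /mass; case: xgetP => [_ -> [beta [t [t0 E ->]]]|/(_ (dens alpha r))].
  exact/esym/dset_dens_eq.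
by case; exists alpha, r.
Qed.

Lemma mass_ge0 A : 0 <= mass A.
Proof.
rewrite /mass; case: xgetP => [_ -> [alpha [r [r0 _ ->]]]|//]; exact: dens_ge0.
Qed.

Lemma mass0 : mass set0 = 0.
Proof.
rewrite /mass; case: xgetP => [_ -> [alpha [r [r0 E ->]]]|//].
rewrite (dens_dset_additive (L := [::]) r0) ?big_nil// => x.
by case: leP => // H; have : disc_trace alpha r x by []; rewrite -E.
Qed.

Lemma mass_additive A n (G : nat -> set S) : discs A -> (forall i, discs (G i)) ->
  trivIset setT G -> A = \bigcup_(i < n) G i -> mass A = \sum_(i < n) mass (G i).
Proof.
move=> dA dG tG AE.
have [/eqP A0|A0] := boolP (A == set0).
  have G0 i : (i < n)%N -> G i = set0.
    by move=> iN; rewrite -subset0 -A0 AE => x Gx; exists i.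
  by rewrite A0 mass0 big1// => i _; rewrite G0 ?mass0.
case: dA => [/eqP|[alpha [r [r0 Ar]]]]; first by rewrite (negbTE A0).
have ex i : exists D : C * R, G i !=set0 -> 0 < D.2 /\ G i = disc_trace D.1 D.2.
  case: (dG i) => [->|[beta [t [t0 ->]]]]; first by exists (0, 0) => -[].
  by exists (beta, t).
have [D HD] := choice ex.
(* Empty pieces carry no disc and are dropped; their mass is 0. *)
pose L := [seq D i | i <- iota 0 n & `[< G i !=set0 >] ].
have inL : forall E, E \in L -> exists i, [/\ E = D i, (i < n)%N & G i !=set0].
  move=> E /mapP[i]; rewrite mem_filter mem_iota add0n => /andP[/asboolP Gi iN] ->.
  by exists i.
rewrite Ar mass_dset// (dens_dset_additive (L := L) r0).
- rewrite /L big_map big_filter -[n in LHS]subn0 -/(index_iota 0 n) big_mkord.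
  rewrite big_mkcond /=; apply: eq_bigr => i _; case: asboolP => [Gi|Gi].
    by have [t0 GE] := HD i Gi; rewrite GE mass_dset.
  have -> : G i = set0 by apply/eqP; apply: contra_notT Gi => /set0P.
  by rewrite mass0.
- by move=> E /inL[i [-> _ /HD[]]].
move=> x; rewrite /L count_map count_filter.
have memG i : G i !=set0 -> G i x = (V (fval x - (D i).1) <= (D i).2).
  by move=> Gi; have [_ GE] := HD i Gi; rewrite {1}GE.
rewrite (@eq_count _ _ (fun i => `[< G i x >])); last first.
  move=> i /=; case: (asboolP (G i !=set0)) => Gi; rewrite ?andbT ?andbF.
    by apply/esym; apply/asboolP/idP; rewrite memG.
  by apply/esym/asboolP => Gx; apply: Gi; exists x.
have -> : (V (fval x - alpha) <= r) = `[< A x >] by rewrite Ar; apply/idP/asboolP.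
have [Ax|Ax] := pselect (A x).
  rewrite (asboolT Ax); move: (Ax); rewrite AE => -[i iN Gx].
  rewrite (@eq_count _ _ (pred1 i)); last first.
    move=> j /=; apply/asboolP/eqP => [Gj|->//].
    by apply: tG => //; exists x.
  by rewrite count_uniq_mem ?iota_uniq// mem_iota add0n iN.
rewrite (asboolF Ax) (@eq_in_count _ _ pred0) ?count_pred0// => i.
rewrite mem_iota add0n => iN /=; apply/asboolP => Gx; apply: Ax; rewrite AE.
by exists i.
Qed.

End FiberSpace.

(** * Lower convex hulls and supporting lines *)

Section ConvexHull.
Context {R : realType}.
Implicit Types (X : set (R^o * R^o)) (P Q : R^o * R^o).

Lemma convex_setP X : convex_set X <-> forall P Q (l : R), 0 <= l <= 1 -> X P -> X Q ->
  X (l * P.1 + (1 - l) * Q.1, l * P.2 + (1 - l) * Q.2).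
Proof.
split => [cX P Q l /andP[l0 l1] XP XQ|H P Q l].
  by have := cX P Q (Itv01 l0 l1) (mem_set XP) (mem_set XQ); rewrite in_setE.
rewrite !in_setE => XP XQ; have := H P Q l%:num _ XP XQ; apply.
by rewrite ge0 le1.
Qed.

Lemma convex_hull_convex X P Q (l : R) : 0 <= l <= 1 -> convex_hull X P -> convex_hull X Q ->
  convex_hull X (l * P.1 + (1 - l) * Q.1, l * P.2 + (1 - l) * Q.2).
Proof.
by move=> l01 XP XQ M [cM XM]; apply: (convex_setP M).1 => //; [apply: XP|apply: XQ].
Qed.

Lemma sub_convex_hull X : X `<=` convex_hull X.
Proof. by move=> P XP M [_]; exact. Qed.

(** k is the minimum of y - s x on X, attained only at abscissas between x1 and x2, both of which
    occur. A non-degenerate segment of slope s on the lower boundary lies on the line y = s x + k,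
    hence between these extreme contact points. *)
Lemma support_line_length X (s k x1 x2 : R) :
  (forall P, X P -> k <= P.2 - s * P.1) ->
  (forall P, X P -> P.2 - s * P.1 = k -> x1 <= P.1 <= x2) ->
  X (x1, k + s * x1) -> X (x2, k + s * x2) -> x1 <= x2 ->
  ereal_sup [set l%:E | l in [set l : R | 0 <= l /\ exists P : R^o * R^o,
    forall t : R, 0 <= t <= l ->
      convex_hull X (P.1 + t, P.2 + s * t) /\
      forall y, convex_hull X (P.1 + t, y) -> P.2 + s * t <= y]] = (x2 - x1)%:E.
Proof.
move=> Xge Xeq X1 X2 x12.
have hull P : convex_hull X P -> k <= P.2 - s * P.1 /\ (P.2 - s * P.1 = k -> x1 <= P.1 <= x2).
  (* M is convex and contains X, so both properties pass to the hull. *)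
  pose M : set (R^o * R^o) := [set P | k <= P.2 - s * P.1 /\ (P.2 - s * P.1 = k -> x1 <= P.1 <= x2)].
  suff : convex_set M /\ X `<=` M by move=> HM /(_ M HM).
  split; last by move=> Q XQ; split; [exact: Xge|exact: Xeq].
  apply/convex_setP => {}P Q l /andP[l0 l1] [P1 P2] [Q1 Q2].
  have H : l * P.2 + (1 - l) * Q.2 - s * (l * P.1 + (1 - l) * Q.1) =
    l * (P.2 - s * P.1) + (1 - l) * (Q.2 - s * Q.1) by ring.
  split; rewrite /= H; first by nra.
  have [l00|l00] := eqVneq l 0; first by rewrite l00 !mul0r subr0 !mul1r !add0r.
  have [l11|l11] := eqVneq l 1; first by rewrite l11 subrr !mul0r !mul1r !addr0.
  have lp : 0 < l by rewrite lt_neqAle eq_sym l00.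
  have lq : 0 < 1 - l by rewrite subr_gt0 lt_neqAle l11.
  move=> E.
  have /P2/andP[P3 P4] : P.2 - s * P.1 = k by apply/le_anti; rewrite P1 andbT; nra.
  have /Q2/andP[Q3 Q4] : Q.2 - s * Q.1 = k by apply/le_anti; rewrite Q1 andbT; nra.
  by apply/andP; split; nra.
apply/eqP; rewrite eq_le; apply/andP; split.
  apply: ge_ereal_sup => _ [l [l0 [P HP]] <-]; rewrite lee_fin.
  have [->|ln0] := eqVneq l 0; first by rewrite subr_ge0.
  have lp : 0 < l by rewrite lt_neqAle eq_sym ln0.
  have [H0 m0] := HP 0 ltac:(by rewrite lexx ltW).
  have [Hl ml] := HP l ltac:(by rewrite lexx ltW).
  rewrite !(addr0, mulr0) in H0 m0.
  (* No hull point Q lies below the line of the segment: joining Q to the far end if Q is on the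
     left, or to P if it is on the right, would give a hull point below a point of the segment. *)
  have above Q : convex_hull X Q -> P.2 - s * P.1 <= Q.2 - s * Q.1.
    move=> HQ; rewrite leNgt; apply/negP => lt.
    have [QP|PQ] := leP Q.1 P.1.
      have d0 : 0 < P.1 + l - Q.1 by lra.
      pose w : R := (P.1 - Q.1) / (P.1 + l - Q.1).
      have wE : w * (P.1 + l - Q.1) = P.1 - Q.1 by rewrite divfK// gt_eqF.
      have w0 : 0 <= w by apply: divr_ge0; lra.
      have w1 : w < 1 by nra.
      have := convex_hull_convex (l := w) _ Hl HQ; rewrite w0 ltW// => /(_ isT) /=.
      have -> : w * (P.1 + l) + (1 - w) * Q.1 = P.1 by rewrite -[RHS](subrK Q.1) -wE; ring.
      move=> /m0; apply/negP; rewrite -ltNge.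
      have E : w * (P.1 + l) + (1 - w) * Q.1 = P.1 by rewrite -[RHS](subrK Q.1) -wE; ring.
      have : 0 < (1 - w) * (P.2 - s * P.1 - (Q.2 - s * Q.1)) by rewrite mulr_gt0; lra.
      have : s * (w * (P.1 + l) + (1 - w) * Q.1) = s * P.1 by rewrite E.
      by move=> {wE E} E1 E2; nra.
    pose A := Num.min Q.1 (P.1 + l).
    have [AQ Al AP] : [/\ A <= Q.1, A <= P.1 + l & P.1 < A].
      by split; rewrite /A ?ge_min ?lexx ?orbT// lt_min PQ ltrDl.
    have d0 : 0 < Q.1 - P.1 by lra.
    pose w : R := (A - P.1) / (Q.1 - P.1).
    have wE : w * (Q.1 - P.1) = A - P.1 by rewrite divfK// gt_eqF.
    have w0 : 0 < w by apply: divr_gt0; lra.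
    have w1 : w <= 1 by nra.
    have := convex_hull_convex (l := w) _ HQ H0; rewrite ltW// w1 => /(_ isT) /=.
    have E : w * Q.1 + (1 - w) * P.1 = P.1 + (A - P.1) by rewrite -wE; ring.
    rewrite E.
    have [_ mA] := HP (A - P.1) ltac:(by apply/andP; split; lra).
    move=> /mA; apply/negP; rewrite -ltNge.
    have : 0 < w * (P.2 - s * P.1 - (Q.2 - s * Q.1)) by rewrite mulr_gt0; lra.
    have : s * (w * Q.1 + (1 - w) * P.1) = s * (P.1 + (A - P.1)) by rewrite E.
    by move=> {wE E} E1 E2; nra.
  have Pk : P.2 - s * P.1 = k.
    apply/le_anti; rewrite (hull _ H0).1 andbT.
    by have := above _ (sub_convex_hull X1) => /=; lra.
  have /andP[P1 _] := (hull _ H0).2 Pk.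
  have /(hull _ Hl).2/andP[_ P2] : (P.1 + l, P.2 + s * l).2 - s * (P.1 + l, P.2 + s * l).1 = k.
    by rewrite /= -Pk; ring.
  by move: P1 P2 => /=; lra.
apply: ereal_sup_ubound; exists (x2 - x1) => //; split; first by rewrite subr_ge0.
exists (x1, k + s * x1) => t /andP[t0 t1] /=; split; last first.
  by move=> y /hull[] /=; lra.
have [E|x12'] := eqVneq x1 x2.
  have -> : t = 0 by apply/le_anti; rewrite t0 andbT; move: t1; rewrite E subrr.
  by rewrite mulr0 !addr0; exact: sub_convex_hull.
have d0 : 0 < x2 - x1 by rewrite subr_gt0 lt_neqAle x12'.
pose w := t / (x2 - x1); have wE : w * (x2 - x1) = t by rewrite divfK// gt_eqF.
have w01 : 0 <= w <= 1 by apply/andP; split; [rewrite divr_ge0// ltW|rewrite ler_pdivrMr// mul1r].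
have := convex_hull_convex w01 (sub_convex_hull X2) (sub_convex_hull X1) => /=.
by congr convex_hull; congr pair; rewrite -wE; ring.
Qed.

End ConvexHull.

(** * Slopes of the Newton polygon and dominant exponents *)

Section Slopes.
Context {R : realType} {C : closedFieldType} (V : nonarch_absval R C).
Context (p : nat) (a : rat -> C) (ha : in_P V p a) (c : C) (hnc : nonconstant a).
Local Notation b := (sub_const a c).
Local Notation gauss := (gauss_term V a c).
Local Notation edom := (edom V a c).

(** The first maximiser: the left end of the segment of slope ln rho, whose right end is given by
    [edom]. It will also be the mass of the open disc of radius rho. *)
Definition emin (rho : R) (e : rat) := [/\ b e != 0,
  forall e', gauss rho e' <= gauss rho e &
  forall e', e' < e -> gauss rho e' < gauss rho e].

Lemma emin_exists (rho : R) : 0 < rho -> exists e, emin rho e.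
Proof.
have [e1 e10 ae1] := hnc; move=> rho0.
have [||e [e0 H1 H2]] := @exists_dominant R rat (gauss rho) (fun e => - ratr e).
- by exists e1; rewrite gauss_gt0// /sub_const (negbTE e10) subr0.
- by move=> eps eps0; exact: (gauss_finite_ge ha).
exists e; split=> // [|e' ee']; last by apply: H2; rewrite ltrN2 ltr_rat.
by apply: contraTneq e0; rewrite /gauss_term => ->; rewrite absval0 mul0r ltxx.
Qed.

(** At radius exp s the largest Gauss term corresponds to the smallest v(b_e) - s e, so the dominant
    exponents are the contacts with the supporting line of slope s. *)
Lemma gauss_expR (s : R) e : b e != 0 ->
  gauss (expR s) e = expR (s * ratr e - - ln (V (b e))).
Proof.
move=> be; rewrite opprK expRD /gauss_term lnK ?posrE ?absval_gt0// mulrC.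
by rewrite /powR gt_eqF ?expR_gt0// expRK (mulrC (ratr e)).
Qed.

Lemma slope_length_gauss (s : R) e e' : edom (expR s) e -> emin (expR s) e' ->
  slope_length V b s = (ratr e - ratr e')%:E.
Proof.
move=> [be e1 e2] [be' e1' e2'].
pose w e := - ln (V (b e)).
have val e0 (y : R) : valuation V (b e0) = y%:E -> b e0 != 0 /\ y = w e0.
  by rewrite /valuation; case: eqP => // _ [<-].
have val' e0 : b e0 != 0 -> valuation V (b e0) = (w e0)%:E.
  by move=> b0; rewrite /valuation (negbTE b0).
pose k := w e - s * ratr e.
have ke' : w e' - s * ratr e' = k.
  have : gauss (expR s) e = gauss (expR s) e' by apply/le_anti; rewrite e1 e1'.
  by rewrite !gauss_expR// => /expR_inj; rewrite /k /w; lra.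
have ge e0 : b e0 != 0 -> k <= w e0 - s * ratr e0.
  by move=> b0; have := e1 e0; rewrite !gauss_expR// ler_expR /k /w; lra.
have gt e0 : b e0 != 0 -> e < e0 -> k < w e0 - s * ratr e0.
  by move=> b0 /e2; rewrite !gauss_expR// ltr_expR /k /w; lra.
have lt e0 : b e0 != 0 -> e0 < e' -> k < w e0 - s * ratr e0.
  by move=> b0 /e2'; rewrite !gauss_expR// ltr_expR -ke' /w; lra.
rewrite /slope_length /newton_polygon -(@support_line_length _ (newton_points V b) s k).
- by [].
- by move=> [x y] [e0 [/= -> /val[b0 ->]]]; exact: ge.
- move=> [x y] [e0 [/= -> /val[b0 ->]]] E; rewrite !ler_rat !leNgt; apply/andP; split.
    by apply/negP => /(lt _ b0); rewrite E ltxx.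
  by apply/negP => /(gt _ b0); rewrite E ltxx.
- by exists e'; split => //=; rewrite val'// -ke'; congr EFin; ring.
- by exists e; split => //=; rewrite val'// /k; congr EFin; ring.
- rewrite ler_rat leNgt; apply/negP => /e2; apply/negP; rewrite -leNgt.
  exact: e1'.
Qed.

(** Passing from r to rho multiplies the term of exponent e by (rho / r)^e, which favours larger
    exponents. *)
Lemma edom_lt_emin (r rho : R) e e' : 0 < r -> r < rho -> edom r e -> emin rho e' -> e <= e'.
Proof.
move=> r0 rrho [be e1 _] [be' e1' _]; rewrite leNgt; apply/negP => ee'.
have rho0 := lt_trans r0 rrho.
have : gauss r e' * (rho / r) `^ ratr e' < gauss r e * (rho / r) `^ ratr e.
  apply: (@le_lt_trans _ _ (gauss r e * (rho / r) `^ ratr e')).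
    by rewrite ler_wpM2r ?powR_ge0.
  rewrite ltr_pM2l ?gauss_gt0//.
  have q1 : 1 < rho / r by rewrite ltr_pdivlMr// mul1r.
  rewrite -(subrK (ratr e') (ratr e)) powRD; last first.
    by rewrite (gt_eqF (divr_gt0 rho0 r0)) implybT.
  rewrite ltr_pMl ?powR_gt0 ?divr_gt0//.
  have d0 : 0 < ratr e - ratr e' :> R by rewrite subr_gt0 ltr_rat.
  have : 1 `^ (ratr e - ratr e') < (rho / r) `^ (ratr e - ratr e').
    by apply: gt0_ltr_powR => //; rewrite nnegrE// ltW// divr_gt0.
  by rewrite powR1.
have E e0 : gauss r e0 * (rho / r) `^ ratr e0 = gauss rho e0.
  rewrite /gauss_term -mulrA -powRM ?ltW ?divr_gt0//; congr (_ * _ `^ _).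
  by field; rewrite gt_eqF.
by rewrite !E ltNge e1'.
Qed.

(** Exponents below e' lose strictly to e' at rho. Only finitely many of them compete near rho, and
    each is beaten from some radius below rho on. *)
Lemma edom_near_emin (rho : R) e' : 0 < rho -> emin rho e' ->
  exists2 r, 0 < r < rho & forall e, edom r e -> e' <= e.
Proof.
move=> rho0 em; have [be' e1 e2] := em.
(* A lower bound for the term of e' at all radii from rho / 2 to rho; exponents whose term at rho is
   smaller never compete. *)
have h0 : 0 < gauss rho e' * (1 / 2) `^ ratr e' by rewrite mulr_gt0 ?gauss_gt0 ?powR_gt0//; lra.
have /finite_seqP[t tE] := gauss_finite_ge ha c rho0 h0.
have thr e0 : e0 < e' -> exists2 r0, 0 < r0 < rho & forall r, r0 <= r -> r < rho ->
    gauss r e0 <= gauss r e'.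
  move=> ee'; have lt := e2 _ ee'.
  have [b0|b0] := eqVneq (b e0) 0.
    exists (rho / 2); first by lra.
    by move=> r _ _; rewrite /gauss_term b0 absval0 mul0r gauss_ge0.
  have d0 : 0 < ratr e' - ratr e0 :> R by rewrite subr_gt0 ltr_rat.
  (* The radius at which the terms of e0 and e' tie. *)
  pose u := (V (b e0) / V (b e')) `^ (ratr e' - ratr e0)^-1.
  have Vb' := absval_gt0 V be'; have Vb0 := absval_gt0 V b0.
  have uE : u `^ (ratr e' - ratr e0) = V (b e0) / V (b e').
    by rewrite /u -powRrM mulVf ?gt_eqF// powRr1// divr_ge0 ?absval_ge0.
  have u0 : 0 < u by rewrite powR_gt0 ?divr_gt0.
  have split r : 0 < r -> (gauss r e0 <= gauss r e') = (u <= r).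
    move=> r0; rewrite /gauss_term -(subrK (ratr e0) (ratr e')) powRD; last by rewrite (gt_eqF r0) implybT.
    rewrite mulrA ler_pM2r ?powR_gt0// mulrC -ler_pdivrMr// -uE.
    apply/idP/idP => [|ur].
      by apply: contraTT; rewrite -!ltNge => ru; rewrite gt0_ltr_powR ?nnegrE ?ltW.
    by rewrite ge0_ler_powR ?nnegrE ?(ltW d0) ?(ltW u0) ?(ltW r0).
  exists u; last by move=> r ur _; rewrite split// (lt_le_trans u0).
  rewrite u0 /=; rewrite ltNge; apply/negP => H.
  have := split _ rho0; rewrite (ltW lt) => /esym; move: H; rewrite le_eqVlt => /predU1P[E|].
    move=> _; move: lt; rewrite /gauss_term -(subrK (ratr e0) (ratr e')) powRD ?(gt_eqF rho0) ?implybT//.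
    by rewrite mulrA ltr_pM2r ?powR_gt0// E uE mulrC divfK ?gt_eqF// ltxx.
  by rewrite ltNge => /negP.
have [r0 /andP[r00 r0rho] H] : exists2 r0, 0 < r0 < rho & forall r, r0 <= r -> r < rho ->
    forall e0, e0 \in t -> e0 < e' -> gauss r e0 <= gauss r e'.
  elim: (t) => [|e0 t' [r1 /andP[r10 r1rho] IH]]; first by exists (rho / 2); [lra|].
  have [ee'|ee'] := boolP (e0 < e').
    have [r2 /andP[r20 r2rho] H2] := thr _ ee'.
    exists (Num.max r1 r2); first by rewrite lt_max r10 gt_max r1rho.
    move=> r; rewrite ge_max => /andP[r1r r2r] rr e3; rewrite inE => /predU1P[->|]; first by move=> _; exact: H2.
    exact: IH.
  exists r1; first by rewrite r10.
  by move=> r r1r rr e3; rewrite inE => /predU1P[->|]; [rewrite (negbTE ee')|exact: IH].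
pose r := Num.max r0 (rho / 2).
have [rr0 rr2 rrho] : [/\ r0 <= r, rho / 2 <= r & r < rho].
  by rewrite /r !le_max !lexx orbT gt_max r0rho; split => //; lra.
have rp : 0 < r by exact: lt_le_trans rr0.
exists r; first by rewrite rp.
move=> e [be ee1 ee2]; rewrite leNgt; apply/negP => ee'.
have := ee2 _ ee'; rewrite ltNge => /negP; apply.
have [et|et] := boolP (e \in t); first exact: H.
have lt : gauss rho e < gauss rho e' * (1 / 2) `^ ratr e'.
  rewrite ltNge; apply: contra et => Hge.
  have : [set e | gauss rho e' * (1 / 2) `^ ratr e' <= gauss rho e] e by [].
  by rewrite tE.
have ge0 e0 : b e0 != 0 -> 0 <= ratr e0 :> R by move=> /(sub_const_ge0 ha) e00; rewrite ler0q.
apply: le_trans (_ : gauss rho e <= _).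
  by rewrite ler_wpM2l ?absval_ge0// ge0_ler_powR ?nnegrE ?ge0 ?(ltW rp) ?(ltW rho0) ?(ltW rrho).
have h2 : 0 <= 1 / 2 :> R by lra.
apply: le_trans (ltW lt) _; rewrite /gauss_term -mulrA -powRM ?(ltW rho0)//.
by rewrite ler_wpM2l ?absval_ge0// ge0_ler_powR ?nnegrE ?ge0 ?(ltW rp)//; lra.
Qed.

End Slopes.

(** * Additive series and translation of discs *)

Section AdditiveSeries.
Context {R : realType} {C : closedFieldType} (V : nonarch_absval R C).
Context (hV : is_complete V) (p : nat) (pC : p \in [pchar C]).

(** Compare coefficients in (X + 1)^(p^i) = X^(p^i) + 1. *)
Lemma bin_pchar i j : (0 < j)%N -> j != (p ^ i)%N -> ('C(p ^ i, j)%:R : C) = 0.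
Proof.
move=> j0 ji; have pP : p \in [pchar {poly C}] by rewrite pchar_poly.
have : (('X + 1 : {poly C}) ^+ (p ^ i))`_j = 0.
  by rewrite exprDn_pchar ?pnat_pchar// expr1n coefD coefXn coef1 (negbTE ji) gtn_eqF// addr0.
rewrite exprDn coef_sum.
under eq_bigr => k _ do rewrite expr1n mulr1 coefMn coefXn.
have [jp|pj] := ltnP j (p ^ i).+1; last by rewrite bin_small.
have pj : (p ^ i - j < (p ^ i).+1)%N by rewrite ltnS leq_subr.
rewrite (bigD1 (Ordinal pj)) //= subKn; last by rewrite -ltnS.
rewrite eqxx big1 => [|k kj]; last first.
  case: eqP => [E|_]; last by rewrite mul0rn.
  case/eqP: kj; apply: val_inj => /=; have := ltn_ord k; lia.
by rewrite addr0 bin_sub// -ltnS.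
Qed.

(** All intermediate binomial coefficients of a power of p vanish in C, so re-expansion changes the
    constant term only. *)
Lemma T_additive g alpha : econv V g -> (forall m, g m != 0 -> exists i, m = (p ^ i)%N) ->
  taylor V alpha g = (fun j => if j == 0%N then eval_ps V g alpha else g j).
Proof.
move=> cg gp; apply/funext => j; case: eqP => [->|/eqP j0]; first exact: T_head.
rewrite /taylor; have -> : (fun m => g (m + j)%N *+ 'C(m + j, j)) = coefs (g j)%:P.
  apply/funext => m; rewrite /coefs coefC; case: eqP => [->|/eqP m0].
    by rewrite binn mulr1n.
  have [->|/gp[i mi]] := eqVneq (g (m + j)%N) 0; first by rewrite mul0rn.
  by rewrite mi -mulr_natr bin_pchar ?mulr0 ?lt0n//; apply/eqP => E; move: m0; rewrite -lt0n; lia.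
by rewrite ev_coefs// hornerC.
Qed.

Lemma ev_additive g x y : econv V g -> (forall m, g m != 0 -> exists i, m = (p ^ i)%N) ->
  eval_ps V g (x + y) = eval_ps V g x + eval_ps V g y.
Proof.
move=> cg gp; have g0 : g 0%N = 0.
  apply/eqP; apply: contraT => /gp[i /esym/eqP].
  by rewrite expn_eq0 (gtn_eqF (prime_gt0 (pcharf_prime pC))).
have cT := conv_T hV x cg.
rewrite -ev_T//; have := evB hV y cT cg.
have -> : taylor V x g \- g = coefs (eval_ps V g x)%:P.
  apply/funext => j; rewrite (T_additive _ cg gp) /coefs coefC /=.
  by case: eqP => [->|_]; rewrite ?g0 ?subr0 ?subrr.
by rewrite ev_coefs// hornerC => ->; rewrite subrK.
Qed.

End AdditiveSeries.

Section AdditiveFiber.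
Context {R : realType} {C : closedFieldType} (V : nonarch_absval R C).
Context (hV : is_complete V) (p k : nat) (pC : p \in [pchar C]).
Context (a : rat -> C) (hF : in_F V p (p ^ k) a) (hnc : nonconstant a).
Local Notation gn := (frob_trunc p a 0).
Local Notation F := (feval_sub V a 0).
Local Notation dens := (dens V p a 0).

Let ha : in_P V p a. Proof. by case: hF. Qed.
Let hp : prime p. Proof. exact: pcharf_prime pC. Qed.
Let p0 n : (0 < p ^ n)%N. Proof. by rewrite expn_gt0 prime_gt0. Qed.

(** For a negative power of q, the relation m / p^n = q^(-i) makes m a divisor of p^n. *)
Lemma gn_additive n m : gn n m != 0 -> exists i, m = (p ^ i)%N.
Proof.
have pn n' : ((p ^ n')%:R : rat) != 0 by rewrite pnatr_eq0 -lt0n p0.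
rewrite /frob_trunc expf_eq0 p0 /= /sub_const if_same subr0 => /hF.2[[i|i] E].
  exists (k * i + n)%N; apply/eqP; rewrite -(eqr_nat rat); apply/eqP.
  have -> : m%:R = (p ^ k)%:R ^+ i * (p ^ n)%:R :> rat.
    by rewrite exprnP -E divfK.
  by rewrite -natrX -natrM -expnM -expnD.
have mp : (m * p ^ (k * i.+1) = p ^ n)%N.
  apply/eqP; rewrite -(eqr_nat rat); apply/eqP; rewrite natrM expnM natrX.
  have -> : m%:R = (p ^ k)%:R ^- i.+1 * (p ^ n)%:R :> rat.
    by rewrite exprnN -NegzE -E divfK.
  by rewrite mulrAC mulVf ?mul1r// expf_neq0.
have /(dvdn_pfactor _ _ hp)[j _ ->] : (m %| p ^ n)%N by rewrite -mp dvdn_mulr.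
by exists j.
Qed.

Lemma F_zero : F 0 = 0.
Proof.
apply: (@absval_small_eq0 _ _ V) => e e0.
have [n /(_ n (leqnn _)) tl] := tail_exists pC ha ltr01 e0.
apply: (F_root hV pC ha ltr01 e0 _ tl); first by rewrite absval0.
have cg := gn_conv pC ha 0 n; have := ev_additive hV pC 0 0 cg (@gn_additive n).
by rewrite addr0 => /eqP; rewrite -subr_eq subrr eq_sym => /eqP.
Qed.

(** Additivity is used for g_n, which is at most e^(p^n) in absolute value at zeros of f, with e > 0
    arbitrary. *)
Lemma F_sub x y : F x = 0 -> F y = 0 -> F (x - y) = 0.
Proof.
move=> Fx Fy; apply: (@absval_small_eq0 _ _ V) => e e0.
pose rho := Num.max 1 (Num.max (V x) (V y)).
have [r1 xr yr] : [/\ 1 <= rho, V x <= rho & V y <= rho] by rewrite /rho !le_max !lexx !orbT.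
have rho0 : 0 < rho by exact: lt_le_trans r1.
have [n /(_ n (leqnn _)) tl] := tail_exists pC ha rho0 e0.
have cg := gn_conv pC ha 0 n.
have small z : V z <= rho -> F z = 0 -> V (eval_ps V (gn n) z) <= e ^+ (p ^ n).
  move=> zr Fz; have := gn_F hV pC ha 0 rho0 e0 zr tl.
  by rewrite Fz expr0n (gtn_eqF (p0 n)) subr0.
have E : eval_ps V (gn n) (x - y) = eval_ps V (gn n) x - eval_ps V (gn n) y.
  have := ev_additive hV pC (x - y) y cg (@gn_additive n).
  by rewrite subrK => ->; rewrite addrK.
have xyr : V (x - y) <= rho by apply: absval_sub_le.
apply: (@ler_expI _ _ _ (p ^ n)) (p0 n) (ltW e0) _; rewrite -absvalX.
rewrite (_ : _ ^+ _ = eval_ps V (gn n) (x - y) - (eval_ps V (gn n) (x - y) - F (x - y) ^+ (p ^ n))); last by ring.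
apply: absval_sub_le; last exact: (gn_F hV pC ha 0 rho0 e0 xyr tl).
by rewrite E; apply: absval_sub_le; exact: small.
Qed.

Lemma dens_translate alpha beta r : 0 < r -> F alpha = 0 -> dens (beta + alpha) r = dens beta r.
Proof.
move=> r0 Fa; pose rho := Num.max 1 (V alpha).
have [r1 ar] : 1 <= rho /\ V alpha <= rho by rewrite /rho !le_max !lexx !orbT.
have rho0 : 0 < rho by exact: lt_le_trans r1.
have [kap kap0 [n1 Hn1]] := T_gn_lower hV pC ha 0 hnc beta r0.
have eta0 : 0 < kap / 2 by lra.
have [n2 Hn2] := tail_exists pC ha rho0 eta0.
have [n3 Hn3] := densP hV pC ha 0 hnc beta r0.
apply: (is_dens_unique pC) (densP hV pC ha 0 hnc _ r0) _.
exists (maxn n1 (maxn n2 n3)) => n; rewrite !geq_max => /and3P[n1n n2n n3n].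
have [N [dN lower]] := Hn1 _ n1n; have tl := Hn2 _ n2n; have [N' [dN' NE]] := Hn3 _ n3n.
exists N; split; last by rewrite (dom_unique dN dN').
have cg := gn_conv pC ha 0 n.
have [] // := @dom_perturb _ _ V _ (taylor V (beta + alpha) (gn n)) _ _ r0 dN.
move=> m; apply: lt_le_trans lower.
apply: (@le_lt_trans _ _ ((kap / 2) ^+ (p ^ n))); last first.
  by rewrite ltrXn2r ?(gtn_eqF (p0 n)) ?(ltW eta0)//; lra.
rewrite !(T_additive hV pC _ cg (@gn_additive n)) /=.
case: eqP => [->|_]; last by rewrite subrr absval0 mul0r exprn_ge0// ltW.
rewrite expr0 mulr1 (ev_additive hV pC _ _ cg (@gn_additive n)) addrC addKr.
have := gn_F hV pC ha 0 rho0 eta0 ar tl.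
by rewrite Fa expr0n (gtn_eqF (p0 n)) subr0.
Qed.

End AdditiveFiber.

(** * Ordinary power series *)

Section PowerSeriesFiber.
Context {R : realType} {C : closedFieldType} (V : nonarch_absval R C).
Context (hV : is_complete V) (p : nat) (pC : p \in [pchar C]).
Context (a : rat -> C) (ha : in_P V p a) (c : C) (hnc : nonconstant a).
Context (hps : is_power_series a).
Local Notation F := (feval_sub V a c).
Local Notation dens := (dens V p a c).
Local Notation g := (fun n : nat => sub_const a c n%:R).

Lemma gn0E : frob_trunc p a c 0 = g.
Proof. by apply/funext => m; rewrite /frob_trunc expn0 divr1 expr1. Qed.

(** Integral exponents are fractions over every p^n, so f_n misses nothing and any eta will do; the
    approximations become equalities already at n = 0. *)
Lemma tail_power_series n (rho eta : R) : tail V p a n rho eta.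
Proof.
move=> e ae H; exfalso; have [m em] := hps ae; apply: (H (m * p ^ n)%N).
rewrite natrM mulfK// pnatr_eq0 -lt0n expn_gt0 prime_gt0//.
exact: pcharf_prime pC.
Qed.

Lemma g_conv : econv V g.
Proof. by rewrite -gn0E; exact: gn_conv. Qed.

Lemma ev_F z : eval_ps V g z = F z.
Proof.
apply/eqP; rewrite -subr_eq0; apply/eqP; apply: (@absval_small_eq0 _ _ V) => e e0.
have z0 : 0 < V z + 1 by rewrite ltr_wpDl// absval_ge0.
have zz : V z <= V z + 1 by rewrite lerDl.
have := gn_F hV pC ha c z0 e0 zz (@tail_power_series 0 _ _).
by rewrite gn0E expn0 !expr1.
Qed.

Lemma g_neq0 : exists m, g m != 0.
Proof.
have [e e0 ae] := hnc; have [m em] := hps ae; exists m.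
by rewrite /sub_const -em (negbTE e0) subr0.
Qed.

(** Here g_n is exactly the p^n-th power of f - c, so its dominant index is p^n times the number of
    zeros. *)
Lemma dens_power_series alpha r s h : 0 < r -> decomp V g alpha r s h ->
  dens alpha r = (size s)%:R.
Proof.
move=> r0 dg; apply: (is_dens_unique pC) (densP hV pC ha c hnc alpha r0) _.
exists 0%N => n _; have dd := decomp_dom hV r0 dg.
have q0 : (0 < p ^ n)%N by rewrite expn_gt0 prime_gt0// (pcharf_prime pC).
exists (size s * p ^ n)%N; split; last by rewrite natrM.
have -> : frob_trunc p a c n = frob (p ^ n) g.
  apply/funext => m; apply/eqP; rewrite -subr_eq0; apply/eqP.
  apply: (@absval_small_eq0 _ _ V) => e e0.
  have e1 : 0 < Num.min 1 e by rewrite lt_min ltr01.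
  have := gn_frob pC c n m ltr01 e1 (@tail_power_series 0 _ _).
  rewrite gn0E add0n expr1n mulr1 => H; apply: le_trans H _.
  apply: (@le_trans _ _ (Num.min 1 e)); last by rewrite ge_min lexx orbT.
  rewrite -[leRHS]expr1; apply: ler_wiXn2l => //; first exact: ltW.
  by rewrite ge_min lexx.
rewrite (T_frob hV pC)//; last exact: g_conv.
by have [] := dom_frob q0 r0 dd.
Qed.

(** Zeros of f - c are isolated. A disc about z small enough to contain no other zero counts z
    alone, and counts nothing if z is not a zero. *)
Lemma dens_zero_mult z : exists2 r, 0 < r &
  (forall y, F y = 0 -> V (y - z) <= r -> y = z) /\
  zero_mult V g z = (dens z r)%:E.
Proof.
have [m gm] := g_neq0.
have [s [h dg]] := decomp_exists hV z g_conv ltr01 gm.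
have [|d d0 Hd] := @seq_pos_lower_bound R C (seq.filter (predC1 z) s) (fun x => V (x - z)).
  by move=> x; rewrite mem_filter /= => /andP[xz _]; rewrite absval_gt0// subr_eq0.
pose r := Num.min 1 (d / 2).
have r0 : 0 < r by rewrite lt_min ltr01 divr_gt0.
have [r1 rd] : r <= 1 /\ r < d.
  by split; [rewrite ge_min lexx|rewrite gt_min; apply/orP; right; lra].
have isol x : x \in s -> V (x - z) <= r -> x = z.
  move=> xs xr; apply/eqP; apply: contraT => xz.
  have := Hd x; rewrite mem_filter /= xz xs => /(_ isT).
  by rewrite leNgt (le_lt_trans xr rd).
exists r => //; split.
  move=> y Fy yr; have y1 : V (y - z) <= 1 by exact: le_trans r1.
  by apply: isol => //; rewrite -(decomp_root hV dg y1) ev_F Fy.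
have [|h' dg'] := decomp_sub hV (beta := z) (t := r) dg.
  by move=> x; move/le_trans; apply.
rewrite (dens_power_series r0 dg') (zero_mult_decomp hV dg); last by rewrite subrr absval0.
rewrite size_filter; congr (_%:R%:E); apply: eq_in_count => x xs /=.
by apply/eqP/idP => [->|/(isol x xs)//]; rewrite subrr absval0 ltW.
Qed.

Lemma power_series_fiber_finite (rho : R) : 0 < rho ->
  finite_set [set z : C | F z = 0 /\ V z <= rho].
Proof.
move=> rho0; have [m gm] := g_neq0.
have [s [h dg]] := decomp_exists hV 0 g_conv rho0 gm.
apply: (@sub_finite_set _ _ [set` s]); last exact: finite_seq.
move=> z [Fz zr] /=; rewrite -(decomp_root hV dg) ?ev_F ?Fz//.
by rewrite subr0.
Qed.

End PowerSeriesFiber.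

(** * The measure on the fiber *)

Section FiberMeasure.
Context {R : realType} {C : closedFieldType} (V : nonarch_absval R C).
Context (hV : is_complete V) (p : nat) (pC : p \in [pchar C]).
Context (a : rat -> C) (ha : in_P V p a) (c : C) (hnc : nonconstant a).
Context (x0 : fiber V a c).
Local Notation S := (pointed_subtype x0).
Local Notation F := (feval_sub V a c).
Local Notation dens := (dens V p a c).
Local Notation dset := (disc_trace (x0 := x0)).
Local Notation edom := (edom V a c).
Implicit Types (mu nu : {measure set (borel S) -> \bar R}) (A B : set S) (x y : S).

Let p0 n : (0 < p ^ n)%N. Proof. by rewrite expn_gt0 prime_gt0// (pcharf_prime pC). Qed.

Definition has_density mu := forall alpha r, 0 < r -> mu (dset alpha r) = (dens alpha r)%:E.

(** The quotients are eventually equal to the density, so the limit condition prescribes the value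
    on every disc. *)
Lemma zero_densityE mu : zero_density_measure p mu <-> has_density mu.
Proof.
have cvgd alpha r : 0 < r ->
    (fun n => num_zeros V (trunc_power p a c n) (disc V alpha r) * ((p ^ n)%:R^-1)%:E)%E @ \oo
    --> (dens alpha r)%:E.
  move=> r0; have [n0 Hn0] := num_zeros_dens hV pC ha c hnc alpha r0.
  apply: cvg_near_cst; exists n0 => // n /= n0n.
  rewrite trunc_powerE// Hn0// -EFinM mulfK// pnatr_eq0 -lt0n; exact: p0.
split => H alpha r r0; last by rewrite [X in _ --> X](H _ _ r0); exact: cvgd.
exact: (cvg_unique _ (H alpha r r0) (cvgd alpha r r0)).
Qed.

Lemma has_density_discs mu nu : has_density mu -> has_density nu ->
  forall A, discs A -> nu A = mu A.
Proof.
move=> hmu hnu A [->|[alpha [r [r0 ->]]]]; first by rewrite !measure0.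
by rewrite hmu// hnu.
Qed.

Lemma has_density_fin mu : has_density mu -> forall A, discs A -> (mu A < +oo)%E.
Proof.
by move=> hmu A [->|[alpha [r [r0 ->]]]]; rewrite ?measure0// hmu// ltry.
Qed.

Lemma has_density_unique mu nu : has_density mu -> has_density nu ->
  forall A : set (borel S), measurable A -> nu A = mu A.
Proof.
move=> hmu hnu; apply: (@base_measure_unique _ _ (@discs _ _ _ _ _ x0)).
- exact: discsI.
- exact: discs_open.
- by move=> U oU; exact: (discs_base hV pC ha hnc oU).
- exact: has_density_fin.
- exact: has_density_discs.
Qed.

Lemma has_density_exists : exists mu, has_density mu /\ forall A,
  mu A = ereal_inf [set mu U | U in [set U : set S | open U /\ A `<=` U]].
Proof.
have Dcompact A : discs A -> compact A by exact: (discs_compact hV pC ha hnc).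
have Dbase (U : set S) : open U -> exists2 G : nat -> set S, (forall n, discs (G n)) & U = \bigcup_n G n.
  exact: (discs_base hV pC ha hnc).
have DD : semi_setD_closed (@discs _ _ V a c x0) by exact: (discsD hV pC ha hnc).
have m0 : mass p (set0 : set S) = 0 by exact: (mass0 hV pC ha hnc).
have m_ge0 A : 0 <= mass p A by exact: (mass_ge0 hV pC ha hnc).
have madd A n (G : nat -> set S) : discs A -> (forall i, discs (G i)) ->
  trivIset setT G -> A = \bigcup_(i < n) G i -> mass p A = \sum_(i < n) mass p (G i).
  exact: (mass_additive hV pC ha hnc).
have [mu [muD muO]] := base_measure_exists (discs0 x0) (@discsI _ _ V a c x0)
  (@discs_open _ _ V a c x0) Dcompact Dbase DD m0 m_ge0 madd.
exists mu; split => // alpha r r0; rewrite muD; last exact: discs_dset.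
by rewrite mass_dset.
Qed.

Lemma measurable_dset alpha r : 0 < r -> measurable (dset alpha r : set (borel S)).
Proof. by move=> r0; apply: open_borel; exact: open_dset. Qed.

Lemma dset_center0 (r : R) : dset 0 r = [set x | V (fval x) <= r].
Proof. by apply/seteqP; split => x; rewrite /disc_trace /= subr0. Qed.

Lemma dset0_sub (r t : R) : r <= t -> dset 0 r `<=` dset 0 t.
Proof. by move=> rt x; rewrite !dset_center0 /=; move/le_trans; exact. Qed.

Lemma has_density_total mu : has_density mu ->
  mu [set: S] = ereal_sup [set (ratr e)%:E | e in [set e : rat | a e != 0]].
Proof.
move=> hmu; have k0 j : 0 < j.+1%:R :> R by [].
have [e1 e10 ae1] := hnc.
apply/eqP; rewrite eq_le; apply/andP; split.
  rewrite (_ : [set: S] = \bigcup_j dset 0 j.+1%:R); last first.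
    apply/seteqP; split => // x _; exists (Num.truncn (V (fval x))) => //.
    by rewrite dset_center0 /= ltW// truncnS_gt.
  apply: measure_bigcup_le.
  - by move=> j; exact: measurable_dset.
  - by move=> i j ij; apply: dset0_sub; rewrite ler_nat.
  - move=> j; rewrite hmu//; have [e ed] := edom_exists ha c hnc (k0 j).
    rewrite (dens0 hV pC ha hnc (k0 j) ed); have [be _ _] := ed.
    have [ae|ae] := eqVneq (a e) 0; last by apply: ereal_sup_ubound; exists e.
    apply: (@le_trans _ _ (ratr e1)%:E); last by apply: ereal_sup_ubound; exists e1.
    have -> : e = 0.
      by apply/eqP; apply: contraNT be => e0; rewrite /sub_const ae (negbTE e0) subrr.
    by rewrite lee_fin ler_rat (in_P_ge0 ha).
apply: ge_ereal_sup => _ [e ae <-].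
have [->|e0] := eqVneq e 0; first by rewrite rmorph0 measure_ge0.
have be : sub_const a c e != 0 by rewrite /sub_const (negbTE e0) subr0.
have [rho rho0 Hr] := edom_large ha be.
have [e' ed] := edom_exists ha c hnc rho0.
apply: (@le_trans _ _ (mu (dset 0 rho))).
  by rewrite hmu// (dens0 hV pC ha hnc rho0 ed) lee_fin ler_rat (Hr _ _ (lexx _) ed).
by apply: le_measure; rewrite ?inE//; exact: measurable_dset.
Qed.

(** The condition v(z) = -s cuts out the closed disc of radius exp s minus the open one. Their
    masses are the last and the first dominant exponent. *)
Lemma has_density_slope mu (s : R) : has_density mu ->
  slope_length V (sub_const a c) s = mu [set x : S | valuation V (pt_val x) = (- s)%:E].
Proof.
move=> hmu; pose rho := expR s; have rho0 : 0 < rho by exact: expR_gt0.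
have [e ed] := edom_exists ha c hnc rho0; have [e' em] := emin_exists ha c hnc rho0.
rewrite (slope_length_gauss ed em).
pose B : set S := [set x | V (fval x) < rho].
have [r /andP[r0 rrho] Hr] := edom_near_emin ha rho0 em.
have d0 : 0 < rho - r by rewrite subr_gt0.
(* Radii of closed discs exhausting the open one; they start at r for j = 0 and increase to rho. *)
pose rj (j : nat) : R := rho - (rho - r) / j.+1%:R.
have rjr j : r <= rj j.
  by rewrite /rj lerBrDr -lerBrDl ler_pdivrMr// ler_peMr ?(ltW d0)// ler1n.
have rj0 j : 0 < rj j by exact: lt_le_trans (rjr j).
have rjrho j : rj j < rho by rewrite /rj ltrBlDr ltrDl divr_gt0.
have BE : B = \bigcup_j dset 0 (rj j).
  apply/seteqP; split => [x xB|x [j _]]; last first.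
    by rewrite dset_center0 /= /B /= => H; exact: le_lt_trans (rjrho j).
  have q0 : 0 < (rho - V (fval x)) / (rho - r) by rewrite divr_gt0// subr_gt0.
  have [j /(_ j (leqnn _))] := invn_small q0; rewrite ltr_pdivlMr// => Hj; exists j => //.
  rewrite dset_center0 /= /rj lerBrDr -lerBrDl; apply: ltW.
  by rewrite mulrC.
have mB : measurable (B : set (borel S)).
  by rewrite BE; apply: bigcupT_measurable => j; exact: measurable_dset.
have muB : mu B = (ratr e')%:E.
  apply/eqP; rewrite eq_le; apply/andP; split.
    rewrite BE; apply: measure_bigcup_le.
    - by move=> j; exact: measurable_dset.
    - move=> i j ij; apply: dset0_sub; rewrite /rj lerD2l lerN2 ler_pM2l//.
      by rewrite lef_pV2 ?posrE// ler_nat.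
    - move=> j; rewrite hmu//; have [e1 ed1] := edom_exists ha c hnc (rj0 j).
      rewrite (dens0 hV pC ha hnc (rj0 j) ed1) lee_fin ler_rat.
      exact: edom_lt_emin (rj0 j) (rjrho j) ed1 em.
  have [e1 ed1] := edom_exists ha c hnc r0.
  apply: (@le_trans _ _ (mu (dset 0 r))).
    by rewrite hmu// (dens0 hV pC ha hnc r0 ed1) lee_fin ler_rat Hr.
  apply: le_measure; rewrite ?inE//; first exact: measurable_dset.
  by move=> x; rewrite dset_center0 /=; move/le_lt_trans; exact.
have -> : [set x : S | valuation V (pt_val x) = (- s)%:E] = dset 0 rho `\` B.
  apply/seteqP; split => x.
    rewrite /= /valuation -/(fval x); case: eqP => // /eqP x0' [/oppr_inj E].
    have Vx : V (fval x) = rho by rewrite /rho -E lnK// posrE absval_gt0.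
    by rewrite dset_center0 /B; split => /=; rewrite Vx// ltxx.
  rewrite dset_center0 /B => -[/= x1 /negP]; rewrite -leNgt => x2.
  have E : V (fval x) = rho by apply/le_anti; rewrite x1 x2.
  rewrite /valuation -/(fval x) -(absval_eq0 V) E gt_eqF//; congr (- _)%:E.
  by rewrite /rho expRK.
have muD : mu (dset 0 rho) = (ratr e)%:E by rewrite hmu// (dens0 hV pC ha hnc rho0 ed).
have fin : (mu (dset 0 rho) < +oo)%E by rewrite muD ltry.
rewrite measureD//; last exact: measurable_dset.
rewrite (_ : dset 0 rho `&` B = B); last first.
  by apply/setIidr => x; rewrite dset_center0 /B /= => /ltW.
by rewrite EFinB -muD -muB.
Qed.

Lemma fval_inj x y : fval x = fval y -> x = y.
Proof. by move=> H; apply: (@eqtype.val_inj _ _ (fiber V a c)). Qed.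

Lemma has_density_singleton mu : has_density mu -> is_power_series a ->
  forall x, measurable ([set x] : set (borel S)) /\
    mu [set x] = zero_mult V (fun n => sub_const a c n%:R) (pt_val x).
Proof.
move=> hmu hps x; have [r r0 [isol zm]] := dens_zero_mult hV pC ha c hnc hps (fval x).
have -> : [set x] = dset (fval x) r.
  apply/seteqP; split => [_ ->|y yx]; first by rewrite /disc_trace /= subrr absval0 ltW.
  apply: fval_inj; apply: isol yx; exact: F_val.
by split; [exact: measurable_dset|rewrite hmu// -zm].
Qed.

(** Bounded parts of the fiber are finite, so there the measure is a finite sum over points;
    exhaustion by discs gives the general case. *)
Lemma has_density_esum mu : has_density mu -> is_power_series a ->
  forall A, measurable (A : set (borel S)) -> mu A =
    (\esum_(x in A) zero_mult V (fun n => sub_const a c n%:R) (pt_val x))%E.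
Proof.
move=> hmu hps A mA; have sing := has_density_singleton hmu hps.
have finE (X : set S) : finite_set X -> measurable (X : set (borel S)) /\
    mu X = (\sum_(x \in X) zero_mult V (fun n => sub_const a c n%:R) (pt_val x))%E.
  move=> fX; have XE : X = \bigcup_(x in X) [set x].
    by apply/seteqP; split => [x Xx|x [y Xy ->]//]; exists x.
  split; first by rewrite XE; apply: fin_bigcup_measurable => // x _; exact: (sing x).1.
  rewrite {1}XE measure_fin_bigcup//; last by move=> x _; exact: (sing x).1.
    by apply: eq_fsbigr => x _; exact: (sing x).2.
  by move=> x y _ _ [z [-> ->]].
apply/eqP; rewrite eq_le; apply/andP; split; last first.
  apply: ge_ereal_sup => _ [X [fX XA] <-]; have [mX <-] := finE X fX.
  by apply: le_measure; rewrite ?inE.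
rewrite [X in (mu X <= _)%E](_ : A = \bigcup_j (A `&` dset 0 j.+1%:R)); last first.
  apply/seteqP; split => [x Ax|x [j _ []]//]; exists (Num.truncn (V (fval x))) => //.
  by split => //; rewrite dset_center0 /= ltW// truncnS_gt.
apply: measure_bigcup_le.
- by move=> j; apply: measurableI => //; exact: measurable_dset.
- by move=> i j ij; apply: setIS; apply: dset0_sub; rewrite ler_nat.
move=> j; set X := A `&` _.
have fX : finite_set X.
  have k0 : 0 < j.+1%:R :> R by [].
  have fin := power_series_fiber_finite hV pC ha c hnc hps k0.
  apply: (@sub_finite_set _ _ (@fval _ _ V a c x0 @^-1` [set z | F z = 0 /\ V z <= j.+1%:R])).
    by move=> x [_]; rewrite dset_center0 /= => xj; split => //; exact: F_val.
  by apply: finite_preimage => // x y _ _; exact: fval_inj.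
rewrite (finE X fX).2; apply: ereal_sup_ubound; exists X => //; split => //.
exact: subIsetl.
Qed.

Lemma has_density_compact mu K : has_density mu -> compact K -> (mu K < +oo)%E.
Proof.
move=> hmu cK; have k0 j : 0 < j.+1%:R :> R by [].
have mK : measurable (K : set (borel S)).
  rewrite -[K]setCK; apply: measurableC; apply: open_borel; apply: closed_openC.
  by apply: compact_closed => //; exact: fiber_hausdorff.
have cov : K `<=` cover [set: nat] (fun j => dset 0 j.+1%:R).
  move=> x _; exists (Num.truncn (V (fval x))) => //.
  by rewrite dset_center0 /= ltW// truncnS_gt.
move: cK; rewrite compact_cover => cK.
have op j : setT j -> open (dset 0 j.+1%:R) by move=> _; exact: open_dset.
have [J _ KJ] := cK nat setT _ op cov.
pose N := \max_(j <- J) j.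
apply: (@le_lt_trans _ _ (mu (dset 0 N.+1%:R))); last by rewrite hmu// ltry.
apply: le_measure; rewrite ?inE//; first exact: measurable_dset.
move=> x /KJ[j jJ]; apply: dset0_sub; rewrite ler_nat ltnS.
exact: (@leq_bigmax_seq _ _ xpredT id).
Qed.

Lemma fiber_locally_compact : locally_compact [set: S].
Proof.
move=> x _; exists (dset (fval x) 1).
  by apply: filterS (nbhs_dset x ltr01) => y.
have cD : compact (dset (fval x) 1) by exact: (compact_dset hV pC ha hnc).
by split => //; apply: compact_closed => //; exact: fiber_hausdorff.
Qed.

End FiberMeasure.

(** * Haar measure on the kernel *)

Section KernelHaar.
Context {R : realType} {C : closedFieldType} (V : nonarch_absval R C).
Context (hV : is_complete V) (p k : nat) (pC : p \in [pchar C]).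
Context (a : rat -> C) (hF : in_F V p (p ^ k) a) (hnc : nonconstant a).
Context (x0 : fiber V a 0).
Local Notation S := (pointed_subtype x0).
Local Notation F := (feval_sub V a 0).
Local Notation dset := (disc_trace (x0 := x0)).
Implicit Types (mu nu : {measure set (borel S) -> \bar R}) (A B : set S) (x y : S).

Let ha : in_P V p a. Proof. by case: hF. Qed.

Lemma kernel_group : is_locally_compact_group x0.
Proof.
split.
- by apply/fiberE; exact: (F_zero hV pC hF).
- by move=> x y /fiberE Fx /fiberE Fy; apply/fiberE; exact: (F_sub hV pC hF).
- exact: fiber_hausdorff.
- exact: (fiber_locally_compact hV pC ha hnc).
Qed.

(** Translating A by g is taking its preimage under subtraction of g. The image of mu under this map
    has the same values on discs as mu, so uniqueness identifies the two. *)
Lemma kernel_translate mu : has_density p mu ->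
  forall (g : S) A, measurable (A : set (borel S)) -> mu (translate g A) = mu A.
Proof.
move=> hmu g.
have ex (y : S) : exists z : S, fval z = fval y - fval g.
  by apply: fval_ex; apply: (F_sub hV pC hF); exact: F_val.
have [h hE] := choice ex.
have trE A : translate g A = h @^-1` A.
  apply/seteqP; split => y.
    move=> [x Ax E]; rewrite /preimage /= (_ : h y = x)//; apply: fval_inj.
    by rewrite hE [fval y]E addrC addKr.
  by move=> Ah; exists (h y) => //; have := hE y; rewrite /fval => ->; rewrite addrC subrK.
have hD alpha r : h @^-1` (dset alpha r) = dset (alpha + fval g) r.
  by apply/seteqP; split => y; rewrite /preimage /disc_trace /= hE opprD addrA addrAC.
(* Measurability is tested on discs, whose preimages are translated discs. *)
have mh : measurable_fun [set: borel S] (h : borel S -> borel S).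
  apply: (@measurability _ _ (borel S) (borel S) setT h (@discs _ _ V a 0 x0)).
    apply/esym; apply: sigma_base; first exact: discs_open.
    exact: (discs_base hV pC ha hnc).
  move=> _ [B [->|[alpha [r [r0 ->]]]] <-]; rewrite setTI; first by rewrite preimage_set0; exact: measurable0.
  by rewrite hD; exact: measurable_dset.
have mhA (A : set S) : measurable (A : set (borel S)) -> measurable (h @^-1` A : set (borel S)).
  by move=> mA; rewrite -[X in measurable X]setTI; exact: mh.
pose nuf (A : set (borel S)) : \bar R := mu (h @^-1` A).
have nu0 : nuf set0 = 0%E by rewrite /nuf preimage_set0 measure0.
have nu_ge0 A : (0 <= nuf A)%E by exact: measure_ge0.
have nuS : semi_sigma_additive nuf.
  move=> G mG tG mUG; rewrite /nuf preimage_bigcup.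
  apply: measure_semi_sigma_additive; first by move=> i; exact: mhA.
    apply/trivIsetP => i j _ _ ij; rewrite -preimage_setI.
    by move/trivIsetP : tG => /(_ _ _ I I ij) ->; rewrite preimage_set0.
  by rewrite -preimage_bigcup; exact: mhA.
pose nu : {measure set (borel S) -> \bar R} :=
  HB.pack nuf (isMeasure.Build _ (borel S) R nuf nu0 nu_ge0 nuS).
have hnu : has_density p nu.
  move=> alpha r r0; rewrite /= /nuf hD hmu//; congr EFin.
  by apply: (dens_translate hV pC hF hnc _ r0); exact: F_val.
by move=> A mA; rewrite trE; exact: (has_density_unique hV pC ha hnc hmu hnu mA).
Qed.

Lemma kernel_haar mu : has_density p mu ->
  (forall A, mu A = ereal_inf [set mu U | U in [set U : set S | open U /\ A `<=` U]]) ->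
  is_haar_measure mu.
Proof.
move=> hmu outer; split.
- rewrite (has_density_total hV pC ha hnc hmu) => H.
  have [e1 e10 ae1] := hnc.
  have : ((ratr e1)%:E <= 0 :> \bar R)%E by rewrite -H; apply: ereal_sup_ubound; exists e1.
  by rewrite lee_fin lerq0 leNgt lt_neqAle eq_sym e10 (in_P_ge0 ha).
- exact: kernel_translate.
- by move=> K; exact: (has_density_compact hmu).
- by move=> A _; exact: outer.
- move=> U oU; apply: (@base_measure_inner _ _ (@discs _ _ V a 0 x0)) => //.
  + exact: discs_open.
  + exact: (discs_compact hV pC ha hnc).
  + exact: (discs_base hV pC ha hnc).
  + exact: fiber_hausdorff.
Qed.

End KernelHaar.

Theorem theorem5p7 (R : realType) (p k q : nat) (hp : prime p)
    (hq : q = (p ^ k)%N) (Fq : finFieldType) (hFq : #|Fq| = q)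
    (C : closedFieldType) (iota : {rmorphism Fq -> C})
    (V : nonarch_absval R C) (hV : is_complete V)
    (a : rat -> C) (ha : in_P V p a) (hnc : nonconstant a) (c : C) :
  exists (x0 : fiber V a c)
         (mu : {measure set (borel (pointed_subtype x0)) -> \bar R}),
    zero_density_measure p mu
    /\ (forall nu : {measure set (borel (pointed_subtype x0)) -> \bar R},
          zero_density_measure p nu ->
          forall A : set (borel (pointed_subtype x0)),
            measurable A -> nu A = mu A)
    /\ (forall s : R, slope_length V (sub_const a c) s =
          mu [set x : pointed_subtype x0 |
                valuation V (pt_val x) = (- s)%:E])
    /\ mu [set: pointed_subtype x0] =
         ereal_sup [set (ratr e)%:E | e in [set e : rat | a e != 0]]
    /\ (is_power_series a ->
          (forall x : pointed_subtype x0,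
             mu [set x] =
             zero_mult V (fun n => sub_const a c n%:R) (pt_val x))
          /\ (forall A : set (pointed_subtype x0),
                measurable (A : set (borel (pointed_subtype x0))) ->
                mu A = (\esum_(x in A)
                  zero_mult V (fun n => sub_const a c n%:R) (pt_val x))%E))
    /\ (in_F V p q a -> (exists e, a e != 0) -> c = 0 ->
          is_locally_compact_group x0 /\ is_haar_measure mu).
Proof.
have pC : p \in [pchar C].
  by apply: (rmorph_pchar iota); apply: (@card_finPcharP _ _ k); rewrite // hFq.
(* Measurable types are pointed, so a zero is needed before a measure on the fiber can be
   introduced. *)
have [z Fz] := fiber_nonempty hV pC ha c hnc.
have fz : fiber V a c z by apply/fiberE.
pose x0 : fiber V a c := exist (fun z => z \in fiber V a c) z (mem_set fz).
have [mu [hmu outer]] := has_density_exists hV pC ha hnc x0.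
exists x0, mu; split; first exact/(zero_densityE hV pC ha hnc).
split.
  move=> nu /(zero_densityE hV pC ha hnc) hnu A mA.
  exact: (has_density_unique hV pC ha hnc hmu hnu mA).
split; first by move=> s; exact: (has_density_slope hV pC ha hnc _ hmu).
split; first exact: (has_density_total hV pC ha hnc hmu).
split.
  move=> hps; split; last exact: (has_density_esum hV pC ha hnc hmu hps).
  by move=> x; exact: (has_density_singleton hV pC ha hnc hmu hps x).2.
move=> hF _ c0; subst c q; split; first exact: (kernel_group hV pC hF hnc).
exact: (kernel_haar hV pC hF hnc hmu outer).
Qed.
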